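(* Let $X$ be a smooth complex projective variety of complex dimension $m$ and $n\ge1$. The bihomogeneous components $E_q^k(X,n)$ of the Kriz model decompose as a direct sum of monogenic (i.e. generated by one element) $\mathcal{S}_n$-submodules $$E_q^k(X,n)=\bigoplus_{\substack{|L_*|=q\\ |H_*|=k-q(2m-1)}}E_q^k(L_*,H_* ),$$ the sum being over types $(L_*,H_* )$. In particular, the multiplicities of the irreducible $\mathcal{S}_n$-modules in each term $E_q^k(L_*,H_* )=\bigoplus_{\lambda\vdash n}m_\lambda V(\lambda)$ satisfy $m_\lambda\le\dim V(\lambda)$.
   Context: $X$ is connected of complex dimension $m\ge 1$; $H^*(X)=H^*(X;\mathbb{Q})$; $w\in H^{2m}(X)$ is the fundamental class; $\Delta\in H^*(X)\otimes H^*(X)$ is the class of the diagonal; $p_i^*:H^*(X)\to H^*(X^n)$, $p_{ij}^*:H^*(X^2)\to H^*(X^n)$ are the pullbacks along the projections. Kriz model $E(X,n)$: the graded-commutative algebra obtained from the exterior algebra with generators $G_{ij}$ ($1\le i\neq j\le n$) of degree $2m-1$ and coefficients in $H^*(X)^{\otimes n}$, modulo $G_{ji}=G_{ij}$; $p_j^*(x)G_{ij}=p_i^*(x)G_{ij}$ ($i<j$, $x\in H^*(X)$); $G_{ik}G_{jk}=G_{ij}G_{jk}-G_{ij}G_{ik}$ ($i<j<k$); with derivation $d$, $d|_{H^*(X)^{\otimes n}}=0$, $d(G_{ij})=p_{ij}^*(\Delta)$. $E_q^k(X,n)$ is the part with $q$ exterior generators and total degree $k$. $\mathcal{S}_n$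 acts by algebra automorphisms via $\sigma(p_i^*(x))=p_{\sigma(i)}^*(x)$, $\sigma(G_{ij})=G_{\sigma(i)\sigma(j)}$. Fix a homogeneous ordered basis $\mathcal{B}=\{x_1=1\prec x_2\prec\dots\prec x_B=w\}$ of $H^*(X)$ with $\deg x_i$ nondecreasing in $i$. The canonical basis of $E_q^k(X,n)$ consists of the monomials $p_1^*(x_{h_1})\cdots p_n^*(x_{h_n})\,G_{i_1j_1}\cdots G_{i_qj_q}$ with $x_{h_a}\in\mathcal{B}$, $i_a<j_a$, $j_1<\dots<j_q$, $x_{h_a}=1$ whenever $a\in\{j_1,\dots,j_q\}$, and total degree $k$. The marked graph of such a monomial has vertices $1,\dots,n$ and edges $\{i_a,j_a\}$ (it is a forest); the mark of a connected component is the element $x_{h_i}$, $i$ being the smallest vertex of that component. A type $(L_*,H_* )$ is a partition $L_*=(\lambda_1\ge\dots\ge\lambda_t\ge1)$ of $n$ together with $H_*=(h_1,\dots,h_t)$, $x_{h_i}\in\mathcal{B}$, such that $x_{h_i}\succeq x_{h_{i+1}}$ whenever $\lambda_i=\lambda_{i+1}$. The subspace of type $(L_*,H_* )$, denoted $E_*^*(L_*,H_* )$ (or $E_q^k(L_*,H_* )$ to show its bidegree), is the linear span of the canonical basis monomials whose marked graph has $t$ components which can be numbered so that the $i$-th has $\lambda_i$ vertices and mark $x_{h_i}$. Put $|L_*|=\sum_{i=1}^t(\lambda_i-1)$ and $|H_*|=\sum_{i=1}^t\deg(x_{h_i})$. $V(\lambda)$ is the irreducible $\mathcal{S}_n$-module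 of the partition $\lambda\vdash n$ ($V(n)$ trivial). *)

(* Defs.v *)
From HB Require Import structures.
From mathcomp Require Import all_boot all_order all_algebra all_fingroup.
From mathcomp Require Import falgebra.
From mathcomp Require Import boolp classical_sets functions.
From mathcomp Require Import monalg generic_quotient.

Set Implicit Arguments.
Unset Strict Implicit.
Unset Printing Implicit Defensive.

Import GRing.Theory.
Local Open Scope ring_scope.
Local Open Scope quotient_scope.
Local Open Scope classical_set_scope.

Section LinearAlgebra.
Variable V : lmodType rat.
Implicit Types (S W : set V).

Definition lspan S : set V :=
  [set v | exists2 c : seq (rat * V), (forall a, a \in c -> S a.2)
           & v = \sum_(a <- c) a.1 *: a.2].

Definition is_subspace W : Prop :=
  W 0 /\ forall (a : rat) u v, W u -> W v -> W (a *: u + v).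

Definition is_direct_sum (I : finType) (P : pred I) (U : I -> set V) W : Prop :=
  [/\ forall i, P i -> is_subspace (U i),
      W = [set v | exists2 u : I -> V, (forall i, P i -> U i (u i))
                   & v = \sum_(i | P i) u i]
    & forall u : I -> V, (forall i, P i -> U i (u i)) ->
        \sum_(i | P i) u i = 0 -> forall i, P i -> u i = 0].

End LinearAlgebra.

(* Left S_n-modules.  MathComp composes permutations from left to right, *)
(* (s * t) i = t (s i), so a left action satisfies *)
(* act s (act t v) = act (t * s) v. *)
Section Modules.
Variables (n : nat) (V : lmodType rat) (act : 'S_n -> V -> V).

Definition is_submodule (W : set V) : Prop :=
  is_subspace W /\ forall s v, W v -> W (act s v).

Definition is_monogenic (W : set V) : Prop :=
  is_submodule W /\
  exists2 g, W g & W = lspan [set act s g | s in [set: 'S_n]].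

End Modules.

Definition module_iso (n : nat) (V V' : lmodType rat) (act : 'S_n -> V -> V)
    (act' : 'S_n -> V' -> V') (U : set V) (U' : set V') : Prop :=
  exists2 f : {linear V -> V'}, set_bij U U' f
    & forall s u, U u -> f (act s u) = act' s (f u).

Definition is_partition (n : nat) (L : seq nat) : bool :=
  [&& sorted geq L, all (leq 1) L & sumn L == n].

(* A partition of n has at most n parts, each at most n: the bounds only serve *)
(* to make the type finite. *)
Definition intpart (n : nat) :=
  {L : n.-bseq 'I_n.+1 | is_partition n [seq val l | l <- L]}.
HB.instance Definition _ n := Finite.on (intpart n).

Definition parts (n : nat) (L : intpart n) : seq nat :=
  [seq val l | l <- val L].

Section Specht.
Variable n : nat.

(* The group algebra of S_n, with f standing for \sum_s f(s) s. *)
Definition group_alg := {ffun 'S_n -> rat^o}.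
HB.instance Definition _ := Vector.on group_alg.

Definition group_alg_act (s : 'S_n) (f : group_alg) : group_alg :=
  [ffun t : 'S_n => f (t * s^-1)%g].

Variable lam : intpart n.

(* The tableau filled row after row with 0, ..., n-1. *)
Definition tab_row (i : 'I_n) : nat := reshape_index (parts lam) i.
Definition tab_col (i : 'I_n) : nat := reshape_offset (parts lam) i.

Definition row_group : {set 'S_n} :=
  [set s : 'S_n | [forall i, tab_row (s i) == tab_row i]].
Definition col_group : {set 'S_n} :=
  [set s : 'S_n | [forall i, tab_col (s i) == tab_col i]].

(* \sum_p \sum_q sgn(q) (p o q), where p o q is q * p in MathComp. *)
Definition young_symmetrizer : group_alg :=
  [ffun s : 'S_n => \sum_(p in row_group) \sum_(q in col_group)
     (-1) ^+ q * (s == (q * p)%g)%:R].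

(* V(lam), as the left ideal generated by the Young symmetrizer. *)
Definition specht : {vspace group_alg} :=
  <<[seq group_alg_act s young_symmetrizer | s : 'S_n]>>%VS.

End Specht.

(* The external direct sum of mu(lam) copies of V(lam), lam |- n. *)
Section SpechtSum.
Variables (n : nat) (mu : intpart n -> nat).

Definition specht_sum_ambient :=
  {ffun {lam : intpart n & 'I_(mu lam)} -> group_alg n}.
HB.instance Definition _ := GRing.Lmodule.on specht_sum_ambient.

Definition specht_sum : set specht_sum_ambient :=
  [set v | forall i, v i \in specht (tag i)].

Definition specht_sum_act (s : 'S_n) (v : specht_sum_ambient) :
    specht_sum_ambient :=
  [ffun i => group_alg_act s (v i)].

End SpechtSum.

Definition has_multiplicities (n : nat) (V : lmodType rat)
    (act : 'S_n -> V -> V) (W : set V) (mu : intpart n -> nat) : Prop :=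
  module_iso (@specht_sum_act n mu) act (@specht_sum n mu) W.

(* Quotient of an algebra by the two-sided ideal generated by relations. *)
Section Quotient.
Variables (A : algType rat) (R : A -> A -> Prop).

Inductive rel_ideal : A -> Prop :=
| rel_ideal_gen r s : R r s -> rel_ideal (r - s)
| rel_ideal0 : rel_ideal 0
| rel_idealD u v : rel_ideal u -> rel_ideal v -> rel_ideal (u + v)
| rel_idealM a b u : rel_ideal u -> rel_ideal (a * u * b).

Definition rel_pred : {pred A} := fun u => `[< rel_ideal u >].

Lemma rel_predP u : reflect (rel_ideal u) (u \in rel_pred).
Proof. exact: asboolP. Qed.

Fact rel_pred_zmod : zmod_closed rel_pred.
Proof.
split=> [|u v /rel_predP Iu /rel_predP Iv]; apply/rel_predP.
  exact: rel_ideal0.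
apply: rel_idealD => //; rewrite -[v]mul1r -mulNr -[_ * v]mulr1.
exact: rel_idealM.
Qed.
HB.instance Definition _ := GRing.isZmodClosed.Build A rel_pred rel_pred_zmod.

Definition presented := Quotient.quot rel_pred.
HB.instance Definition _ := GRing.Zmodule.on presented.

Definition presented_proj : A -> presented := fun u => \pi u.

Lemma presented_eqP u v :
  reflect (presented_proj u = presented_proj v) (u - v \in rel_pred).
Proof. by rewrite Quotient.idealrBE; apply: eqP. Qed.

Lemma presented_ind (Q : presented -> Prop) :
  (forall u, Q (presented_proj u)) -> forall x, Q x.
Proof. by move=> QP x; rewrite -[x]reprK; apply: QP. Qed.

Fact presented_proj_zmod : zmod_morphism presented_proj.
Proof.
move=> u v; rewrite /presented_proj.
exact: (raddfB (\pi_(Quotient.quot rel_pred))).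
Qed.
HB.instance Definition _ :=
  GRing.isZmodMorphism.Build A presented presented_proj presented_proj_zmod.

End Quotient.

(* Locked to keep unification fast. *)
HB.lock Definition presented_mul (A : algType rat) (R : A -> A -> Prop)
  (x y : presented R) : presented R := presented_proj R (repr x * repr y).
HB.lock Definition presented_scale (A : algType rat) (R : A -> A -> Prop)
  (c : rat) (x : presented R) : presented R := presented_proj R (c *: repr x).

Section QuotientAlgebra.
Variables (A : algType rat) (R : A -> A -> Prop).
Local Notation presented := (presented R).
Local Notation presented_proj := (presented_proj R).
Local Notation presented_mul := (@presented_mul A R).
Local Notation presented_scale := (@presented_scale A R).
Local Notation rel_pred := (rel_pred R).
Local Notation rel_ideal := (rel_ideal R).

Lemma rel_predM a b u : u \in rel_pred -> a * u * b \in rel_pred.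
Proof. by move/rel_predP=> Iu; apply/rel_predP/rel_idealM. Qed.

Lemma repr_rel u : repr (presented_proj u) - u \in rel_pred.
Proof. by apply/presented_eqP; rewrite {1}/presented_proj reprK. Qed.

Lemma presented_mulE u v :
  presented_mul (presented_proj u) (presented_proj v) = presented_proj (u * v).
Proof.
rewrite unlock; apply/presented_eqP; set u' := repr _; set v' := repr _.
have -> : u' * v' - u * v = 1 * (u' - u) * v' + u * (v' - v) * 1.
  by rewrite mul1r mulr1 mulrBl mulrBr addrA subrK.
by apply: rpredD; apply: rel_predM; apply: repr_rel.
Qed.

Lemma presented_scaleE c u :
  presented_scale c (presented_proj u) = presented_proj (c *: u).
Proof.
rewrite unlock; apply/presented_eqP; rewrite -scalerBr -mulr_algl -[_ * _]mulr1.
by apply: rel_predM; apply: repr_rel.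
Qed.

Fact presented_mulA : associative presented_mul.
Proof.
by elim/presented_ind=> u; elim/presented_ind=> v; elim/presented_ind=> w;
  rewrite !presented_mulE mulrA.
Qed.
Fact presented_mul1 : left_id (presented_proj 1) presented_mul.
Proof. by elim/presented_ind=> u; rewrite presented_mulE mul1r. Qed.
Fact presented_mulr1 : right_id (presented_proj 1) presented_mul.
Proof. by elim/presented_ind=> u; rewrite presented_mulE mulr1. Qed.
Fact presented_mulDl : left_distributive presented_mul +%R.
Proof.
by elim/presented_ind=> u; elim/presented_ind=> v; elim/presented_ind=> w;
  rewrite -raddfD !presented_mulE mulrDl raddfD.
Qed.
Fact presented_mulDr : right_distributive presented_mul +%R.
Proof.
by elim/presented_ind=> u; elim/presented_ind=> v; elim/presented_ind=> w;
  rewrite -raddfD !presented_mulE mulrDr raddfD.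
Qed.
HB.instance Definition _ := GRing.Zmodule_isPzRing.Build presented
  presented_mulA presented_mul1 presented_mulr1 presented_mulDl presented_mulDr.

Fact presented_scaleA a b x :
  presented_scale a (presented_scale b x) = presented_scale (a * b) x.
Proof. by elim/presented_ind: x => u; rewrite !presented_scaleE scalerA. Qed.
Fact presented_scale1 : left_id 1 presented_scale.
Proof. by elim/presented_ind=> u; rewrite presented_scaleE scale1r. Qed.
Fact presented_scaleDr : right_distributive presented_scale +%R.
Proof.
move=> c; elim/presented_ind=> u; elim/presented_ind=> v.
by rewrite -raddfD !presented_scaleE scalerDr raddfD.
Qed.
Fact presented_scaleDl x : {morph presented_scale^~ x : a b / a + b}.
Proof.
move=> a b; elim/presented_ind: x => u.
by rewrite !presented_scaleE scalerDl raddfD.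
Qed.
HB.instance Definition _ := GRing.Zmodule_isLmodule.Build rat presented
  presented_scaleA presented_scale1 presented_scaleDr presented_scaleDl.

Fact presented_proj_monoid : monoid_morphism presented_proj.
Proof. by split=> // u v; apply/esym/presented_mulE. Qed.
HB.instance Definition _ :=
  GRing.isMonoidMorphism.Build A presented presented_proj presented_proj_monoid.

Fact presented_proj_scalable : scalable presented_proj.
Proof. by move=> c u; apply/esym/presented_scaleE. Qed.
HB.instance Definition _ :=
  GRing.isScalable.Build rat A presented *:%R presented_proj
    presented_proj_scalable.

Lemma presented_projM u v :
  presented_proj u * presented_proj v = presented_proj (u * v).
Proof. exact: presented_mulE. Qed.

Lemma presented_projZ c u : c *: presented_proj u = presented_proj (c *: u).
Proof. exact: presented_scaleE. Qed.

Lemma presented_scalerAl c (x y : presented) : c *: (x * y) = (c *: x) * y.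
Proof.
elim/presented_ind: x => u; elim/presented_ind: y => v.
by rewrite ?(presented_projM, presented_projZ) scalerAl.
Qed.

Lemma presented_scalerAr c (x y : presented) : c *: (x * y) = x * (c *: y).
Proof.
elim/presented_ind: x => u; elim/presented_ind: y => v.
by rewrite ?(presented_projM, presented_projZ) scalerAr.
Qed.

Lemma presented_relE r s : R r s -> presented_proj r = presented_proj s.
Proof. by move=> Rrs; apply/presented_eqP/rel_predP/rel_ideal_gen. Qed.

Section Map.
Variables (f : {lrmorphism A -> A}).
Hypothesis fR : forall r s, R r s -> presented_proj (f r) = presented_proj (f s).

Definition presented_map (x : presented) : presented :=
  presented_proj (f (repr x)).

Lemma presented_map_rel u : u \in rel_pred -> f u \in rel_pred.
Proof.
move/rel_predP=> Iu; apply/rel_predP.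
elim: Iu => [r s /fR/presented_eqP/rel_predP|||a b w _ Iw].
- by rewrite rmorphB.
- by rewrite rmorph0; apply: rel_ideal0.
- by move=> v w _ Iv _ Iw; rewrite rmorphD; apply: rel_idealD.
- by rewrite !rmorphM; apply: rel_idealM.
Qed.

Lemma presented_mapE u :
  presented_map (presented_proj u) = presented_proj (f u).
Proof. by apply/presented_eqP; rewrite -rmorphB presented_map_rel ?repr_rel. Qed.

End Map.

End QuotientAlgebra.

Section FreeAlgebra.
Variable I : choiceType.

Definition free_alg := {malg rat[{fmonom I}]}.
HB.instance Definition _ := GRing.Lalgebra.on free_alg.

Lemma malgC_comm (c : rat) (u : {malg rat[{fmonom I}]}) :
  u * c%:MP = c%:MP * u.
Proof.
rewrite malgM_def fgmulgU mul_malgC malgZ_def.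
by apply: eq_bigr => k _; rewrite mulm1 mulrC.
Qed.

Fact free_scalerAr (c : rat) (u v : free_alg) : c *: (u * v) = u * (c *: v).
Proof. by rewrite -!mul_malgC !mulrA malgC_comm. Qed.
HB.instance Definition _ :=
  GRing.Lalgebra_isAlgebra.Build rat free_alg free_scalerAr.

End FreeAlgebra.

(* Locked to keep unification fast. *)
HB.lock Definition free_gen (I : choiceType) (i : I) : free_alg I := << fmu i >>.

Section Lift.
Variables (I : choiceType) (B : algType rat) (g : I -> B).

Definition free_lift_word (w : {fmonom I}) : B := \prod_(i <- w) g i.

Fact free_lift_word_mmorphism : mmorphism free_lift_word.
Proof.
by split=> [u v|]; rewrite /free_lift_word ?fmM ?big_cat // fm1 big_nil.
Qed.
HB.instance Definition _ :=
  isMultiplicative.Build {fmonom I} B free_lift_word free_lift_word_mmorphism.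

Definition free_lift : free_alg I -> B :=
  fun u => mmap (in_alg B) free_lift_word u.

Fact free_lift_zmod : zmod_morphism free_lift.
Proof. exact: mmap_is_additive. Qed.
HB.instance Definition _ :=
  GRing.isZmodMorphism.Build (free_alg I) B free_lift free_lift_zmod.

Fact free_lift_monoid : monoid_morphism free_lift.
Proof.
have [|M1 M2] := @commr_mmap_is_multiplicative {fmonom I} rat B (in_alg B)
  free_lift_word; last by split.
by move=> u v w; rewrite /GRing.comm /= mulr_algl mulr_algr.
Qed.
HB.instance Definition _ :=
  GRing.isMonoidMorphism.Build (free_alg I) B free_lift free_lift_monoid.

Fact free_lift_scalable : scalable free_lift.
Proof.
by move=> c u; rewrite /free_lift mmapZ /= mulr_algl.
Qed.
HB.instance Definition _ :=
  GRing.isScalable.Build rat (free_alg I) B *:%R free_lift free_lift_scalable.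

Lemma free_lift_gen i : free_lift (free_gen i) = g i.
Proof.
by rewrite unlock /free_lift mmapU /= scale1r mul1r /free_lift_word fmU big_seq1.
Qed.

End Lift.

(* The data of H^*(X; Q), for X of complex dimension m, that enter the Kriz *)
(* model: a finite-dimensional connected graded-commutative algebra of formal *)
(* dimension 2m satisfying Poincare duality with respect to the fundamental *)
(* class w. *)
Record cohomology (m : nat) := Cohomology {
  coh_alg :> falgType rat;
  coh : nat -> {vspace coh_alg};
  fund_class : coh_alg;
  _ : (\sum_(k < (2 * m).+1) coh k)%VS = fullv;
  _ : directv (\sum_(k < (2 * m).+1) coh k);
  _ : forall k, (2 * m < k)%N -> coh k = 0%VS;
  _ : coh 0 = <[1]>%VS;
  _ : forall a b x y, x \in coh a -> y \in coh b -> x * y \in coh (a + b);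
  _ : forall a b x y, x \in coh a -> y \in coh b ->
        x * y = (-1) ^+ (a * b) * (y * x);
  _ : fund_class != 0;
  _ : coh (2 * m) = <[fund_class]>%VS;
  _ : forall a x, (a <= 2 * m)%N -> x \in coh a -> x != 0 ->
        exists2 y, y \in coh (2 * m - a) & x * y = fund_class
}.

(* The basis x_1 = 1, ..., x_B = w is indexed from 0 by 'I_(hb_last.+1), and *)
(* ordered by its indices. *)
Record homogeneous_basis (m : nat) (X : cohomology m) := HomogeneousBasis {
  hb_last : nat;
  hb :> 'I_hb_last.+1 -> X;
  hb_deg : 'I_hb_last.+1 -> nat;
  _ : basis_of fullv (codom hb);
  _ : forall h, hb h \in coh X (hb_deg h);
  _ : forall h h' : 'I_hb_last.+1, (h <= h')%N -> (hb_deg h <= hb_deg h')%N;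
  _ : hb ord0 = 1;
  _ : hb ord_max = fund_class X
}.

Definition hb_index (m : nat) (X : cohomology m) (B : homogeneous_basis X) :=
  'I_(hb_last B).+1.
HB.instance Definition _ m (X : cohomology m) (B : homogeneous_basis X) :=
  Finite.on (hb_index B).

(* The Arnold relation for i < j < k implies all its permutations. *)
Lemma arnold_perm (n : nat) (E : pzRingType) (g : 'I_n -> 'I_n -> E) :
  (forall i j, g j i = g i j) ->
  (forall i j k l, g i j * g k l = - (g k l * g i j)) ->
  (forall i j k : 'I_n, (i < j < k)%N ->
     g i k * g j k = g i j * g j k - g i j * g i k) ->
  forall i j k : 'I_n, i != j -> j != k -> i != k ->
    g i k * g j k = g i j * g j k - g i j * g i k.
Proof.
move=> gC gA A0; pose A (i j k : 'I_n) :=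
  g i k * g j k = g i j * g j k - g i j * g i k.
have A12 a b c : A a b c -> A b a c.
  by rewrite /A (gC a b) (gA b c a c) => ->; rewrite opprB.
have A23 a b c : A a b c -> A a c b.
  by rewrite /A (gC b c) => ->; rewrite (gA a c a b) opprK subrK.
move=> i j k ij jk ik; rewrite -/(A i j k).
case: (ltngtP i j) (ij) => [lij|lij|/val_inj->]; last by rewrite eqxx.
all: case: (ltngtP j k) (jk) => [ljk|ljk|/val_inj->]; last by rewrite eqxx.
all: case: (ltngtP i k) (ik) => [lik|lik|/val_inj->]; last by rewrite eqxx.
all: move=> _ _ _; try by (apply: A0; rewrite ?lij ?ljk ?lik).
all: try by (apply/A12/A0; rewrite ?lij ?ljk ?lik).
all: try by (apply/A23/A0; rewrite ?lij ?ljk ?lik).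
all: try by (apply/A12/A23/A0; rewrite ?lij ?ljk ?lik).
all: try by (apply/A23/A12/A0; rewrite ?lij ?ljk ?lik).
all: try by (apply/A12/A23/A12/A0; rewrite ?lij ?ljk ?lik).
Qed.

Section KrizRelations.
Variables (m n : nat) (X : cohomology m) (A : algType rat).
Variables (P : 'I_n -> X -> A) (G : 'I_n -> 'I_n -> A).

(* P i x and G i j stand for p_i^*(x) and G_ij.  The first four relations *)
(* present the n-fold tensor power of H^*(X) as the coproduct of n copies of *)
(* H^*(X) in graded-commutative algebras; kriz_Gii discards the symbols G_ii, *)
(* which are not generators of the model.  The signs use that the degree 2m-1 *)
(* of G_ij is odd. *)
Inductive kriz_rel : A -> A -> Prop :=
| kriz_lin i (c : rat) x y : kriz_rel (P i (c *: x + y)) (c *: P i x + P i y)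
| kriz_one i : kriz_rel (P i 1) 1
| kriz_mul i x y : kriz_rel (P i (x * y)) (P i x * P i y)
| kriz_PP i j a b x y : x \in coh X a -> y \in coh X b ->
    kriz_rel (P i x * P j y) ((-1) ^+ (a * b) * (P j y * P i x))
| kriz_GP i j k a x : x \in coh X a ->
    kriz_rel (G i j * P k x) ((-1) ^+ a * (P k x * G i j))
| kriz_GG i j k l : kriz_rel (G i j * G k l) (- (G k l * G i j))
| kriz_sqr i j : kriz_rel (G i j * G i j) 0
| kriz_Gii i : kriz_rel (G i i) 0
| kriz_sym i j : kriz_rel (G j i) (G i j)
| kriz_PG (i j : 'I_n) x : (i < j)%N -> kriz_rel (P j x * G i j) (P i x * G i j)
| kriz_arnold (i j k : 'I_n) : (i < j < k)%N ->
    kriz_rel (G i k * G j k) (G i j * G j k - G i j * G i k).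

Local Notation pi := (presented_proj kriz_rel).

Let relE r s : kriz_rel r s -> pi r = pi s.
Proof. exact: presented_relE. Qed.

Let G_sym i j : pi (G j i) = pi (G i j).
Proof. exact/relE/kriz_sym. Qed.

Let G_anti i j k l : pi (G i j) * pi (G k l) = - (pi (G k l) * pi (G i j)).
Proof. by rewrite !presented_projM -raddfN; apply/relE/kriz_GG. Qed.

Let p_G i j x : pi (P j x) * pi (G i j) = pi (P i x) * pi (G i j).
Proof.
case: (ltngtP i j) => [ij|ji|/val_inj-> //].
  by rewrite !presented_projM; apply/relE/kriz_PG.
by rewrite -G_sym !presented_projM; apply/esym/relE/kriz_PG.
Qed.

Let piB u v : pi (u - v) = pi u - pi v.
Proof. exact: raddfB. Qed.

Let arnold := arnold_perm G_sym G_anti (fun i j k ijk =>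
  etrans (presented_projM _ _ _) (etrans (relE (kriz_arnold ijk))
    (etrans (piB _ _) (esym (congr2 (fun u v => u - v)
      (presented_projM _ _ _) (presented_projM _ _ _)))))).

Lemma kriz_rel_act (f : {lrmorphism A -> A}) (s : 'S_n) :
    (forall i x, f (P i x) = P (s i) x) ->
    (forall i j, f (G i j) = G (s i) (s j)) ->
  forall r r', kriz_rel r r' -> pi (f r) = pi (f r').
Proof.
move=> fP fG r r'.
have sI (i j : 'I_n) : (i < j)%N -> s i != s j.
  by move=> ij; rewrite (inj_eq perm_inj) -val_eqE ltn_eqF.
have fL c u v : f (c *: u + v) = c *: f u + f v by exact: linearP.
have fM u v : f (u * v) = f u * f v by exact: rmorphM.
have fB u v : f (u - v) = f u - f v by exact: rmorphB.
have fN u : f (- u) = - f u by exact: rmorphN.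
have f0 : f 0 = 0 by exact: rmorph0.
have f1 : f 1 = 1 by exact: rmorph1.
have fS k : f ((-1) ^+ k) = (-1) ^+ k by exact: rmorph_sign.
case=> [i c x y|i|i x y|i j a b x y Xx Yy|i j k a x Xx|i j k l|i j|i|i j
       |i j x ij|i j k /andP[ij jk]].
- by rewrite fL !fP; apply/relE/kriz_lin.
- by rewrite fP f1; apply/relE/kriz_one.
- by rewrite fM !fP; apply/relE/kriz_mul.
- by rewrite !fM fS !fP; apply/relE/kriz_PP.
- by rewrite !fM fS fP fG; apply/relE/kriz_GP.
- by rewrite fN !fM !fG; apply/relE/kriz_GG.
- by rewrite fM f0 fG; apply/relE/kriz_sqr.
- by rewrite fG f0; apply/relE/kriz_Gii.
- by rewrite !fG; apply/relE/kriz_sym.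
- by rewrite !fM !fP fG -!presented_projM; apply: p_G.
- rewrite fB !fM !fG piB -!presented_projM; apply: arnold; try exact: sI.
  by apply/sI/(ltn_trans ij).
Qed.

End KrizRelations.

Section KrizModel.
Variables (m n : nat) (X : cohomology m).

(* inl (i, x) stands for p_i^*(x), inr (i, j) for G_ij. *)
Definition kriz_gen := ('I_n * X + 'I_n * 'I_n)%type.
HB.instance Definition _ := Choice.on kriz_gen.

Definition free_p (i : 'I_n) (x : X) : free_alg kriz_gen :=
  free_gen (inl (i, x) : kriz_gen).
Definition free_G (i j : 'I_n) : free_alg kriz_gen :=
  free_gen (inr (i, j) : kriz_gen).

(* The underlying bigraded algebra of the Kriz model; its differential,
   d(G_ij) = p_ij^*(Delta), plays no role below. *)
Definition kriz := presented (kriz_rel free_p free_G).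
HB.instance Definition _ := GRing.PzRing.on kriz.
HB.instance Definition _ := GRing.Lmodule.on kriz.

Definition kriz_proj : free_alg kriz_gen -> kriz :=
  presented_proj (kriz_rel free_p free_G).
HB.instance Definition _ := GRing.RMorphism.on kriz_proj.
HB.instance Definition _ := GRing.Linear.on kriz_proj.

Definition kriz_p (i : 'I_n) (x : X) : kriz := kriz_proj (free_p i x).
Definition kriz_G (i j : 'I_n) : kriz := kriz_proj (free_G i j).

Definition kriz_gen_act (s : 'S_n) (g : kriz_gen) : kriz_gen :=
  match g with
  | inl (i, x) => inl (s i, x)
  | inr (i, j) => inr (s i, s j)
  end.

Definition kriz_free_act (s : 'S_n) : free_alg kriz_gen -> free_alg kriz_gen :=
  free_lift (fun g => free_gen (kriz_gen_act s g)).
HB.instance Definition _ s := GRing.RMorphism.on (kriz_free_act s).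
HB.instance Definition _ s := GRing.Linear.on (kriz_free_act s).

Definition kriz_act (s : 'S_n) : kriz -> kriz :=
  presented_map (kriz_free_act s).

Lemma kriz_actE (s : 'S_n) u :
  kriz_act s (kriz_proj u) = kriz_proj (kriz_free_act s u).
Proof.
apply/presented_mapE/(kriz_rel_act (s := s)).
  by move=> i x; apply: free_lift_gen.
by move=> i j; apply: free_lift_gen.
Qed.

Lemma kriz_act_p s i x : kriz_act s (kriz_p i x) = kriz_p (s i) x.
Proof. by rewrite kriz_actE /kriz_free_act free_lift_gen. Qed.

Lemma kriz_act_G s i j : kriz_act s (kriz_G i j) = kriz_G (s i) (s j).
Proof. by rewrite kriz_actE /kriz_free_act free_lift_gen. Qed.

Lemma kriz_ind (Q : kriz -> Prop) :
  (forall u, Q (kriz_proj u)) -> forall x, Q x.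
Proof. exact: presented_ind. Qed.

Let projB u v : kriz_proj (u - v) = kriz_proj u - kriz_proj v.
Proof. exact: raddfB. Qed.
Let projM u v : kriz_proj (u * v) = kriz_proj u * kriz_proj v.
Proof. exact: rmorphM. Qed.
Let projZ c u : kriz_proj (c *: u) = c *: kriz_proj u.
Proof. exact: linearZ_LR. Qed.

Fact kriz_act_zmod s : zmod_morphism (kriz_act s).
Proof.
elim/kriz_ind=> u; elim/kriz_ind=> v.
by rewrite -projB !kriz_actE -projB; congr kriz_proj; apply: raddfB.
Qed.
HB.instance Definition _ s :=
  GRing.isZmodMorphism.Build kriz kriz (kriz_act s) (kriz_act_zmod s).

Fact kriz_act_monoid s : monoid_morphism (kriz_act s).
Proof.
split; first by rewrite -[1]/(kriz_proj 1) kriz_actE; congr kriz_proj;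
  apply: rmorph1.
elim/kriz_ind=> u; elim/kriz_ind=> v.
by rewrite -projM !kriz_actE -projM; congr kriz_proj; apply: rmorphM.
Qed.
HB.instance Definition _ s :=
  GRing.isMonoidMorphism.Build kriz kriz (kriz_act s) (kriz_act_monoid s).

Fact kriz_act_scalable s : scalable (kriz_act s).
Proof.
move=> c; elim/kriz_ind=> u.
by rewrite -projZ !kriz_actE -projZ; congr kriz_proj; apply: linearZ_LR.
Qed.
HB.instance Definition _ s :=
  GRing.isScalable.Build rat kriz kriz *:%R (kriz_act s) (kriz_act_scalable s).

Definition kriz_component (q k : nat) : set kriz :=
  lspan [set u | exists (d : 'I_n -> nat) (x : 'I_n -> X)
                        (e : q.-tuple ('I_n * 'I_n)),
    [/\ forall a, x a \in coh X (d a),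
        (\sum_a d a + q * (2 * m - 1))%N = k
      & u = (\prod_a kriz_p a (x a)) * \prod_(ij <- e) kriz_G ij.1 ij.2]].

Section CanonicalBasis.
Variable B : homogeneous_basis X.

(* The canonical monomial with coefficients x_(h a) and edges e is encoded by *)
(* the pair (h, e). *)
Definition is_canonical (h : 'I_n -> hb_index B)
    (e : seq ('I_n * 'I_n)) : bool :=
  [&& all (fun ij : 'I_n * 'I_n => (ij.1 < ij.2)%N) e,
      sorted ltn [seq val ij.2 | ij <- e]
    & all (fun ij => h ij.2 == ord0) e].

Definition canonical_monomial (h : 'I_n -> hb_index B)
    (e : seq ('I_n * 'I_n)) : kriz :=
  (\prod_a kriz_p a (B (h a))) * \prod_(ij <- e) kriz_G ij.1 ij.2.

Definition graph_adj (e : seq ('I_n * 'I_n)) : rel 'I_n :=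
  fun i j => ((i, j) \in e) || ((j, i) \in e).

(* The list of pairs (number of vertices, mark) of the connected components of *)
(* the marked graph, each component being represented by its smallest vertex. *)
Definition marked_components (h : 'I_n -> hb_index B)
    (e : seq ('I_n * 'I_n)) : seq (nat * hb_index B) :=
  [seq (#|connect (graph_adj e) i|, h i) | i <- enum 'I_n
     & [forall j, connect (graph_adj e) i j ==> (i <= j)%N]].

Definition is_kriz_type (L : seq nat) (H : seq (hb_index B)) : bool :=
  (size H == size L) &&
  all (fun i => (nth 0%N L i == nth 0%N L i.+1) ==>
                (nth ord0 H i.+1 <= nth ord0 H i)%N)
      (iota 0 (size L).-1).

Definition kriz_type :=
  {T : intpart n * n.-bseq (hb_index B) | is_kriz_type (parts T.1) T.2}.
HB.instance Definition _ := Finite.on kriz_type.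

Definition type_parts (T : kriz_type) : seq nat := parts (val T).1.
Definition type_marks (T : kriz_type) : seq (hb_index B) := (val T).2.

Definition type_rank (T : kriz_type) : nat :=
  (\sum_(l <- type_parts T) (l - 1))%N.
Definition type_deg (T : kriz_type) : nat :=
  (\sum_(h <- type_marks T) hb_deg h)%N.

Definition kriz_type_space (T : kriz_type) : set kriz :=
  lspan [set u | exists h e,
    [/\ is_canonical h e,
        perm_eq (marked_components h e) (zip (type_parts T) (type_marks T))
      & u = canonical_monomial h e]].

End CanonicalBasis.

End KrizModel.

(* Main.v *)
(* The Arnold relation rewrites the product of the G_ij over a forest in two *)
(* ways: as a combination of canonical products over forests with the same *)
(* components, and as a combination of products along systems of paths, one for *)
(* each component, starting at its smallest vertex.  Two marked path systems of *)
(* the same type differ by a permutation, up to sign, so that either of them *)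
(* generates the subspace of its type.  The canonical monomials are independent *)
(* because the model with t + 1 points acts on the formal sums of the *)
(* v(b) p_t^*(b) and of the v(k) G_kt with coefficients in a representation of *)
(* the model with t points.  A monogenic module is a quotient of the group *)
(* algebra, where V(lam) occurs dim V(lam) times; Young symmetrizers make this *)
(* explicit. *)
From HB Require Import structures.
Require Import Defs.
From mathcomp Require Import all_boot all_order all_algebra all_fingroup.
From mathcomp Require Import falgebra.
From mathcomp Require Import zify ring.
From mathcomp Require Import boolp classical_sets.
From mathcomp Require Import monalg generic_quotient.

Set Implicit Arguments.
Unset Strict Implicit.
Unset Printing Implicit Defensive.

Import Order.TTheory GRing.Theory Num.Theory.

(** A canonical monomial is a forest whose trees carry labels, and its type keeps only the sizes and
    labels of the trees. The Arnold relation, valid for indices in any order, rewrites a two-edge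
    path on three vertices through the two other such paths, so it preserves connected components.
    The relation between [p_i], [p_j] and [G_ij] slides a label along a tree to its smallest vertex
    ([p_gprod_move]). Hence products of generators are combinations of canonical monomials over
    forests with the same components ([gprod_straight], [canonical_span]), and a permutation carries
    a canonical monomial into the span of those of the same type ([relabelled_type_space]). So the
    subspaces of types are submodules, and those of the right rank and degree add up to the
    bihomogeneous component.

    For one generator, the Arnold relation is used in a second way: it turns a forest into a
    combination of systems of paths, one path per component, starting at the smallest vertex
    ([gprod_path_span]). Two marked path systems of the same type are matched, path by path, by a
    permutation ([path_monomial_transport]), so the orbit of any one of them spans, up to signs.

    The sum is direct because canonical monomials are independent. For this a representation of the
    model is built one point at a time: the space for t+1 points has a copy of the space for t
    points for each label of the last point and for each edge from an earlier point to it. The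
    relations survive this step ([ext_ops]), and each canonical monomial sends the vector of the
    empty monomial to plus or minus its own basis vector ([ext_code_basis], [act_labels],
    [act_edges]).

    As for multiplicities, let a monogenic module [W] be generated by [g]. The unit of the group
    algebra is a combination of conjugates of Young symmetrizers ([class_average_span]), so bases of
    the spaces [c lam W] generate [W]; they generate independent copies of the modules [V(lam)]
    ([monogenic_multiplicities]). Conversely, [mu lam] copies of [V(lam)] in [W] yield [mu lam]
    independent elements of the right ideal generated by [c lam], which embeds in the left ideal
    [V(lam)] ([monogenic_multiplicity_le]). *)

Section Span.

(** * Subspaces and spans *)

Local Open Scope ring_scope.
Local Open Scope classical_set_scope.
Variable V : lmodType rat.
Implicit Types (S W : set V).

Lemma lspan_subspace S : is_subspace (lspan S).
Proof.
split=> [|a u v [c Sc ->] [d Sd ->]].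
  by exists [::]; rewrite ?big_nil //.
exists ([seq (a * x.1, x.2) | x <- c] ++ d).
  by move=> x; rewrite mem_cat => /orP[/mapP[y yc ->]|/Sd//]; apply: (Sc _ yc).
rewrite big_cat big_map scaler_sumr; congr (_ + _).
by apply: eq_bigr => x _; rewrite scalerA.
Qed.

Lemma subspace0 W : is_subspace W -> W 0.
Proof. by case. Qed.

Lemma subspaceD W u v : is_subspace W -> W u -> W v -> W (u + v).
Proof. by move=> [_ H] Wu Wv; rewrite -[u]scale1r; apply: H. Qed.

Lemma subspaceZ W a u : is_subspace W -> W u -> W (a *: u).
Proof. by move=> [W0 H] Wu; rewrite -[_ *: _]addr0; apply: H. Qed.

Lemma subspaceB W u v : is_subspace W -> W u -> W v -> W (u - v).
Proof.
by move=> sW Wu Wv; rewrite -scaleN1r; apply: subspaceD => //; apply: subspaceZ.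
Qed.

Lemma subspace_sum W (I : Type) (r : seq I) (P : pred I) (F : I -> V) :
  is_subspace W -> (forall i, P i -> W (F i)) -> W (\sum_(i <- r | P i) F i).
Proof.
move=> sW WF; elim/big_ind: _ => //; first exact: subspace0.
by move=> u v; apply: subspaceD.
Qed.

Lemma subspace_sum_seq W (I : eqType) (r : seq I) (F : I -> V) :
  is_subspace W -> (forall i, i \in r -> W (F i)) -> W (\sum_(i <- r) F i).
Proof.
by move=> sW WF; rewrite big_seq; apply: subspace_sum.
Qed.

Lemma mem_lspan S v : S v -> lspan S v.
Proof.
move=> Sv; exists [:: (1, v)]; last by rewrite big_seq1 scale1r.
by move=> a; rewrite inE => /eqP->.
Qed.

Lemma lspan_min S W : is_subspace W -> S `<=` W -> lspan S `<=` W.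
Proof.
move=> sW SW v [c Sc ->]; apply: subspace_sum_seq => // a ac.
by apply: subspaceZ => //; apply/SW/Sc.
Qed.

Lemma lspan_sub S S' : S `<=` lspan S' -> lspan S `<=` lspan S'.
Proof. by move=> SS'; apply: lspan_min => //; apply: lspan_subspace. Qed.

End Span.

Section LinearPreimage.
Local Open Scope ring_scope.
Local Open Scope classical_set_scope.
Variables V V' : lmodType rat.

Lemma subspace_preimage (f : {linear V -> V'}) (W : set V') :
  is_subspace W -> is_subspace [set v | W (f v)].
Proof.
move=> sW; split=> /= [|a u v Wu Wv]; first by rewrite linear0; case: sW.
by rewrite linearP; apply: sW.2.
Qed.

Lemma lspan_linear (f : {linear V -> V'}) (S : set V) (W : set V') :
  is_subspace W -> (forall v, S v -> W (f v)) ->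
  forall v, lspan S v -> W (f v).
Proof.
by move=> sW SW; apply: (lspan_min (subspace_preimage f sW)).
Qed.

End LinearPreimage.

(** * Young symmetrizers *)

Section GroupAlgebra.
Local Open Scope ring_scope.
Variable n : nat.
Local Notation A := (group_alg n).
Implicit Types (x y z : A) (s t : 'S_n).

(** The convolution product for composition of functions: as permutations compose from left to
    right, [gdelta s * gdelta t] is [gdelta (t * s)]. *)
Definition gmul x y : A := [ffun s => \sum_t x t * y (s * t^-1)%g].
Definition gdelta s : A := [ffun t => (t == s)%:R].

Lemma gdelta_mulE s y : gmul (gdelta s) y = group_alg_act s y.
Proof.
apply/ffunP=> t; rewrite !ffunE (bigD1 s) //= ffunE eqxx mul1r big1 ?addr0 //.
by move=> r /negPf rs; rewrite ffunE rs mul0r.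
Qed.

Fact gmulA : associative gmul.
Proof.
move=> x y z; apply/ffunP=> s; rewrite !ffunE.
under eq_bigr do rewrite ffunE mulr_sumr.
under [RHS]eq_bigr do rewrite ffunE mulr_suml.
rewrite [RHS]exchange_big; apply: eq_bigr => t _ /=.
rewrite [RHS](reindex_inj (mulIg t)); apply: eq_bigr => r _ /=.
by rewrite mulrA mulgK invMg mulgA.
Qed.

Fact gmul1x : left_id (gdelta 1%g) gmul.
Proof.
by move=> x; rewrite gdelta_mulE; apply/ffunP=> s; rewrite ffunE invg1 mulg1.
Qed.

Fact gmulx1 : right_id (gdelta 1%g) gmul.
Proof.
move=> x; apply/ffunP=> s; rewrite ffunE (bigD1 s) //= ffunE mulgV eqxx mulr1.
rewrite big1 ?addr0 // => t /negPf ts.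
by rewrite ffunE -eq_mulgV1 eq_sym ts mulr0.
Qed.

Fact gmulDl : left_distributive gmul +%R.
Proof.
move=> x y z; apply/ffunP=> s; rewrite !ffunE -big_split; apply: eq_bigr => t _.
by rewrite ffunE mulrDl.
Qed.

Fact gmulDr : right_distributive gmul +%R.
Proof.
move=> x y z; apply/ffunP=> s; rewrite !ffunE -big_split; apply: eq_bigr => t _.
by rewrite ffunE mulrDr.
Qed.

HB.instance Definition _ := GRing.Zmodule_isPzRing.Build (group_alg n)
  gmulA gmul1x gmulx1 gmulDl gmulDr.

Lemma galgZAl (k : rat) x y : (k *: x) * y = k *: (x * y).
Proof.
apply/ffunP=> s; rewrite !ffunE scaler_sumr; apply: eq_bigr => t _.
by rewrite ffunE scalerAl.
Qed.

Lemma galgZAr (k : rat) x y : x * (k *: y) = k *: (x * y).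
Proof.
apply/ffunP=> s; rewrite !ffunE scaler_sumr; apply: eq_bigr => t _.
by rewrite ffunE scalerAr.
Qed.

Lemma galg_actE s x : group_alg_act s x = gdelta s * x.
Proof. by rewrite -gdelta_mulE. Qed.

Lemma gdeltaM s t : gdelta s * gdelta t = gdelta (t * s)%g.
Proof.
rewrite -galg_actE; apply/ffunP=> r.
by rewrite !ffunE (can2_eq (mulgKV s) (mulgK s)).
Qed.

Lemma galg_sum x : x = \sum_s x s *: gdelta s.
Proof.
apply/ffunP=> t; rewrite sum_ffunE (bigD1 t) //= !ffunE eqxx.
rewrite big1 => [|s /negPf st]; first by rewrite addr0 /GRing.scale /= mulr1.
by rewrite !ffunE eq_sym st scaler0.
Qed.

Definition gstar x : A := [ffun s => x (s^-1)%g].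

Lemma gstarK : involutive gstar.
Proof. by move=> x; apply/ffunP=> s; rewrite !ffunE invgK. Qed.

Lemma gstarM x y : gstar (x * y) = gstar y * gstar x.
Proof.
apply/ffunP=> s; rewrite !ffunE [RHS](reindex_inj (mulIg s)) /=.
apply: eq_bigr => t _; rewrite !ffunE mulrC; congr (y _ * x _).
  by rewrite invMg.
by rewrite invMg invgK mulgK.
Qed.

Fact gstar_linear : linear gstar.
Proof. by move=> k x y; apply/ffunP=> s; rewrite !ffunE. Qed.
HB.instance Definition _ :=
  GRing.isLinear.Build rat (group_alg n) (group_alg n) *:%R gstar gstar_linear.

Lemma gstar_delta s : gstar (gdelta s) = gdelta s^-1%g.
Proof. by apply/ffunP=> t; rewrite !ffunE (inv_eq invgK). Qed.

(** The coefficient of the identity in [gstar x * x] is the sum of the squares of the coefficients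
    of [x], which over the rationals vanishes only for 0. The semisimplicity arguments below rest on
    this positivity. *)
Lemma gstar_mul_eq0 x : gstar x * x = 0 -> x = 0.
Proof.
move/ffunP/(_ 1%g); rewrite !ffunE => x0.
have {}x0 : \sum_s (x s^-1%g : rat) ^+ 2 = 0.
  by rewrite -[RHS]x0; apply: eq_bigr => s _; rewrite ffunE mul1g expr2.
apply/ffunP=> s; rewrite ffunE; apply/eqP.
have /(_ s^-1%g isT) : forall s, true -> (x s^-1%g : rat) ^+ 2 = 0.
  by apply: psumr_eq0P => // t _; apply: sqr_ge0.
by rewrite invgK => /eqP; rewrite sqrf_eq0.
Qed.

Lemma mul_gstar_eq0 x : x * gstar x = 0 -> x = 0.
Proof.
by rewrite -{1}[x]gstarK => /gstar_mul_eq0 sx; rewrite -[x]gstarK sx linear0.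
Qed.

End GroupAlgebra.

Section CardNat.
Local Open Scope nat_scope.
Variables (T : finType) (A : {pred T}) (f : T -> nat) (k : nat).

Lemma card_inj_leq : {in A &, injective f} -> {in A, forall x, f x < k} ->
  #|A| <= k.
Proof.
move=> fI fk; rewrite cardE -(size_map f) -[leqRHS](size_iota 0).
apply: uniq_leq_size.
  by rewrite map_inj_in_uniq ?enum_uniq // => x y; rewrite !mem_enum; apply: fI.
by move=> _ /mapP[x + ->]; rewrite mem_enum mem_iota => /fk.
Qed.

Lemma leq_card_surj : (forall r, r < k -> exists2 x, x \in A & f x = r) ->
  k <= #|A|.
Proof.
move=> fS; rewrite cardE -(size_map f) -[leqLHS](size_iota 0).
apply: uniq_leq_size => [|r]; first exact: iota_uniq.
rewrite mem_iota => /= /fS[x xA <-]; apply: map_f; by rewrite mem_enum.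
Qed.

End CardNat.

(** * Tableaux and the dominance order *)

Section Tableau.
Local Open Scope nat_scope.
Variable n : nat.
Implicit Types (lam mu : intpart n) (i j u v : 'I_n).

Definition part lam r := nth 0 (parts lam) r.

Lemma partsP lam :
  [/\ sorted geq (parts lam), all (leq 1) (parts lam) & sumn (parts lam) = n].
Proof. by have /and3P[-> -> /eqP] := valP lam. Qed.

Lemma part_anti lam r r' : r <= r' -> part lam r' <= part lam r.
Proof.
have [srt _ _] := partsP lam; rewrite /part => rr'.
have [r'L|r'L] := ltnP r' (size (parts lam)); last by rewrite (nth_default 0 r'L).
have := sorted_leq_nth _ _ 0 srt; apply=> //; last first.
- by rewrite inE (leq_ltn_trans rr').
- exact: leqnn.
- by move=> x y z /= xy /leq_trans; apply.
Qed.

Lemma part_gt0 lam r : (0 < part lam r) = (r < size (parts lam)).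
Proof.
rewrite /part; case: (ltnP r (size (parts lam))) => rL; last by rewrite (nth_default 0 rL).
by have [_ /allP/(_ _ (mem_nth 0 rL))] := partsP lam.
Qed.

Lemma part_inj lam mu : part lam =1 part mu -> lam = mu.
Proof.
move=> E; have sE : size (parts lam) = size (parts mu).
  apply/eqP; rewrite eqn_leq; apply/andP; split; rewrite leqNgt -part_gt0.
    by rewrite E part_gt0 ltnn.
  by rewrite -E part_gt0 ltnn.
apply/val_inj/val_inj/(inj_map val_inj)/(@eq_from_nth _ 0) => // k _.
exact: E.
Qed.

Lemma tab_col_lt lam i : tab_col lam i < part lam (tab_row lam i).
Proof. by apply: reshape_offsetP; have [_ _ ->] := partsP lam. Qed.

Lemma tab_cell_inj lam i j :
  tab_row lam i = tab_row lam j -> tab_col lam i = tab_col lam j -> i = j.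
Proof.
move=> rE cE; apply/val_inj => /=.
rewrite -[val i](reshape_indexK (parts lam)) -[val j](reshape_indexK (parts lam)).
by rewrite -/(tab_row lam i) -/(tab_col lam i) rE cE.
Qed.

Lemma tab_cell lam r c : c < part lam r ->
  exists2 i, tab_row lam i = r & tab_col lam i = c.
Proof.
move=> cr; have [_ _ sE] := partsP lam.
have lt := flatten_indexP cr; rewrite sE in lt.
exists (Ordinal lt); first exact: flatten_indexKl.
exact: flatten_indexKr.
Qed.

Lemma tab_col_ltn lam i : tab_col lam i < n.
Proof.
have [_ _ {2}<-] := partsP lam; apply: leq_trans (tab_col_lt lam i) _.
have rL : tab_row lam i < size (parts lam).
  by apply: reshape_indexP; have [_ _ ->] := partsP lam.
rewrite /part -{2}[parts lam](cat_take_drop (tab_row lam i)) sumn_cat.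
by rewrite (drop_nth 0 rL) /= addnCA leq_addr.
Qed.

Lemma card_tab_row lam r : #|[pred i | tab_row lam i == r]| = part lam r.
Proof.
apply/eqP; rewrite eqn_leq; apply/andP; split.
  apply: (@card_inj_leq _ _ (tab_col lam)) => [i j|i]; rewrite !inE.
    by move=> /eqP <- /eqP/esym; apply: tab_cell_inj.
  by move=> /eqP <-; apply: tab_col_lt.
apply: (@leq_card_surj _ _ (tab_col lam)) => c /tab_cell[i ir ic].
by exists i; rewrite // inE ir.
Qed.

(** This is the sum of the first [k] parts of [lam]; comparing these sums for all [k] is the
    dominance order. *)
Definition rows_below lam k := #|[pred i | tab_row lam i < k]|.

Lemma rows_belowS lam k : rows_below lam k.+1 = rows_below lam k + part lam k.
Proof.
rewrite /rows_below -card_tab_row -cardUI [X in _ + X]eq_card0 ?addn0.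
  by apply: eq_card => i; rewrite !inE ltnS leq_eqVlt orbC.
by move=> i; rewrite !inE; case: eqP => [->|]; rewrite ?ltnn ?andbF.
Qed.

Lemma rows_below_inj lam mu : rows_below lam =1 rows_below mu -> lam = mu.
Proof.
move=> E; apply: part_inj => r; apply/(@addnI (rows_below lam r)).
by rewrite {2}E -!rows_belowS.
Qed.

Section Transversal.
Variables (lam mu : intpart n) (g : 'S_n).
Hypothesis transv : forall u v, tab_row lam u = tab_row lam v ->
  tab_col mu (g u) = tab_col mu (g v) -> u = v.

Definition col_count k c :=
  #|[pred v | (tab_row lam v < k) && (tab_col mu (g v) == c)]|.
Definition tab_col_count k c :=
  #|[pred u | (tab_row mu u < k) && (tab_col mu u == c)]|.

(** If column [c] of [mu] reaches row [k], it has a cell in each of the first [k] rows, whereas each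
    of the first [k] rows of [lam] sends at most one entry to it. Otherwise the right-hand side is
    the whole column, and [g] is injective. *)
Lemma col_count_le k c : col_count k c <= tab_col_count k c.
Proof.
have [/existsP[u /andP[ku /eqP uc]]|] :=
    boolP [exists u, (k <= tab_row mu u) && (tab_col mu u == c)].
  apply: (@leq_trans k).
    apply: (@card_inj_leq _ _ (tab_row lam)) => [v w|v]; rewrite !inE.
      move=> /andP[_ /eqP vc] /andP[_ /eqP wc] E.
      by apply: transv; rewrite ?E // vc wc.
    by case/andP.
  apply: (@leq_card_surj _ _ (tab_row mu)) => r rk.
  have [|v vr vc] := @tab_cell mu r c.
    by rewrite -uc (leq_trans (tab_col_lt _ _)) ?part_anti // ltnW ?(leq_trans rk).
  by exists v; rewrite // inE vr rk vc eqxx.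
rewrite negb_exists => /forallP noex.
have <- : #|[pred u | tab_col mu u == c]| = tab_col_count k c.
  apply: eq_card => u; rewrite !inE; have := noex u.
  by case: ltnP => //= _ /negPf.
apply: (@leq_trans #|[preim g of [pred u | tab_col mu u == c]]|).
  by apply: subset_leq_card; apply/fintype.subsetP => v; rewrite !inE => /andP[].
rewrite card_preim; last exact: perm_inj.
by apply: subset_leq_card; apply/fintype.subsetP => v; rewrite inE => /andP[].
Qed.

Lemma sum_col_count k : \sum_(c < n) col_count k c = rows_below lam k.
Proof.
rewrite /rows_below -sum1_card.
rewrite [RHS](partition_big (fun v => Ordinal (tab_col_ltn mu (g v))) predT) //=.
by apply: eq_bigr => c _; rewrite sum1_card; apply: eq_card => v; rewrite !inE.
Qed.

Lemma sum_tab_col_count k : \sum_(c < n) tab_col_count k c = rows_below mu k.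
Proof.
rewrite /rows_below -sum1_card.
rewrite [RHS](partition_big (fun v => Ordinal (tab_col_ltn mu v)) predT) //=.
by apply: eq_bigr => c _; rewrite sum1_card; apply: eq_card => v; rewrite !inE.
Qed.

Lemma transversal_dominance k : rows_below lam k <= rows_below mu k.
Proof.
by rewrite -sum_col_count -sum_tab_col_count; apply: leq_sum => c _;
  apply: col_count_le.
Qed.

(** For equal shapes the column counts have equal sums, so all the inequalities of [col_count_le]
    are equalities. Adding the row of [v] raises the count of the column of [g v], hence that column
    meets this row in the tableau too. *)
Lemma transversal_cell v : lam = mu ->
  exists2 u, tab_row mu u = tab_row lam v & tab_col mu u = tab_col mu (g v).
Proof.
move=> lm.
have cE k (c : 'I_n) : col_count k c = tab_col_count k c.
  have /leqif_sum : forall c : 'I_n, true -> col_count k c <= tab_col_count k c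
      ?= iff (col_count k c == tab_col_count k c).
    by move=> d _; split=> //; apply: col_count_le.
  move=> /= [_]; rewrite sum_col_count sum_tab_col_count lm eqxx => /esym/forallP.
  by move/(_ c)/eqP.
pose c := Ordinal (tab_col_ltn mu (g v)); set r := tab_row lam v.
have rc : col_count r c < col_count r.+1 c.
  apply: proper_card; apply/properP; split.
    by apply/fintype.subsetP=> w; rewrite !inE ltnS => /andP[/ltnW-> ->].
  by exists v; rewrite !inE ?ltnn // ltnSn /=.
rewrite !cE in rc.
have /fintype.subsetPn[u] : ~~ ([pred u | (tab_row mu u < r.+1) && (tab_col mu u == c)]
    \subset [pred u | (tab_row mu u < r) && (tab_col mu u == c)]).
  by apply/negP=> /subset_leq_card; rewrite leqNgt => /negP; apply.
rewrite !inE ltnS => /andP[ur /eqP uc]; rewrite uc eqxx andbT -leqNgt => ru.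
by exists u => //; apply/eqP; rewrite eqn_leq ur.
Qed.

End Transversal.
End Tableau.

(** * Young symmetrizers: orthogonality, idempotence up to scalars, nondegeneracy *)

Section YoungSymmetrizer.
Local Open Scope ring_scope.
Variable n : nat.
Local Notation A := (group_alg n).
Implicit Types (lam mu : intpart n) (x y : A) (s t g : 'S_n).

Lemma galg_sandwich x y z : x * y * z = \sum_g y g *: (x * gdelta g * z).
Proof.
rewrite [y in LHS]galg_sum mulr_sumr mulr_suml; apply: eq_bigr => g _.
by rewrite galgZAr galgZAl.
Qed.

Definition row_sum lam : A := \sum_(p in row_group lam) gdelta p.
Definition col_sum lam : A := \sum_(q in col_group lam) (-1) ^+ q *: gdelta q.
Local Notation c := (@young_symmetrizer n).

Lemma young_symmetrizerE lam : c lam = row_sum lam * col_sum lam.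
Proof.
rewrite mulr_suml; apply/ffunP=> s; rewrite ffunE sum_ffunE; apply: eq_bigr => p _.
rewrite mulr_sumr sum_ffunE; apply: eq_bigr => q _.
by rewrite galgZAr gdeltaM !ffunE.
Qed.

Lemma row_groupP lam s :
  reflect (forall i, tab_row lam (s i) = tab_row lam i) (s \in row_group lam).
Proof. by rewrite inE; apply: (iffP forallP) => H i; apply/eqP; apply: H. Qed.

Lemma col_groupP lam s :
  reflect (forall i, tab_col lam (s i) = tab_col lam i) (s \in col_group lam).
Proof. by rewrite inE; apply: (iffP forallP) => H i; apply/eqP; apply: H. Qed.

Lemma row_groupM lam s t : s \in row_group lam ->
  (s * t \in row_group lam)%g = (t \in row_group lam).
Proof.
move=> /row_groupP sR; apply/row_groupP/row_groupP => H i.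
  have := H (s^-1%g i); rewrite permM permKV => ->.
  by rewrite -sR permKV.
by rewrite permM H sR.
Qed.

Lemma col_groupM lam s t : s \in col_group lam ->
  (s * t \in col_group lam)%g = (t \in col_group lam).
Proof.
move=> /col_groupP sR; apply/col_groupP/col_groupP => H i.
  have := H (s^-1%g i); rewrite permM permKV => ->.
  by rewrite -sR permKV.
by rewrite permM H sR.
Qed.

Lemma row_groupV lam s : (s^-1 \in row_group lam)%g = (s \in row_group lam).
Proof.
by apply/row_groupP/row_groupP => H i;
  [rewrite -[in RHS](permK s i) H | rewrite -[in RHS](permKV s i) H].
Qed.

Lemma col_groupV lam s : (s^-1 \in col_group lam)%g = (s \in col_group lam).
Proof.
by apply/col_groupP/col_groupP => H i;
  [rewrite -[in RHS](permK s i) H | rewrite -[in RHS](permKV s i) H].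
Qed.

Lemma row_col_group1 lam s : s \in row_group lam -> s \in col_group lam -> s = 1%g.
Proof.
move=> /row_groupP sR /col_groupP sC; apply/permP=> i; rewrite perm1.
by apply: (@tab_cell_inj _ lam).
Qed.

Lemma row_sum_delta lam t : t \in row_group lam ->
  row_sum lam * gdelta t = row_sum lam.
Proof.
move=> tR; rewrite mulr_suml.
rewrite [RHS](reindex_inj (mulgI t)); apply: eq_big => p; last by rewrite gdeltaM.
by rewrite row_groupM.
Qed.

Lemma delta_col_sum lam t : t \in col_group lam ->
  gdelta t * col_sum lam = (-1) ^+ t *: col_sum lam.
Proof.
move=> tC; rewrite mulr_sumr [in RHS]/col_sum scaler_sumr.
rewrite [RHS](reindex_inj (mulIg t)); apply: eq_big => q.
  by rewrite -[RHS]col_groupV invMg col_groupM ?col_groupV.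
by rewrite galgZAr gdeltaM scalerA odd_permM signr_addb mulrCA -signr_addb addbb mulr1.
Qed.

Lemma row_sum_idem lam : row_sum lam * row_sum lam = #|row_group lam|%:R *: row_sum lam.
Proof.
rewrite {2}/row_sum mulr_sumr (eq_bigr (fun=> row_sum lam)).
  by rewrite sumr_const scaler_nat.
by move=> p; apply: row_sum_delta.
Qed.

Lemma col_sum_idem lam : col_sum lam * col_sum lam = #|col_group lam|%:R *: col_sum lam.
Proof.
rewrite {1}/col_sum mulr_suml (eq_bigr (fun=> col_sum lam)).
  by rewrite sumr_const scaler_nat.
move=> q /delta_col_sum E.
by rewrite galgZAl E scalerA -signr_addb addbb scale1r.
Qed.

Lemma gstar_row_sum lam : gstar (row_sum lam) = row_sum lam.
Proof.
rewrite linear_sum [RHS](reindex_inj invg_inj) /=.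
by apply: eq_big => p; rewrite ?row_groupV ?gstar_delta.
Qed.

Lemma gstar_col_sum lam : gstar (col_sum lam) = col_sum lam.
Proof.
rewrite linear_sum [RHS](reindex_inj invg_inj) /=.
apply: eq_big => p; rewrite ?col_groupV // => _.
by rewrite linearZ /= gstar_delta odd_permV.
Qed.

(** The row sum absorbs the transposition of [i] and [j]; carried across [g] it becomes an odd
    element of the column group, absorbed with sign -1. So the product equals its opposite. *)
Lemma row_col_transposition lam mu g (i j : 'I_n) : i != j ->
    tab_row lam i = tab_row lam j ->
    tab_col mu (g^-1%g i) = tab_col mu (g^-1%g j) ->
  row_sum lam * gdelta g * col_sum mu = 0.
Proof.
move=> ij rE cE; pose t := tperm i j; pose t' := (t ^ g^-1)%g.
have tR : t \in row_group lam.
  by apply/row_groupP=> k; rewrite /t; case: tpermP => [->|->|].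
have t'E : t' = tperm (g^-1%g i) (g^-1%g j) by rewrite /t' tpermJ.
have tC : t' \in col_group mu.
  by apply/col_groupP=> k; rewrite t'E; case: tpermP => [->|->|].
have odd_t : odd_perm t' by rewrite t'E odd_tperm (inj_eq perm_inj).
set w := _ * _ * _.
have wN : w = - w.
  rewrite {1}/w -(row_sum_delta tR) -[_ * gdelta t * _]mulrA.
  have -> : gdelta t * gdelta g = gdelta g * gdelta t'.
    by rewrite !gdeltaM /t' conjgE invgK -!mulgA mulVg mulg1.
  by rewrite -!mulrA (delta_col_sum tC) odd_t expr1 scaleN1r !mulrN mulrA.
have : w *+ 2 = 0 by rewrite mulr2n {2}wN subrr.
by rewrite -scaler_nat => /eqP; rewrite scaler_eq0 => /orP[|/eqP//].
Qed.

(* Otherwise the transposition (i j) lies in the row group of lam and in the *)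
(* conjugate by g of the column group of mu, and kills the product. *)
Lemma row_col_transversal lam mu g :
    row_sum lam * gdelta g * col_sum mu != 0 ->
  forall i j, tab_row lam i = tab_row lam j ->
    tab_col mu (g^-1%g i) = tab_col mu (g^-1%g j) -> i = j.
Proof.
move=> nz i j rE cE; apply/eqP/negPn/negP=> ij.
by rewrite (row_col_transposition ij rE cE) eqxx in nz.
Qed.

Lemma row_col_dominance lam mu x : ~ (forall k, rows_below lam k <= rows_below mu k)%N ->
  row_sum lam * x * col_sum mu = 0.
Proof.
move=> nd; rewrite galg_sandwich big1 // => g _; apply/eqP; rewrite scaler_eq0; apply/orP; right.
apply: contra_notT nd => /row_col_transversal tr k.
exact: (transversal_dominance tr).
Qed.

(** Dominance is antisymmetric, so it fails in one direction. Either the outer product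
    [row_sum lam * _ * col_sum mu] vanishes, or the inner one [col_sum lam * _ * row_sum mu] does,
    as the image under [gstar] of a product of the first kind. *)
Lemma young_orth lam mu x : lam != mu -> c lam * x * c mu = 0.
Proof.
move=> lm; rewrite !young_symmetrizerE.
have -> : row_sum lam * col_sum lam * x * (row_sum mu * col_sum mu) =
    row_sum lam * (col_sum lam * x * row_sum mu) * col_sum mu by rewrite !mulrA.
have [lemu|nle] := pselect (forall k, rows_below lam k <= rows_below mu k)%N.
  have nge : ~ (forall k, rows_below mu k <= rows_below lam k)%N.
    move=> ge; move/eqP: lm; apply; apply: rows_below_inj => k.
    by apply/eqP; rewrite eqn_leq lemu ge.
  have /(congr1 (@gstar n)) := row_col_dominance (gstar x) nge.
  rewrite linear0 !gstarM gstarK gstar_row_sum gstar_col_sum mulrA => ->.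
  by rewrite mulr0 mul0r.
exact: row_col_dominance.
Qed.

(** By [transversal_cell], each [v] can be moved inside its row to a cell in the column of [g^-1 v].
    This movement preserves rows, and following [g] by it preserves columns, which gives the two
    factors. *)
Lemma row_col_factor lam g : row_sum lam * gdelta g * col_sum lam != 0 ->
  exists p q, [/\ p \in row_group lam, q \in col_group lam & gdelta g = gdelta p * gdelta q].
Proof.
move=> /row_col_transversal tr.
have ex v : exists u, (tab_row lam u == tab_row lam v) &&
                      (tab_col lam u == tab_col lam (g^-1%g v)).
  by have [u ur uc] := transversal_cell tr v erefl; exists u; rewrite ur uc !eqxx.
pose f v := xchoose (ex v).
have fP v : tab_row lam (f v) = tab_row lam v /\
            tab_col lam (f v) = tab_col lam (g^-1%g v).
  by have /andP[/eqP-> /eqP->] := xchooseP (ex v).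
have fI : injective f.
  by move=> v w E; apply: tr; rewrite -?(fP v).1 -?(fP v).2 -?(fP w).1 -?(fP w).2 E.
exists (perm fI)^-1%g, (g * perm fI)%g; split.
- by rewrite row_groupV; apply/row_groupP=> i; rewrite permE (fP i).1.
- by apply/col_groupP=> i; rewrite permM permE (fP _).2 permK.
- by rewrite gdeltaM mulgK.
Qed.

Lemma row_mul_col lam x : exists k : rat, row_sum lam * x * col_sum lam = k *: c lam.
Proof.
have dE g : exists k : rat, row_sum lam * gdelta g * col_sum lam = k *: c lam.
  have [->|/row_col_factor] := eqVneq (row_sum lam * gdelta g * col_sum lam) 0.
    by exists 0; rewrite scale0r.
  move=> [p [q [pR qC ->]]]; exists ((-1) ^+ q).
  by rewrite mulrA row_sum_delta // -mulrA delta_col_sum // galgZAr young_symmetrizerE.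
have [k kE] := choice dE; exists (\sum_g x g * k g).
rewrite galg_sandwich scaler_suml; apply: eq_bigr => g _.
by rewrite kE scalerA.
Qed.

Lemma young_sandwich lam x : exists k : rat, c lam * x * c lam = k *: c lam.
Proof.
have [k E] := row_mul_col lam (col_sum lam * x * row_sum lam); exists k.
by rewrite -E young_symmetrizerE !mulrA.
Qed.

Lemma young1 lam : c lam 1%g = 1.
Proof.
rewrite ffunE (bigD1 1%g) /=; last by apply/row_groupP=> i; rewrite perm1.
rewrite (bigD1 1%g) /=; last by apply/col_groupP=> i; rewrite perm1.
rewrite odd_perm1 mulg1 eqxx mulr1 !big1 ?addr0 // => [p /andP[pR p1]|q /andP[qC q1]].
  apply: big1 => q qC; case: eqP => [/esym/eqP|]; rewrite ?mulr0 //.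
  rewrite -eq_invg_mul => /eqP qE; case/negP: p1; rewrite -qE.
  by apply/eqP/(@row_col_group1 lam); rewrite ?qE // -col_groupV -qE invgK.
by rewrite mulg1 eq_sym (negPf q1) mulr0.
Qed.

Lemma young_neq0 lam : c lam != 0.
Proof. by apply/eqP=> /ffunP/(_ 1%g); rewrite young1 ffunE. Qed.

(** Write [c lam] as [a * b]. If its square were 0, then [a * b * a] times its image under [gstar]
    would be 0, so [a * b * a] would be 0; the same argument then kills [a * b] itself. *)
Lemma young_square lam : exists2 k : rat, k != 0 & c lam * c lam = k *: c lam.
Proof.
have [k E] := young_sandwich lam 1; rewrite mulr1 in E.
exists k => //; apply: contra_neq (young_neq0 lam) => k0.
have {E} : c lam * c lam = 0 by rewrite E k0 scale0r.
rewrite young_symmetrizerE; set a := row_sum lam; set b := col_sum lam => abab.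
have aba0 : a * b * a = 0.
  apply: mul_gstar_eq0; rewrite !gstarM gstar_row_sum gstar_col_sum -/a -/b.
  have -> : a * b * a * (a * (b * a)) = a * b * (a * a) * (b * a) by rewrite !mulrA.
  rewrite row_sum_idem galgZAr galgZAl -/a.
  have -> : a * b * a * (b * a) = a * b * (a * b) * a by rewrite !mulrA.
  by rewrite abab mul0r scaler0.
apply: mul_gstar_eq0; rewrite !gstarM gstar_row_sum gstar_col_sum -/a -/b.
have -> : a * b * (b * a) = a * (b * b) * a by rewrite !mulrA.
by rewrite col_sum_idem galgZAr galgZAl -/b aba0 scaler0.
Qed.

(** Elements of the left ideal [V(lam)] are detected by the multipliers [c lam * y]. With [c lam]
    equal to [a * b], positivity passes the vanishing from [a * b] to [b * a], and then to the
    element with [y] chosen as [gstar z]. It serves to prove injectivity on sums of copies of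
    [V(lam)]. *)
Lemma young_nondegenerate lam z :
  (forall y, c lam * y * (z * c lam) = 0) -> z * c lam = 0.
Proof.
rewrite young_symmetrizerE; set a := row_sum lam; set b := col_sum lam.
set v := z * (a * b) => H.
have bav0 y : b * a * (y * v) = 0.
  apply: gstar_mul_eq0; rewrite gstarM [gstar (b * a)]gstarM gstar_row_sum gstar_col_sum.
  rewrite -/a -/b.
  have -> : gstar (y * v) * (a * b) * (b * a * (y * v)) =
      gstar (y * v) * (a * (b * b) * a * (y * v)) by rewrite !mulrA.
  rewrite col_sum_idem galgZAr !galgZAl -/b.
  have -> : a * b * a * (y * v) = a * b * (a * y) * v by rewrite !mulrA.
  by rewrite H scaler0 mulr0.
apply: gstar_mul_eq0; rewrite {1}/v !gstarM gstar_row_sum gstar_col_sum -/a -/b.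
by rewrite -mulrA bav0.
Qed.

End YoungSymmetrizer.

(** * Rearrangements and enumerations *)

Section Sequences.
Local Open Scope nat_scope.

Lemma perm_map_lift (T U : eqType) (f : T -> U) (s : seq T) (t : seq U) :
  perm_eq (map f s) t -> exists2 s', perm_eq s' s & map f s' = t.
Proof.
case: s => [|x0 s]; first by rewrite perm_sym => /perm_nilP->; exists [::].
set s1 := x0 :: s; rewrite perm_sym => /(perm_iotaP (f x0))[I I_iota tE].
exists (map (nth x0 s1) I).
  by apply/(perm_iotaP x0); exists I => //; rewrite size_map in I_iota.
rewrite tE -map_comp; apply/eq_in_map => i iI.
rewrite [RHS](nth_map x0) // -(size_map f); have := perm_mem I_iota i.
by rewrite iI mem_iota => /esym/andP[].
Qed.

Lemma seq_preimage (T : Type) (U : eqType) (f : T -> U) (t : seq U) :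
  (forall y, y \in t -> exists x, f x = y) -> exists s, map f s = t.
Proof.
elim: t => [|y t IHt] H; first by exists [::].
have [x xE] := H y (mem_head _ _).
have [|s sE] := IHt; first by move=> z zt; apply: H; rewrite inE zt orbT.
by exists (x :: s); rewrite /= xE sE.
Qed.

Lemma mem_uniq_full (T : finType) (s : seq T) x :
  uniq s -> size s = #|T| -> x \in s.
Proof.
move=> us ss; have [||_ ->] := @uniq_min_size _ s (enum T) us.
- by move=> y; rewrite mem_enum.
- by rewrite ss cardE.
- by rewrite mem_enum.
Qed.

Lemma perm_of_seqs (T : finType) (s t : seq T) :
    uniq s -> uniq t -> size s = #|T| -> size t = #|T| ->
  exists g : {perm T}, map g s = t.
Proof.
move=> us ut ss st; case: s us ss => [|x0 s0] us ss.
  by exists 1%g; rewrite /= in ss; case: t st ut; rewrite // -ss.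
set s := x0 :: s0 in us ss *.
have idx r (y : T) : uniq r -> size r = #|T| -> index y r < #|T|.
  by move=> ur sr; rewrite -sr index_mem mem_uniq_full.
have fI : injective (fun x => nth x0 t (index x s)).
  move=> x y /eqP; rewrite nth_uniq ?st ?idx // => /eqP/(congr1 (nth x0 s)).
  by rewrite !nth_index ?mem_uniq_full.
exists (perm fI); apply: (@eq_from_nth _ x0) => [|i].
  by rewrite size_map ss st.
rewrite size_map => si.
by rewrite (nth_map x0) // permE index_uniq.
Qed.

Lemma exists_intpart n (L : seq nat) : is_partition n L ->
  exists lam : intpart n, parts lam = L.
Proof.
move=> Lp; have /and3P[_ L1 /eqP sL] := Lp.
have szL : size [seq inord l : 'I_n.+1 | l <- L] <= n.
  rewrite size_map -sL; elim: L L1 {Lp sL} => //= l L IHL /andP[l1 /IHL H].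
  by rewrite -add1n leq_add.
have valE : [seq val (l : 'I_n.+1) | l <- Bseq szL] = L.
  rewrite /= -map_comp map_id_in // => l lL /=; rewrite inordK // ltnS -sL.
  by have := perm_sumn (perm_to_rem lL) => ->; apply: leq_addr.
by have lamP : is_partition n [seq val l | l <- Bseq szL];
  [rewrite valE | exists (Sub (Bseq szL) lamP : intpart n)].
Qed.

End Sequences.

(** * Cycle type determines the conjugacy class *)

Section CycleType.
Local Open Scope nat_scope.
Variable T : finType.
Implicit Types s t : {perm T}.

Lemma porbits_partition s : finset.partition (porbits s) [set: T].
Proof.
apply/and3P; split.
- rewrite finset.eqEsubset finset.subsetT; apply/fintype.subsetP=> x _; apply/finset.bigcupP.
  by exists (porbit s x); rewrite ?porbit_id // imset_f.
- apply/finset.trivIsetP=> _ _ /imsetP[x _ ->] /imsetP[y _ ->].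
  apply: contraR => /pred0Pn[z /andP[/= zx zy]].
  by move: zx zy; rewrite -!eq_porbit_mem => /eqP <- /eqP <-.
- by apply/imsetP=> -[x _ /setP/(_ x)]; rewrite inE porbit_id.
Qed.

Definition cycle_sizes s := map (fun c : {set T} => #|c|) (enum (porbits s)).

(** This is cycle notation: each cycle is written out from a chosen point, and together the cycles
    list every point once. *)
Lemma cycle_representatives s : exists2 r : seq T,
    perm_eq [seq #|porbit s x| | x <- r] (cycle_sizes s)
  & let A := flatten [seq traject s x #|porbit s x| | x <- r] in
    uniq A /\ size A = #|T|.
Proof.
have [|r rE] := @seq_preimage _ _ (porbit s) (enum (porbits s)).
  by move=> c; rewrite mem_enum => /imsetP[x _ ->]; exists x.
exists r; first by rewrite /cycle_sizes -rE -map_comp perm_refl.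
move=> A; have sA : size A = #|T|.
  rewrite size_flatten /shape -map_comp -cardsT.
  rewrite (finset.card_partition (porbits_partition s)) -big_enum /= -rE big_map.
  by rewrite sumnE big_map; apply: eq_bigr => x _; rewrite /= size_traject.
split=> //; apply: (@leq_size_uniq _ (enum T)); rewrite ?enum_uniq //; last first.
  by rewrite sA -cardE.
move=> x _; have : porbit s x \in enum (porbits s) by rewrite mem_enum imset_f.
rewrite -rE => /mapP[y yr E]; apply/flattenP.
exists (traject s y #|porbit s y|); first exact: map_f.
by rewrite -porbit_traject -E porbit_id.
Qed.

(** Write both permutations in cycle notation with cycles of equal lengths in corresponding places.
    The bijection between the two lists intertwines [s] and [t]. *)
Lemma cycle_type_conj s t :
    perm_eq (cycle_sizes s)
            (cycle_sizes t) ->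
  exists g, t = (s ^ g)%g.
Proof.
have [r rs [ur sr]] := cycle_representatives s.
have [q0 qt [uq sq]] := cycle_representatives t.
rewrite -(permPl rs) -(permPr qt) perm_sym => /perm_map_lift[q qq0 qE].
have perm_A : perm_eq (flatten [seq traject t x #|porbit t x| | x <- q])
                      (flatten [seq traject t x #|porbit t x| | x <- q0]).
  exact/perm_flatten/perm_map.
rewrite -(perm_uniq perm_A) in uq; rewrite -(perm_size perm_A) in sq.
have [g gE] := perm_of_seqs ur uq sr sq; exists g.
have {gE} gE : [seq map g (traject s x #|porbit s x|) | x <- r] =
               [seq traject t x #|porbit t x| | x <- q].
  apply: eq_from_flatten_shape; first by rewrite -gE map_flatten -map_comp.
  rewrite /shape -!map_comp.
  have -> : map (size \o (fun x => traject t x #|porbit t x|)) q =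
            map (fun x => #|porbit t x|) q.
    by apply: eq_map => x /=; rewrite size_traject.
  by rewrite qE; apply: eq_map => x /=; rewrite size_map size_traject.
have trE x : x \in r -> exists y, #|porbit s x| = #|porbit t y| /\
    forall k, k < #|porbit s x| -> g (iter k s x) = iter k t y.
  move=> xr; have i_r : index x r < size r by rewrite index_mem.
  have szE : size q = size r by have /(congr1 size) := qE; rewrite !size_map.
  exists (nth x q (index x r)).
  have cE : #|porbit s x| = #|porbit t (nth x q (index x r))|.
    have /(congr1 (nth 0 ^~ (index x r))) := qE.
    by rewrite !(nth_map x) ?szE // nth_index.
  split=> // k kx; move/(congr1 (nth [::] ^~ (index x r))): gE.
  rewrite !(nth_map x) ?szE // nth_index // -cE => /(congr1 (nth (g x) ^~ k)).
  by rewrite (nth_map x) ?size_traject // (nth_traject s) // (set_nth_default (nth x q (index x r)) (g x)) ?size_traject // (nth_traject t).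
apply/permP=> y; rewrite -[y in RHS](permKV g) permJ; set x := g^-1%g y.
have -> : y = g x by rewrite permKV.
have : x \in flatten [seq traject s x #|porbit s x| | x <- r].
  exact: mem_uniq_full.
case/flattenP=> _ /mapP[a ar ->] /trajectP[k ka ->].
have [b [cE bE]] := trE a ar; rewrite bE // -!iterS.
have [ka1|] := ltnP k.+1 #|porbit s a|; first by rewrite bE.
(* At the last point of a cycle both trajectories return to their starting points. *)
rewrite leq_eqVlt ltnNge ka orbF => /eqP ka1.
have a0 : 0 < #|porbit s a| by apply: leq_trans ka.
by rewrite -ka1 {1}cE !iter_porbit -[LHS]/(iter 0 t b) -bE.
Qed.

End CycleType.

(** * The unit as a combination of conjugates of Young symmetrizers *)

Section Completeness.
Local Open Scope ring_scope.
Variable n : nat.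
Local Notation A := (group_alg n).
Local Notation c := (@young_symmetrizer n).
Implicit Types (lam mu : intpart n) (x y : A) (s t g : 'S_n).

Lemma cycle_partition s : exists lam : intpart n,
  parts lam = sort geq (cycle_sizes s).
Proof.
apply: exists_intpart; apply/and3P; split.
- by apply: sort_sorted => i j; apply: leq_total.
- apply/allP=> k; rewrite mem_sort => /mapP[d].
  rewrite mem_enum => /imsetP[i _ ->] ->.
  by rewrite lt0n card_porbit_neq0.
- rewrite (perm_sumn (permEl (perm_sort _ _))) sumnE big_map big_enum /=.
  by rewrite -(finset.card_partition (porbits_partition s)) cardsT card_ord.
Qed.

Definition cycle_type s : intpart n := projT1 (cid (cycle_partition s)).

Lemma cycle_typeE s : parts (cycle_type s) = sort geq (cycle_sizes s).
Proof. by rewrite /cycle_type; case: cid. Qed.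

Lemma cycle_type_eq s t : cycle_type s = cycle_type t -> exists g, t = (s ^ g)%g.
Proof.
move=> /(congr1 (@parts n)); rewrite !cycle_typeE => E.
apply: cycle_type_conj; by rewrite -(perm_sort geq) E perm_sort.
Qed.

Lemma cycle_typeV s : cycle_type s^-1 = cycle_type s.
Proof.
apply/val_inj/val_inj/(inj_map val_inj).
by rewrite -!/(parts _) !cycle_typeE /cycle_sizes porbitsV.
Qed.

Lemma galg_mul_delta x g s : (x * gdelta g) s = x (g^-1 * s)%g.
Proof.
rewrite ffunE (bigD1 (g^-1 * s)%g) //= ffunE invMg invgK mulKVg eqxx mulr1.
rewrite big1 ?addr0 // => t ts; rewrite ffunE; case: eqP => [E|]; rewrite ?mulr0 //.
by rewrite -E invMg invgK mulgKV eqxx in ts.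
Qed.

(** Up to the factor n!, this is the projection of the group algebra onto its center. *)
Definition class_average x : A := \sum_g gdelta g^-1%g * x * gdelta g.

Lemma class_averageE x s : class_average x s = \sum_g x (s ^ g)%g.
Proof.
rewrite sum_ffunE; apply: eq_bigr => g _.
by rewrite galg_mul_delta -galg_actE ffunE invgK conjgE mulgA.
Qed.

Lemma class_averageJ x s g : class_average x (s ^ g)%g = class_average x s.
Proof.
rewrite !class_averageE [RHS](reindex_inj (mulgI g)) /=.
by apply: eq_bigr => h _; rewrite conjgM.
Qed.

Lemma class_average_type x s t : cycle_type s = cycle_type t ->
  class_average x s = class_average x t.
Proof. by case/cycle_type_eq=> g ->; rewrite class_averageJ. Qed.

Local Notation z lam := (class_average (c lam)).

Lemma class_average_orth lam mu : lam != mu -> z lam * z mu = 0.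
Proof.
move=> lm; rewrite mulr_suml big1 // => g _; rewrite mulr_sumr big1 // => h _.
rewrite (_ : _ * _ = gdelta g^-1%g * (c lam * (gdelta g * gdelta h^-1%g) * c mu) * gdelta h).
  by rewrite young_orth // mulr0 mul0r.
by rewrite !mulrA.
Qed.

(** A permutation and its inverse have the same cycle type, so a class average is fixed by [gstar]
    and positivity applies. It is not 0, its value at the identity being n!. *)
Lemma class_average_square_neq0 lam : z lam * z lam != 0.
Proof.
have zE : gstar (z lam) = z lam.
  by apply/ffunP=> s; rewrite ffunE; apply/class_average_type/cycle_typeV.
apply/eqP; rewrite -{2}zE => /mul_gstar_eq0/ffunP/(_ 1%g)/eqP.
rewrite class_averageE (eq_bigr (fun=> 1)) => [|g _]; last by rewrite conj1g young1.
rewrite sumr_const ffunE -scaler_nat scaler_eq0 oner_eq0 orbF pnatr_eq0.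
by rewrite card_Sn eqn0Ngt fact_gt0.
Qed.

Lemma class_average_free (k : intpart n -> rat) :
  \sum_lam k lam *: z lam = 0 -> forall lam, k lam = 0.
Proof.
move=> k0 mu; have : (\sum_lam k lam *: z lam) * z mu = 0 by rewrite k0 mul0r.
rewrite mulr_suml (bigD1 mu) //= big1 => [|lam lm]; last first.
  by rewrite galgZAl class_average_orth ?scaler0.
rewrite addr0 galgZAl => /eqP; rewrite scaler_eq0.
by rewrite (negPf (class_average_square_neq0 mu)) orbF => /eqP.
Qed.

(* The averages of the Young symmetrizers are independent functions of the *)
(* cycle type, and as numerous as the cycle types, so they span the center. *)
Lemma class_average_span : exists k : intpart n -> rat, 1 = \sum_lam k lam *: z lam.
Proof.
pose N := #|{: intpart n}|.
pose F lam mu : rat := if [pick s | cycle_type s == mu] is Some s then z lam s else 0.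
have FE lam s : F lam (cycle_type s) = z lam s.
  rewrite /F; case: pickP => [t /eqP|/(_ s)]; last by rewrite eqxx.
  exact: class_average_type.
pose M : 'M[rat]_N := \matrix_(i, j) F (enum_val i) (enum_val j).
have Mfree : row_free M.
  apply: inj_row_free => v vM; apply/rowP=> i; rewrite mxE.
  rewrite -[i]enum_valK; pose k lam := v 0 (enum_rank lam).
  apply: (@class_average_free k); apply/ffunP=> s; rewrite sum_ffunE ffunE.
  have /rowP/(_ (enum_rank (cycle_type s))) := vM; rewrite !mxE => E.
  rewrite -[RHS]E (reindex_onto enum_val enum_rank) => [|lam _]; last exact: enum_rankK.
  apply: eq_big => [j|j _]; first by rewrite enum_valK eqxx.
  by rewrite ffunE /k enum_valK mxE enum_rankK FE.
have Mu : M \in unitmx by rewrite -row_free_unit.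
(* The unit, as a function of the cycle type, is the indicator of the cycle type of the identity;
   solving [v *m M = e] gives its coefficients. *)
pose e : 'rV[rat]_N := \row_j (enum_val j == cycle_type 1%g)%:R.
pose v := e *m invmx M.
have vM : v *m M = e by rewrite mulmxKV.
exists (fun lam => v 0 (enum_rank lam)); apply/ffunP=> s; rewrite sum_ffunE.
have /rowP/(_ (enum_rank (cycle_type s))) := vM; rewrite !mxE enum_rankK.
have -> : (cycle_type s == cycle_type 1%g) = (s == 1%g).
  apply/eqP/eqP=> [/esym/cycle_type_eq[g ->]|->//]; exact: conj1g.
have -> : (1 : A) s = (s == 1%g)%:R by exact: (ffunE (fun t => (t == 1%g)%:R)).
move=> <-; rewrite [RHS](reindex_onto enum_val enum_rank); last first.
  by move=> lam _; apply: enum_rankK.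
apply: eq_big => [j|j _]; first by rewrite enum_valK eqxx.
by rewrite ffunE enum_valK !mxE enum_rankK FE.
Qed.

End Completeness.

(** * Bases of finite-dimensional subspaces *)

Section Independence.
Local Open Scope ring_scope.
Local Open Scope classical_set_scope.
Variable V : lmodType rat.
Implicit Types (s : seq V) (S : set V).

Definition independent s := forall k : nat -> rat,
  \sum_(i < size s) k i *: s`_i = 0 -> forall i, (i < size s)%N -> k i = 0.

Lemma independent_rcons s v : independent s ->
  ~ (exists k : nat -> rat, v = \sum_(i < size s) k i *: s`_i) ->
  independent (rcons s v).
Proof.
move=> ind nv k; rewrite size_rcons big_ord_recr /= nth_rcons ltnn eqxx.
rewrite (eq_bigr (fun i : 'I__ => k i *: s`_i)) => [k0|i _]; last first.
  by rewrite nth_rcons ltn_ord.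
have ks : k (size s) = 0.
  apply/eqP/negPn/negP=> knz; apply: nv.
  exists (fun i => - (k (size s))^-1 * k i); apply: (scalerI knz).
  have /eqP := k0; rewrite addrC addr_eq0 => /eqP->; rewrite scaler_sumr -sumrN.
  by apply: eq_bigr => i _; rewrite scalerA mulrA mulrN mulfV // mulN1r scaleNr.
rewrite ks scale0r addr0 in k0 => i; rewrite ltnS leq_eqVlt => /orP[/eqP->//|].
exact: ind.
Qed.

Lemma independent_image (U : vectType rat) (phi : {linear U -> V}) s :
  independent s -> (forall v, v \in s -> exists x, v = phi x) ->
  (size s <= \dim {:U})%N.
Proof.
move=> ind im; have [|t tE] := @seq_preimage _ _ phi s.
  by move=> v /im[x ->]; exists x.
have szt : size s = size t by rewrite -tE size_map.
have : free t.
  apply/(@freeP _ _ _ (in_tuple t)) => k k0 i.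
  pose k' j := if insub j is Some i' then k i' else 0.
  have k'E (j : 'I_(size t)) : k' j = k j by rewrite /k' valK.
  rewrite -k'E; apply: ind; last by rewrite szt.
  have := congr1 phi k0; rewrite linear0 linear_sum szt => kk; rewrite -[RHS]kk.
  by apply: eq_bigr => j _; rewrite linearZ k'E -tE (nth_map 0).
by rewrite szt => /eqP<-; apply: dimvS; apply: subvf.
Qed.

(** The dimension of [U] bounds the length of independent lists in the image of [phi]; an
    independent list of maximal length in [S] spans [S]. *)
Lemma finite_basis (U : vectType rat) (phi : {linear U -> V}) S :
    is_subspace S -> (forall v, S v -> exists x, v = phi x) ->
  exists s, [/\ forall v, v \in s -> S v, independent s
    & forall v, S v -> exists k : nat -> rat, v = \sum_(i < size s) k i *: s`_i].
Proof.
move=> sS im.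
pose P d := `[< exists2 s, (forall v, v \in s -> S v) /\ independent s & size s = d >].
have exP : exists d, P d.
  by exists 0; apply/asboolP; exists [::] => //; split=> // k _ [].
have ubP d : P d -> (d <= \dim {:U})%N.
  move=> /asboolP[s [sS' ind] <-]; apply: (independent_image ind) => v /sS'.
  exact: im.
case: (ex_maxnP exP ubP) => d /asboolP[s [sS' ind] szs] maxd.
exists s; split=> // v Sv; apply: contrapT => nv.
have /maxd : P d.+1; last by rewrite ltnn.
apply/asboolP; exists (rcons s v); last by rewrite size_rcons szs.
split; last exact: independent_rcons.
by move=> u; rewrite mem_rcons inE => /orP[/eqP->|/sS'].
Qed.

End Independence.

(** * Monogenic modules *)

Section GroupModule.
Local Open Scope ring_scope.
Local Open Scope classical_set_scope.
Variables (n : nat) (V : lmodType rat) (act : 'S_n -> V -> V).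
Hypothesis act_linear : forall s, linear (act s).
Hypothesis act1 : forall v, act 1%g v = v.
Hypothesis actM : forall s t v, act s (act t v) = act (t * s)%g v.
Local Notation A := (group_alg n).
Local Notation c := (@young_symmetrizer n).
Implicit Types (lam mu : intpart n) (x y : A) (s t : 'S_n) (u v w : V).

HB.instance Definition _ s := GRing.isLinear.Build rat V V *:%R (act s) (act_linear s).

Definition galg_act x v : V := \sum_s x s *: act s v.

Fact galg_act_linear x : linear (galg_act x).
Proof.
move=> k u v; rewrite scaler_sumr -big_split; apply: eq_bigr => s _ /=.
by rewrite linearP scalerDr !scalerA mulrC.
Qed.
HB.instance Definition _ x :=
  GRing.isLinear.Build rat V V *:%R (galg_act x) (galg_act_linear x).

Definition galg_eval v x : V := galg_act x v.

Fact galg_eval_linear v : linear (galg_eval v).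
Proof.
move=> k x y; rewrite /galg_eval /galg_act scaler_sumr -big_split.
by apply: eq_bigr => s _ /=; rewrite !ffunE scalerDl scalerA.
Qed.
HB.instance Definition _ v :=
  GRing.isLinear.Build rat A V *:%R (galg_eval v) (galg_eval_linear v).

Lemma galg_actDl x y v : galg_act (x + y) v = galg_act x v + galg_act y v.
Proof. exact: (linearD (galg_eval v)). Qed.

Lemma galg_actZl k x v : galg_act (k *: x) v = k *: galg_act x v.
Proof. exact: (linearZ_LR (galg_eval v)). Qed.

Lemma galg_act0l v : galg_act 0 v = 0.
Proof. exact: (linear0 (galg_eval v)). Qed.

Lemma galg_act_suml (I : Type) (r : seq I) (P : pred I) (F : I -> A) v :
  galg_act (\sum_(i <- r | P i) F i) v = \sum_(i <- r | P i) galg_act (F i) v.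
Proof. exact: (linear_sum (galg_eval v)). Qed.

Lemma galg_act_delta s v : galg_act (gdelta s) v = act s v.
Proof.
rewrite /galg_act (bigD1 s) //= ffunE eqxx scale1r big1 ?addr0 // => t /negPf ts.
by rewrite ffunE ts scale0r.
Qed.

Lemma galg_act1 v : galg_act 1 v = v.
Proof. by rewrite -[1]/(gdelta 1%g) galg_act_delta. Qed.

Lemma galg_actM x y v : galg_act (x * y) v = galg_act x (galg_act y v).
Proof.
rewrite /galg_act; under eq_bigr => s _ do rewrite ffunE scaler_suml.
rewrite exchange_big; apply: eq_bigr => t _ /=.
rewrite linear_sum scaler_sumr (reindex_inj (mulIg t)).
by apply: eq_bigr => s _ /=; rewrite linearZ /= actM scalerA mulgK.
Qed.

(** This identifies the span of the translates of [c lam] with the left ideal it generates. *)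
Lemma spechtP lam x : reflect (exists y, x = y * c lam) (x \in specht lam).
Proof.
apply: (iffP idP) => [|[y ->]].
  move=> xs; pose X := [seq group_alg_act s (c lam) | s : 'S_n].
  rewrite (@coord_span _ _ _ (in_tuple X) x xs).
  apply: (big_rec (fun x => exists y, x = y * c lam)) => [|i _ _ [y ->]].
    by exists 0; rewrite mul0r.
  have /mapP[s _ ->] : X`_i \in X by apply: mem_nth.
  by eexists; rewrite galg_actE -galgZAl -mulrDl.
rewrite [y]galg_sum mulr_suml; apply: memv_suml => s _.
rewrite galgZAl -galg_actE; apply: memvZ; apply: memv_span.
by apply: map_f; rewrite mem_enum.
Qed.

Section Monogenic.
Variables (W : set V) (g : V).
Hypothesis WE : W = lspan [set act s g | s in [set: 'S_n]].

Lemma monogenicP v : W v <-> exists x, v = galg_act x g.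
Proof.
rewrite WE; split=> [[r rS ->]|[x ->]]; last first.
  apply: subspace_sum => [|s _]; first exact: lspan_subspace.
  by apply: subspaceZ; [exact: lspan_subspace | apply: mem_lspan; exists s].
elim: r rS => [|a r IHr] rS; first by exists 0; rewrite big_nil galg_act0l.
have [|x xE] := IHr; first by move=> b br; apply: rS; rewrite inE br orbT.
have [s _ sE] := rS a (mem_head _ _).
exists (a.1 *: gdelta s + x).
by rewrite big_cons xE galg_actDl galg_actZl galg_act_delta sE.
Qed.

Lemma monogenic_subspace : is_subspace W.
Proof. rewrite WE; exact: lspan_subspace. Qed.

Lemma monogenic_closed x v : W v -> W (galg_act x v).
Proof.
by move=> /monogenicP[y ->]; apply/monogenicP; exists (x * y); rewrite galg_actM.
Qed.

Lemma isotypic_basis lam : exists r : seq V,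
  [/\ forall v, v \in r -> W v /\ exists w, v = galg_act (c lam) w, independent r
    & forall v, W v -> exists k : nat -> rat,
        galg_act (c lam) v = \sum_(i < size r) k i *: r`_i].
Proof.
pose S : set V := [set galg_act (c lam) v | v in W].
have sW := monogenic_subspace.
have sS : is_subspace S.
  split=> [|k u v [u' Wu <-] [v' Wv <-]].
    by exists 0; [apply: subspace0 | rewrite linear0].
  by exists (k *: u' + v'); rewrite ?linearP //; apply: sW.2.
have im v : S v -> exists x, v = galg_eval g x.
  by case=> w /monogenicP[x ->] <-; exists (c lam * x); rewrite /galg_eval galg_actM.
have [r [rS ind gen]] := finite_basis sS im.
exists r; split=> // [v /rS[w Ww <-]|v Wv]; last by apply: gen; exists v.
by split; [apply: monogenic_closed | exists w].
Qed.

(** A family in the sum of copies of the left ideals is sent to the sum of its components applied to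
    the corresponding basis vectors of the spaces [c lam W]. Equivariance is clear; injectivity
    comes from sandwiching with [c lam], surjectivity from [class_average_span]. *)
Lemma monogenic_multiplicities :
  exists mu : intpart n -> nat, has_multiplicities act W mu.
Proof.
have [s sP] := choice isotypic_basis.
pose mu lam := size (s lam); exists mu.
pose f (u : specht_sum_ambient mu) : V :=
  \sum_lam \sum_(j < mu lam) galg_act (u (Tagged (fun lam => 'I_(mu lam)) j)) (s lam)`_j.
have f_lin : linear f.
  move=> k u v; rewrite /f scaler_sumr -big_split; apply: eq_bigr => lam _ /=.
  rewrite scaler_sumr -big_split; apply: eq_bigr => j _ /=.
  by rewrite !ffunE galg_actDl galg_actZl.
pose F : {linear specht_sum_ambient mu -> V} :=
  HB.pack f (GRing.isLinear.Build _ _ _ _ f f_lin).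
have sW := monogenic_subspace.
have Ws lam (j : 'I_(mu lam)) : W (s lam)`_j.
  by have [H _ _] := sP lam; have [] := H _ (mem_nth 0 (ltn_ord j)).
have kapE lam : exists k : rat, k != 0 /\ c lam * c lam = k *: c lam.
  by have [k k0 E] := young_square lam; exists k.
have [kap kapP] := choice kapE.
have cs lam (j : 'I_(mu lam)) : galg_act (c lam) (s lam)`_j = kap lam *: (s lam)`_j.
  have [H _ _] := sP lam; have [_ [w ->]] := H _ (mem_nth 0 (ltn_ord j)).
  by rewrite -galg_actM (kapP lam).2 galg_actZl.
exists F => [|t u _]; last first.
  rewrite -[LHS]/(f _) -[in RHS]/(f _) /f linear_sum; apply: eq_bigr => lam _.
  rewrite linear_sum; apply: eq_bigr => j _.
  by rewrite ffunE galg_actE galg_actM galg_act_delta.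
have sSp : is_subspace (@specht_sum n mu).
  split=> [i|k u v Su Sv i]; rewrite !ffunE ?mem0v //.
  by rewrite memvD ?memvZ ?Su ?Sv.
split=> [u Su|u v|v Wv].
- rewrite -[W _]/(W (f u)); apply: subspace_sum => // lam _.
  by apply: subspace_sum => // j _; exact: monogenic_closed.
- move=> Su Sv fuv; apply/eqP; rewrite -subr_eq0; apply/eqP.
  have {Su Sv} Su := subspaceB sSp (set_mem Su) (set_mem Sv).
  have {fuv} : f (u - v) = 0 by rewrite -[LHS]/(F (u - v)) linearB [F u]fuv subrr.
  move: (u - v) Su => {u v} u Su fu0; apply/ffunP=> -[lam j]; rewrite [RHS]ffunE.
  have /spechtP[z zE] := Su (existT _ lam j); rewrite zE.
  (* Applying [c lam * y] to the relation kills the other shapes by [young_orth], and by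
     [young_sandwich] turns each component of shape [lam] into a scalar multiple of a basis
     vector. *)
  apply: young_nondegenerate => y.
  have yE (i : 'I_(mu lam)) : exists k : rat,
      c lam * y * u (Tagged (fun lam => 'I_(mu lam)) i) = k *: c lam.
    have /spechtP[zi ->] := Su (Tagged (fun lam => 'I_(mu lam)) i).
    by rewrite mulrA -[_ * y * zi]mulrA; apply: young_sandwich.
  have [k kE] := choice yE.
  pose k' i := if insub i is Some i' then k i' else 0.
  have k'E (i : 'I_(mu lam)) : k' i = k i by rewrite /k' valK.
  rewrite -zE kE -k'E.
  suff -> : k' j = 0 by rewrite scale0r.
  have [_ ind _] := sP lam; apply: ind (ltn_ord j).
  apply: (scalerI (kapP lam).1); rewrite scaler0.
  have := congr1 (galg_act (c lam * y)) fu0; rewrite linear0 => E; rewrite -[RHS]E.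
  rewrite [in RHS]/f [RHS]linear_sum [RHS](bigD1 lam) //= [X in _ + X]big1 ?addr0.
    rewrite scaler_sumr [RHS]linear_sum; apply: eq_bigr => i _.
    by rewrite /= -galg_actM kE galg_actZl cs k'E !scalerA mulrC.
  move=> nu nulam; rewrite linear_sum big1 // => i _.
  have /spechtP[zi ->] := Su (Tagged (fun lam => 'I_(mu lam)) i).
  rewrite /= -galg_actM mulrA -[_ * y * zi]mulrA young_orth ?galg_act0l //.
  by rewrite eq_sym.
pose I : set V := [set f u | u in @specht_sum n mu].
have sI : is_subspace I.
  split=> [|k _ _ [u Su <-] [v' Sv <-]].
    by exists 0; [apply: subspace0 | rewrite -[LHS]/(F _) linear0].
  by exists (k *: u + v'); [apply: sSp.2 | rewrite -[LHS]/(F _) linearP].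
have Is lam (j : 'I_(mu lam)) y : I (galg_act y (s lam)`_j).
  exists [ffun i => if i == Tagged (fun lam => 'I_(mu lam)) j
                    (* The scalar compensates the factor [kap lam] by which [c lam] acts on its
                       basis vectors. *)
                    then (kap lam)^-1 *: (y * c lam) else 0].
    move=> i; rewrite ffunE; case: eqP => [->|_]; last exact: mem0v.
    by apply/memvZ/spechtP; exists y.
  rewrite /f (bigD1 lam) //= [X in _ + X]big1 ?addr0 => [|nu nulam].
    rewrite (bigD1 j) //= big1 ?addr0 => [|i ij].
      rewrite ffunE eqxx galg_actZl galg_actM cs linearZ /= scalerA mulVf ?scale1r //.
      by case: (kapP lam).
    by rewrite ffunE eq_Tagged /= (negPf ij) galg_act0l.
  rewrite big1 // => i _; rewrite ffunE -tag_eqE /tag_eq /= (negPf nulam).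
  by rewrite galg_act0l.
rewrite -[[set _ | _ in _] _]/(I v) -[v]galg_act1.
(* Write [v] as the unit applied to [v]: it becomes a combination of translates of vectors
   [c lam (h v)], each in the span of the basis for [lam]. *)
have [k ->] := class_average_span n.
rewrite galg_act_suml; apply: subspace_sum => // lam _.
rewrite galg_actZl; apply: subspaceZ => //.
rewrite galg_act_suml; apply: subspace_sum => // h _.
rewrite !galg_actM; have [_ _ gen] := sP lam.
have [|a ->] := gen (galg_act (gdelta h) v); first exact: monogenic_closed.
rewrite linear_sum; apply: subspace_sum => // j _.
by rewrite linearZ; apply: subspaceZ => //; apply: Is.
Qed.

(** The generator of the j-th copy of [V(lam)] maps to some [x j] applied to [g], and [c lam]
    multiplies it by a nonzero scalar. A linear relation among the [c lam * x j] would thus be one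
    among these generators, so they are independent. *)
Lemma monogenic_multiplicity_le (mu : intpart n -> nat) :
  has_multiplicities act W mu -> forall lam, (mu lam <= \dim (specht lam))%N.
Proof.
case=> f [fW f_inj _] f_act lam; have [kap kap0 ccE] := young_square lam.
have sSp : is_subspace (@specht_sum n mu).
  split=> [i|k u v Su Sv i]; rewrite !ffunE ?mem0v //.
  by rewrite memvD ?memvZ ?Su ?Sv.
pose e (j : 'I_(mu lam)) : specht_sum_ambient mu :=
  [ffun i => if i == Tagged (fun lam => 'I_(mu lam)) j then c lam else 0].
have eS j : specht_sum (e j).
  move=> i; rewrite ffunE; case: eqP => [->|_]; last exact: mem0v.
  by apply/spechtP; exists 1; rewrite mul1r.
have feE j : galg_act (c lam) (f (e j)) = kap *: f (e j).
  rewrite -linearZ -(_ : \sum_s c lam s *: specht_sum_act s (e j) = kap *: e j).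
    by rewrite linear_sum; apply: eq_bigr => s _; rewrite linearZ_LR /= f_act.
  apply/ffunP=> i; rewrite sum_ffunE [RHS]ffunE.
  rewrite (eq_bigr (fun s => c lam s *: (gdelta s * e j i))) => [|s _]; last first.
    by rewrite ffunE [specht_sum_act _ _ _]ffunE galg_actE.
  rewrite (eq_bigr (fun s => (c lam s *: gdelta s) * e j i)) => [|s _]; last first.
    by rewrite galgZAl.
  rewrite -mulr_suml -galg_sum ffunE.
  by case: eqP => _; rewrite ?mulr0 ?scaler0.
have xP j : exists x, f (e j) = galg_act x g by apply/monogenicP/fW.
have [x xE] := choice xP.
(* [y j] is the image of [c lam * x j] under the injection *)
(* [z |-> gstar z * col_sum lam] of the right ideal [c lam * A] in [A * c lam]. *)
pose y j := gstar (x j) * col_sum lam * c lam.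
have y_free (k : 'I_(mu lam) -> rat) :
    \sum_j k j *: y j = 0 -> forall j, k j = 0.
  move=> k0; have cx0 : \sum_j k j *: (c lam * x j) = 0.
    apply: (can_inj (@gstarK n)); rewrite linear0.
    apply: (scalerI kap0); rewrite scaler0.
    have := congr1 ( *%R^~ (row_sum lam)) k0; rewrite mul0r => E; rewrite -[RHS]E.
    rewrite linear_sum scaler_sumr mulr_suml; apply: eq_bigr => j _.
    have := congr1 (@gstar n) ccE.
    rewrite linearZ gstarM /= young_symmetrizerE gstarM gstar_row_sum gstar_col_sum => cc.
    rewrite linearZ /= !gstarM gstar_row_sum gstar_col_sum scalerA mulrC -scalerA.
    rewrite -galgZAr -cc galgZAl /y young_symmetrizerE.
    by rewrite !mulrA.
  have : f (\sum_j k j *: e j) = f 0.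
    rewrite linear0; apply: (scalerI kap0); rewrite scaler0.
    rewrite -[RHS](galg_act0l g) -cx0 galg_act_suml [f _]linear_sum scaler_sumr.
    apply: eq_bigr => j _; rewrite linearZ_LR /= scalerA mulrC -scalerA -feE xE.
    by rewrite galg_actZl galg_actM.
  move/f_inj => E j; have {}E : \sum_j k j *: e j = 0.
    apply: E; apply: mem_set; last exact: (subspace0 sSp).
    by apply: (subspace_sum _ sSp) => i _; apply: (subspaceZ _ sSp).
  move/ffunP/(_ (Tagged (fun lam => 'I_(mu lam)) j)): E.
  have keE i : (k i *: e i) (Tagged (fun lam => 'I_(mu lam)) j) =
      if j == i then k i *: c lam else 0.
    rewrite ffunE /e ffunE eq_Tagged /=.
    by case: eqP => // _; rewrite scaler0.
  rewrite sum_ffunE (eq_bigr _ (fun i _ => keE i)).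
  rewrite (bigD1 j) // eqxx big1 => [|i ij]; last by rewrite eq_sym (negPf ij).
  rewrite [X in X = _ -> _]addr0 [in X in _ = X -> _]ffunE => /eqP.
  by rewrite scaler_eq0 (negPf (young_neq0 lam)) orbF => /eqP.
pose X := [tuple y j | j < mu lam].
have Xfree : free X.
  apply/freeP=> k k0; apply: y_free; rewrite -[RHS]k0; apply: eq_bigr => j _.
  by rewrite -tnth_nth tnth_mktuple.
have /eqP := Xfree; rewrite size_tuple => <-; apply/dimvS/span_subvP=> _ /mapP[j _ ->].
by apply/spechtP; exists (gstar (x j) * col_sum lam).
Qed.

End Monogenic.
End GroupModule.

(** * Straightening in the Kriz model *)

Section UpToSign.
Local Open Scope ring_scope.

(** Signs do not affect membership in subspaces, so reorderings of odd factors are recorded only up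
    to this relation. *)
Definition up_to_sign (V : zmodType) (u v : V) := u = v \/ u = - v.

Lemma up_to_sign_refl (V : zmodType) (u : V) : up_to_sign u u.
Proof. by left. Qed.

Lemma up_to_signN (V : zmodType) (u v : V) : u = - v -> up_to_sign u v.
Proof. by right. Qed.

Lemma up_to_sign_sym (V : zmodType) (u v : V) : up_to_sign u v -> up_to_sign v u.
Proof. by case=> ->; [left | right; rewrite opprK]. Qed.

Lemma up_to_sign_trans (V : zmodType) (v u w : V) :
  up_to_sign u v -> up_to_sign v w -> up_to_sign u w.
Proof.
by case=> -> [] ->; [left | right | right | left; rewrite opprK].
Qed.

Lemma up_to_sign_mul (R : pzRingType) (u u' v v' : R) :
  up_to_sign u u' -> up_to_sign v v' -> up_to_sign (u * v) (u' * v').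
Proof.
by case=> -> [] ->; rewrite ?mulrN ?mulNr ?opprK; [left | right | right | left].
Qed.

Lemma up_to_sign_sign (R : pzRingType) k (u : R) : up_to_sign ((-1) ^+ k * u) u.
Proof. by rewrite -signr_odd mulr_sign; case: ifP; [right | left]. Qed.

Lemma up_to_sign_in (V : lmodType rat) (W : set V) u v :
  is_subspace W -> up_to_sign u v -> W v -> W u.
Proof. by move=> sW [->|->] // Wv; rewrite -scaleN1r; apply: subspaceZ. Qed.

Lemma prod_commute_sign (R : pzRingType) (I : Type) (F : I -> R) (r : seq I) (u : R) :
    (forall i, up_to_sign (F i * u) (u * F i)) ->
  up_to_sign (\prod_(i <- r) F i * u) (u * \prod_(i <- r) F i).
Proof.
move=> Fu; elim: r => [|i r IHr]; first by rewrite big_nil mul1r mulr1; left.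
rewrite big_cons -mulrA.
apply: (up_to_sign_trans (up_to_sign_mul (up_to_sign_refl _) IHr)).
by rewrite !mulrA; apply: up_to_sign_mul; [apply: Fu | left].
Qed.

Lemma prod_perm_sign (R : pzRingType) (I : eqType) (F : I -> R) (r1 r2 : seq I) :
    (forall i j, up_to_sign (F i * F j) (F j * F i)) -> perm_eq r1 r2 ->
  up_to_sign (\prod_(i <- r1) F i) (\prod_(i <- r2) F i).
Proof.
move=> F_comm; elim: r1 r2 => [|i r1 IHr] r2.
  by rewrite perm_sym => /perm_nilP->; left.
move=> pr; have : i \in r2 by rewrite -(perm_mem pr) mem_head.
move=> /splitPr r2E; case: r2E pr => [a b].
rewrite perm_sym (perm_catCA a [:: i] b) /= perm_cons perm_sym => /IHr.
rewrite big_cons !big_cat big_cons /= => E.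
apply: (up_to_sign_trans (up_to_sign_mul (up_to_sign_refl _) E)).
rewrite !mulrA; apply: up_to_sign_mul; last by left.
by apply/up_to_sign_sym/prod_commute_sign => j; apply: F_comm.
Qed.

End UpToSign.

(** * The defining relations of the model in usable form *)

Section KrizAlgebra.
Local Open Scope ring_scope.
Variables (m n : nat) (X : cohomology m).
Local Notation E := (kriz n X).
Local Notation p := (@kriz_p m n X).
Local Notation G := (@kriz_G m n X).
Implicit Types (i j k l a b : 'I_n) (x y z : X).

Let relE r s : kriz_rel (@free_p m n X) (@free_G m n X) r s ->
  kriz_proj r = kriz_proj s.
Proof. exact: presented_relE. Qed.

Let projM u v : @kriz_proj m n X (u * v) = kriz_proj u * kriz_proj v.
Proof. exact: rmorphM. Qed.
Let projS (d : nat) u : @kriz_proj m n X ((-1) ^+ d * u) = (-1) ^+ d * kriz_proj u.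
Proof. by rewrite projM rmorph_sign. Qed.

Lemma kriz_scalerAl (c : rat) (u v : E) : c *: (u * v) = (c *: u) * v.
Proof. exact: presented_scalerAl. Qed.

Lemma kriz_scalerAr (c : rat) (u v : E) : c *: (u * v) = u * (c *: v).
Proof. exact: presented_scalerAr. Qed.

Lemma kriz_p_linear i c x y : p i (c *: x + y) = c *: p i x + p i y.
Proof.
rewrite /kriz_p (relE (kriz_lin _ _ _ _ _ _)).
by rewrite [LHS]raddfD /= [kriz_proj (_ *: _)]linearZ_LR.
Qed.

Lemma kriz_p1 i : p i 1 = 1.
Proof. by rewrite /kriz_p (relE (kriz_one _ _ _)); apply: rmorph1. Qed.

Lemma kriz_pM i x y : p i (x * y) = p i x * p i y.
Proof. by rewrite /kriz_p (relE (kriz_mul _ _ _ _ _)) projM. Qed.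

Lemma kriz_p_comm i j d d' x y : x \in coh X d -> y \in coh X d' ->
  p i x * p j y = (-1) ^+ (d * d') * (p j y * p i x).
Proof.
move=> xa yb; rewrite -[LHS]projM (relE (kriz_PP _ _ _ _ xa yb)).
by rewrite projS projM.
Qed.

Lemma kriz_G_anti i j k l : G i j * G k l = - (G k l * G i j).
Proof.
rewrite -[LHS]projM (relE (kriz_GG _ _ _ _ _ _)) -projM.
exact: raddfN.
Qed.

Lemma kriz_G_square i j : G i j * G i j = 0.
Proof. by rewrite -[LHS]projM (relE (kriz_sqr _ _ _ _)); apply: raddf0. Qed.

Lemma kriz_G_diag i : G i i = 0.
Proof. by rewrite /kriz_G (relE (kriz_Gii _ _ _)); apply: raddf0. Qed.

Lemma kriz_G_sym i j : G j i = G i j.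
Proof. exact/relE/kriz_sym. Qed.

Lemma kriz_pG i j x : p j x * G i j = p i x * G i j.
Proof.
case: (ltngtP i j) => [ij|ji|/val_inj-> //].
  by rewrite -[LHS]projM -[RHS]projM; apply/relE/kriz_PG.
by rewrite -kriz_G_sym -[LHS]projM -[RHS]projM; apply/esym/relE/kriz_PG.
Qed.

(** When two indices coincide both sides vanish; otherwise this is the ordered relation,
    permuted. *)
Lemma kriz_G_arnold i j k : G i k * G j k = G i j * G j k - G i j * G i k.
Proof.
have [->|ij] := eqVneq i j.
  by rewrite kriz_G_square kriz_G_diag !mul0r subrr.
have [->|jk] := eqVneq j k.
  by rewrite kriz_G_diag !mulr0 kriz_G_square subrr.
have [->|ik] := eqVneq i k.
  by rewrite kriz_G_diag mulr0 mul0r -kriz_G_sym kriz_G_square subrr.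
apply: arnold_perm => // [a b|a b c d|a b c abc].
- exact: kriz_G_sym.
- exact: kriz_G_anti.
- rewrite -[LHS]projM (relE (kriz_arnold _ _ abc)) -!projM.
  exact: raddfB.
Qed.

Definition gprod (e : seq ('I_n * 'I_n)) : E := \prod_(ij <- e) G ij.1 ij.2.

Lemma gprod_nil : gprod [::] = 1.
Proof. exact: big_nil. Qed.

Lemma gprod_cons ij e : gprod (ij :: e) = G ij.1 ij.2 * gprod e.
Proof. exact: big_cons. Qed.

Lemma gprod_cat e1 e2 : gprod (e1 ++ e2) = gprod e1 * gprod e2.
Proof. exact: big_cat. Qed.

Lemma gprod_perm e1 e2 : perm_eq e1 e2 -> up_to_sign (gprod e1) (gprod e2).
Proof.
by apply: prod_perm_sign => ij kl; apply: up_to_signN; apply: kriz_G_anti.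
Qed.

Lemma gprod_comm e i j : up_to_sign (gprod e * G i j) (G i j * gprod e).
Proof.
by apply: prod_commute_sign => ij; apply: up_to_signN; apply: kriz_G_anti.
Qed.

(** Each edge of a path from [a] to [b] can be brought next to the label, which then crosses it; the
    sign of the reordering cancels. *)
Lemma p_gprod_move e a b x : connect (graph_adj e) a b ->
  p a x * gprod e = p b x * gprod e.
Proof.
have edge i j : (i, j) \in e -> p i x * gprod e = p j x * gprod e.
  move=> /perm_to_rem/gprod_perm; rewrite gprod_cons /=.
  by case=> ->; rewrite ?mulrN !mulrA kriz_pG.
case/connectP=> s + ->; elim: s a => //= c s IHs a /andP[/orP ac /IHs <-].
by case: ac => /edge.
Qed.

End KrizAlgebra.

(** * Connected components of edge lists and their smallest vertices *)

Section EdgeLists.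
Local Open Scope nat_scope.
Variable n : nat.
Implicit Types (e : seq ('I_n * 'I_n)) (i j u v : 'I_n).

Lemma connect_adjC e : connect_sym (graph_adj e).
Proof. by apply: sym_connect_sym => i j; rewrite /graph_adj orbC. Qed.

Lemma connect_adj1 e i j : (i, j) \in e -> connect (graph_adj e) i j.
Proof. by move=> ije; apply: connect1; rewrite /graph_adj ije. Qed.

Lemma connect_adj_sub e1 e2 :
  (forall i j, (i, j) \in e1 -> connect (graph_adj e2) i j) ->
  subrel (connect (graph_adj e1)) (connect (graph_adj e2)).
Proof.
move=> H; apply: connect_sub => i j /orP[/H//|/H].
by rewrite connect_adjC.
Qed.

Lemma connect_adj_eq e1 e2 :
  (forall i j, (i, j) \in e1 -> connect (graph_adj e2) i j) ->
  (forall i j, (i, j) \in e2 -> connect (graph_adj e1) i j) ->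
  connect (graph_adj e1) =2 connect (graph_adj e2).
Proof.
by move=> H1 H2 u v; apply/idP/idP; apply: connect_adj_sub.
Qed.

Lemma connect_adj_mem e1 e2 : e1 =i e2 ->
  connect (graph_adj e1) =2 connect (graph_adj e2).
Proof.
by move=> E; apply: connect_adj_eq => i j; [rewrite E|rewrite -E]; apply: connect_adj1.
Qed.

(** This is a union step: the class of the end of the edge receives the representative of the class
    of its start. On canonical lists the representatives are the smallest vertices. *)
Definition merge_root (r : 'I_n -> 'I_n) (ij : 'I_n * 'I_n) : 'I_n -> 'I_n :=
  fun v => if r v == r ij.2 then r ij.1 else r v.
Definition root e : 'I_n -> 'I_n := foldl merge_root id e.

Lemma root_rcons e ij : root (rcons e ij) = merge_root (root e) ij.
Proof. by rewrite /root foldl_rcons. Qed.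

Lemma connect_rootE e u v : connect (graph_adj e) u v = (root e u == root e v).
Proof.
elim/last_ind: e u v => [|e ij IHe] u v.
  apply/idP/eqP=> [/connectP[[|w s] //= _ ->//]|].
  by rewrite /root /= => ->; apply: connect0.
rewrite root_rcons; set r := root e in IHe *.
have sub : subrel (connect (graph_adj e)) (connect (graph_adj (rcons e ij))).
  by apply: connect_adj_sub => a b abe; apply: connect_adj1; rewrite mem_rcons inE abe orbT.
have cij : connect (graph_adj (rcons e ij)) ij.1 ij.2.
  by apply: connect_adj1; rewrite mem_rcons inE -surjective_pairing eqxx.
have cji : connect (graph_adj (rcons e ij)) ij.2 ij.1 by rewrite connect_adjC.
apply/idP/eqP=> [|].
  have edge a b : (a, b) \in rcons e ij -> merge_root r ij a = merge_root r ij b.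
    rewrite mem_rcons inE => /orP[/eqP <-|/connect_adj1]; rewrite /merge_root /=.
      by rewrite eqxx; case: ifP.
    by rewrite IHe => /eqP->.
  case/connectP=> s + ->; elim: s u => //= w s IHs u /andP[/orP uw /IHs <-].
  by case: uw => /edge.
rewrite /merge_root; case: eqP => [/eqP uj|_]; case: eqP => [/eqP vj|_].
- by move=> _; apply: sub; rewrite IHe (eqP uj) eq_sym.
- move=> /eqP iv; apply: connect_trans (sub _ _ _) (connect_trans cji (sub _ _ _)).
    by rewrite IHe.
  by rewrite IHe.
- move=> /eqP ui; apply: connect_trans (sub _ _ _) (connect_trans cij (sub _ _ _)).
    by rewrite IHe.
  by rewrite IHe eq_sym.
- by move=> /eqP uv; apply: sub; rewrite IHe.
Qed.

Definition targets e := [seq ij.2 | ij <- e].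

Definition canonical_edges e :=
  all (fun ij : 'I_n * 'I_n => ij.1 < ij.2) e && sorted ltn [seq val ij.2 | ij <- e].

Lemma canonical_edges_rcons e i j : canonical_edges (rcons e (i, j)) ->
  [/\ canonical_edges e, i < j & forall k, k \in targets e -> k < j].
Proof.
rewrite /canonical_edges all_rcons map_rcons.
rewrite !(sorted_pairwise ltn_trans) pairwise_rcons.
move=> /andP[/andP[ij ->] /andP[/allP lt ->]]; split=> // k /mapP[kl kle ->].
by apply: lt; apply: map_f.
Qed.

Lemma canonical_targets_uniq e : canonical_edges e -> uniq (targets e).
Proof.
case/andP=> _ /(sorted_uniq ltn_trans ltnn).
by rewrite (map_comp val snd) map_inj_uniq //; apply: val_inj.
Qed.

(** The last edge of a canonical list ends at a vertex beyond all earlier targets, hence one that is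
    still its own root, and it starts from a component with a smaller root. *)
Lemma canonical_root e : canonical_edges e -> forall v,
  [/\ root e v <= v, (root e v == v) = (v \notin targets e)
    & root e (root e v) = root e v].
Proof.
elim/last_ind: e => [|e [i j] IHe]; first by move=> _ v; rewrite /root /= eqxx leqnn.
case/canonical_edges_rcons=> /IHe {}IHe ij ltj v.
have jt : j \notin targets e by apply/negP=> /ltj; rewrite ltnn.
have rj : root e j = j by have [_ + _] := IHe j; rewrite jt => /eqP.
have ri_lt : root e i < j by have [ri _ _] := IHe i; apply: leq_ltn_trans ij.
have ri_j : (root e i == j) = false by rewrite -val_eqE ltn_eqF.
have [le_v tE idem] := IHe v; have [_ _ idemi] := IHe i.
rewrite root_rcons /merge_root /= rj /targets map_rcons mem_rcons inE negb_or -/(targets e).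
have [rvj|rvj] := eqVneq (root e v) j.
  have ri_v : root e i < v by apply: leq_trans le_v; rewrite rvj.
  split; [exact: ltnW| |by rewrite idemi ri_j].
  rewrite -val_eqE ltn_eqF //; apply/esym/negbTE; rewrite negb_and negbK.
  by rewrite -tE rvj eq_sym orbN.
split=> //; last by rewrite idem (negPf rvj).
have [vj|_] := eqVneq v j; last by rewrite tE.
by move: rvj; rewrite vj rj eqxx.
Qed.

Lemma root_min e v : canonical_edges e ->
  [forall j, connect (graph_adj e) v j ==> (v <= j)] = (v \notin targets e).
Proof.
move=> ce; have [le_v <- idem] := canonical_root ce v.
apply/forallP/eqP=> [/(_ (root e v))|E j].
  rewrite connect_rootE idem eqxx /= => le'.
  by apply/val_inj/eqP; rewrite eqn_leq le_v.
apply/implyP; rewrite connect_rootE E => /eqP ->.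
by have [] := canonical_root ce j.
Qed.

End EdgeLists.

Section Duplicates.
Lemma not_uniq_map (T U : eqType) (f : T -> U) (s : seq T) : ~~ uniq (map f s) ->
  exists x y r, perm_eq s [:: x, y & r] /\ f x = f y.
Proof.
elim: s => //= x s IHs; rewrite negb_and negbK => /orP[/mapP[y ys E]|/IHs].
  exists x, y, (rem y s); split=> //; by rewrite perm_cons perm_to_rem.
move=> [y [z [r [ps E]]]]; exists y, z, (x :: r); split=> //.
rewrite -(perm_cons x) in ps; apply: perm_trans ps _.
by rewrite -[[:: x, _ & _]]/([:: x] ++ [:: y; z] ++ r) perm_catCA.
Qed.
End Duplicates.

(** * Straightening a product of edges into canonical products *)

Section Straightening.
Local Open Scope ring_scope.
Local Open Scope classical_set_scope.
Variables (m n : nat) (X : cohomology m).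
Local Notation E := (kriz n X).
Local Notation gprod := (@gprod m n X).
Implicit Types (e : seq ('I_n * 'I_n)) (i j k : 'I_n).

Definition kriz_mull (u v : E) := u * v.
Definition kriz_mulr (u v : E) := v * u.

Fact kriz_mull_linear u : linear (kriz_mull u).
Proof. by move=> c v w; rewrite /kriz_mull mulrDr -kriz_scalerAr. Qed.
HB.instance Definition _ u :=
  GRing.isLinear.Build rat E E *:%R (kriz_mull u) (kriz_mull_linear u).

Fact kriz_mulr_linear u : linear (kriz_mulr u).
Proof. by move=> c v w; rewrite /kriz_mulr mulrDl -kriz_scalerAl. Qed.
HB.instance Definition _ u :=
  GRing.isLinear.Build rat E E *:%R (kriz_mulr u) (kriz_mulr_linear u).

Lemma lspan_mull (S W : set E) u : is_subspace W ->
  (forall v, S v -> W (u * v)) -> forall v, lspan S v -> W (u * v).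
Proof. by move=> sW; apply: (lspan_linear (f := kriz_mull u)). Qed.

Lemma lspan_mulr (S W : set E) u : is_subspace W ->
  (forall v, S v -> W (v * u)) -> forall v, lspan S v -> W (v * u).
Proof. by move=> sW; apply: (lspan_linear (f := kriz_mulr u)). Qed.

Lemma gprod0 e i : (i, i) \in e -> gprod e = 0.
Proof.
move=> /perm_to_rem/(@gprod_perm m n X).
by rewrite gprod_cons kriz_G_diag mul0r => -[]->; rewrite ?oppr0.
Qed.

Definition straight e : set E :=
  [set u | exists e', [/\ canonical_edges e', size e' = size e,
     connect (graph_adj e') =2 connect (graph_adj e) & u = gprod e']].

Lemma straight_sub e1 e2 : size e1 = size e2 ->
  connect (graph_adj e1) =2 connect (graph_adj e2) -> straight e1 `<=` straight e2.
Proof.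
move=> sE cE u [e [ce se ge ->]]; exists e; split=> //; first by rewrite se.
by move=> i j; rewrite ge cE.
Qed.

(** This measure decreases when the Arnold relation separates two edges with the same larger
    endpoint. *)
Definition edge_weight e := (\sum_(ij <- e) maxn ij.1 ij.2)%N.

Lemma straight_perm e1 e2 : perm_eq e1 e2 ->
  lspan (straight e2) (gprod e2) -> lspan (straight e1) (gprod e1).
Proof.
move=> pe12 H; apply: (up_to_sign_in (lspan_subspace _) (gprod_perm X pe12)).
apply: (lspan_min (lspan_subspace _) _ H) => u /(@straight_sub _ e1) S.
by apply/mem_lspan/S; [rewrite (perm_size pe12) | apply/connect_adj_mem => z; rewrite (perm_mem pe12)].
Qed.

Definition orient (ij : 'I_n * 'I_n) := if (ij.1 < ij.2)%N then ij else (ij.2, ij.1).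

(** Loops and repeated edges give 0. If two edges have the same larger endpoint [k], the Arnold
    relation replaces one of them by an edge joining two vertices below [k], lowering the weight. If
    all larger endpoints differ, sorting by them gives a canonical list. *)
Lemma gprod_straight e : lspan (straight e) (gprod e).
Proof.
have [w] := ubnP (edge_weight e); elim: w e => // w IHw e we.
have [/hasP[[i j] /= ije /eqP ij]|/hasPn nd] := boolP (has (fun ij => ij.1 == ij.2) e).
  by rewrite -ij in ije; rewrite (gprod0 ije); apply: subspace0; apply: lspan_subspace.
pose e1 := map orient e.
have ge1 : gprod e1 = gprod e.
  rewrite /gprod big_map; apply: eq_bigr => -[i j] _; rewrite /orient.
  by case: ifP => //= _; apply: kriz_G_sym.
have we1 : edge_weight e1 = edge_weight e.
  rewrite /edge_weight big_map; apply: eq_bigr => -[i j] _; rewrite /orient.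
  by case: ifP => //= _; apply: maxnC.
have ce1 : connect (graph_adj e1) =2 connect (graph_adj e).
  apply: connect_adj_eq => i j.
    case/mapP=> -[a b] abe; rewrite /orient /=; case: ifP => _ [-> ->].
      exact: connect_adj1.
    by rewrite connect_adjC; apply: connect_adj1.
  move=> ije; have : orient (i, j) \in e1 by apply: map_f.
  rewrite /orient /=; case: ifP => _; first exact: connect_adj1.
  by rewrite connect_adjC; apply: connect_adj1.
have lt1 : all (fun ij : 'I_n * 'I_n => (ij.1 < ij.2)%N) e1.
  rewrite all_map; apply/allP=> -[i j] /nd /=; rewrite /orient /=.
  by case: (ltngtP i j) => //= /val_inj->; rewrite eqxx.
suff core : lspan (straight e1) (gprod e1).
  rewrite -ge1; apply: (lspan_min (lspan_subspace _)) core => u Su.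
  by apply: mem_lspan; apply: straight_sub Su; [apply: size_map | exact: ce1].
rewrite -we1 in we; clearbody e1; move: e1 we lt1 {ge1 ce1 we1 nd e} => e we lt1.
have [ut|] := boolP (uniq (targets e)).
  pose le2 (ij kl : 'I_n * 'I_n) := (ij.2 <= kl.2)%N.
  apply: (@straight_perm _ (sort le2 e)); first by rewrite perm_sym perm_sort.
  apply: mem_lspan; exists (sort le2 e); split=> //.
  rewrite /canonical_edges (perm_all _ (permEl (perm_sort _ _))) lt1 /=.
  rewrite ltn_sorted_uniq_leq; apply/andP; split.
    rewrite (perm_uniq (perm_map _ (permEl (perm_sort _ _)))).
    by rewrite (map_comp val snd) map_inj_uniq //; apply: val_inj.
  rewrite sorted_map; apply: sort_sorted => i j; exact: leq_total.
case/not_uniq_map=> -[i k] [[j k'] [r [pe /= kE]]]; subst k'.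
apply: (straight_perm pe).
have := perm_all (fun ij : 'I_n * 'I_n => (ij.1 < ij.2)%N) pe.
rewrite lt1 => /esym/and3P[/= ik jk ltr].
rewrite /edge_weight (perm_big _ pe) !big_cons /= in we.
have [ij|ij] := eqVneq i j.
  rewrite (_ : gprod _ = 0); first by apply: subspace0; apply: lspan_subspace.
  by rewrite !gprod_cons mulrA ij kriz_G_square mul0r.
(* Any two edges of the triangle on [a], [b], [c] connect the same three vertices. *)
have conn a b c l (e1 := [:: (a, c), (b, c) & r]) (e2 := [:: (a, b), l & r]) :
    l = (b, c) \/ l = (a, c) ->
  connect (graph_adj e2) =2 connect (graph_adj e1).
  have tr x y z e' : connect (graph_adj e') x y -> connect (graph_adj e') y z ->
      connect (graph_adj e') x z by apply: connect_trans.
  have in1 e' l' : l' \in e' -> connect (graph_adj e') l'.1 l'.2.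
    by case: l' => x y; apply: connect_adj1.
  have in2 e' l' : l' \in e' -> connect (graph_adj e') l'.2 l'.1.
    by move/in1; rewrite connect_adjC.
  move=> lE; have ac1 : (a, c) \in e1 by rewrite !inE eqxx.
  have bc1 : (b, c) \in e1 by rewrite !inE eqxx orbT.
  have ab2 : (a, b) \in e2 by rewrite !inE eqxx.
  have l2 : l \in e2 by rewrite !inE eqxx orbT.
  apply: connect_adj_eq => x y; rewrite !inE => /or3P[/eqP[-> ->]|/eqP xy|xyr].
  - exact: tr (in1 _ _ ac1) (in2 _ _ bc1).
  - by case: lE xy => -> [-> ->]; apply: connect_adj1.
  - by apply: connect_adj1; rewrite !inE xyr !orbT.
  - case: lE l2 => -> l2; last exact: in1 l2.
    exact: tr (in1 _ _ ab2) (in1 _ _ l2).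
  - case: xy lE l2 => -> -> [] -> l2; first exact: in1 l2.
    exact: tr (in2 _ _ ab2) (in1 _ _ l2).
  - by apply: connect_adj1; rewrite !inE xyr !orbT.
have step l : l = (j, k) \/ l = (i, k) ->
    lspan (straight [:: (i, k), (j, k) & r]) (gprod [:: (i, j), l & r]).
  move=> lE; apply: (lspan_min (lspan_subspace _)) (IHw _ _) => [u Su|].
    apply: mem_lspan; move: u Su.
    apply: (@straight_sub [:: (i, j), l & r] [:: (i, k), (j, k) & r]); first by [].
    exact: conn.
  move: we; rewrite /edge_weight !big_cons.
  by case: lE => -> /=; lia.
rewrite (_ : gprod _ = gprod [:: (i, j), (j, k) & r] - gprod [:: (i, j), (i, k) & r]).
  by apply: subspaceB; [exact: lspan_subspace | apply: step; left | apply: step; right].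
by rewrite !gprod_cons !mulrA kriz_G_arnold mulrBl.
Qed.

End Straightening.

(** * Path systems *)

Section PathEdges.
Local Open Scope nat_scope.
Variable n : nat.
Implicit Types (s t : seq 'I_n) (i j u v a : 'I_n) (b : 'I_n -> seq 'I_n).

Definition path_edges s : seq ('I_n * 'I_n) := zip s (behead s).

Lemma path_edges_cons i j s : path_edges (i :: j :: s) = (i, j) :: path_edges (j :: s).
Proof. by []. Qed.

Lemma path_edges_cat s i t :
  path_edges (s ++ i :: t) = path_edges (rcons s i) ++ path_edges (i :: t).
Proof.
elim: s => [|k [|l s] IHs] //.
by rewrite !cat_cons path_edges_cons -cat_cons IHs.
Qed.

Lemma path_edges_map (f : 'I_n -> 'I_n) s :
  path_edges (map f s) = [seq (f ij.1, f ij.2) | ij <- path_edges s].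
Proof. by rewrite /path_edges behead_map; elim: s (behead s) => [|x s IHs] [|y t] //=; rewrite IHs. Qed.

Lemma path_edges_mem s u v : (u, v) \in path_edges s -> (u \in s) && (v \in s).
Proof.
elim: s => [|i [|j s] IHs] //; rewrite path_edges_cons inE => /orP[/eqP[-> ->]|/IHs].
  by rewrite !inE !eqxx orbT.
by move=> /andP[us vs]; rewrite 2![_ \in i :: _]in_cons us vs !orbT.
Qed.

Lemma path_edges_connect s u v : u \in s -> v \in s ->
  connect (graph_adj (path_edges s)) u v.
Proof.
have from_head i t w : w \in i :: t -> connect (graph_adj (path_edges (i :: t))) i w.
  elim: t i => [|j t IHt] i; first by rewrite inE => /eqP ->; apply: connect0.
  rewrite inE => /orP[/eqP->|/IHt]; first exact: connect0.
  have ij : connect (graph_adj (path_edges (i :: j :: t))) i j.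
    by apply: connect_adj1; rewrite path_edges_cons mem_head.
  move=> jw; apply: connect_trans ij _; apply: connect_adj_sub jw => x y xy.
  by apply: connect_adj1; rewrite path_edges_cons inE xy orbT.
case: s => // i s /from_head iu /from_head iv.
by apply: connect_trans iv; rewrite connect_adjC.
Qed.

(* When [a] is not a root, [b a] is empty and the last condition holds by the *)
(* default value of [head]. *)
Definition path_system (r : 'I_n -> 'I_n) b := forall a,
  [/\ uniq (b a), forall v, (v \in b a) = (r v == a) & head a (b a) = a].

Definition system_edges b := flatten [seq path_edges (b a) | a <- enum 'I_n].

Lemma system_connect r b : path_system r b -> forall u v,
  connect (graph_adj (system_edges b)) u v = (r u == r v).
Proof.
move=> bP u v; apply/idP/eqP=> [|ruv].
  have edge x y : (x, y) \in system_edges b -> r x = r y.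
    case/flattenP=> _ /mapP[a _ ->] /path_edges_mem.
    by have [_ bE _] := bP a; rewrite !bE => /andP[/eqP-> /eqP->].
  case/connectP=> s + ->; elim: s u => //= w s IHs u /andP[/orP uw /IHs <-].
  by case: uw => /edge.
have [_ bE _] := bP (r u).
have : connect (graph_adj (path_edges (b (r u)))) u v.
  by apply: path_edges_connect; rewrite bE // ruv.
apply: connect_adj_sub => x y xy; apply: connect_adj1; apply/flattenP.
exists (path_edges (b (r u))) => //.
by apply/mapP; exists (r u); rewrite ?mem_enum.
Qed.

Lemma exists_path_system r : (forall v, r (r v) = r v) -> exists b, path_system r b.
Proof.
move=> idem; pose c a := [seq v <- enum 'I_n | r v == a].
have cE a v : (v \in c a) = (r v == a) by rewrite mem_filter mem_enum andbT.
exists (fun a => if a \in c a then a :: rem a (c a) else [::]) => a.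
have uc : uniq (c a) by apply: filter_uniq; apply: enum_uniq.
case: ifP => ac; split=> //.
- by rewrite /= mem_rem_uniq // inE eqxx rem_uniq.
- by move=> v; rewrite -(perm_mem (perm_to_rem ac)) cE.
- move=> v; apply/esym/negbTE; apply: contraFN ac => /eqP rv.
  by rewrite cE -rv idem.
Qed.

End PathEdges.

Section Paths.
Local Open Scope ring_scope.
Local Open Scope classical_set_scope.
Variables (m n : nat) (X : cohomology m).
Local Notation E := (kriz n X).
Local Notation G := (@kriz_G m n X).
Local Notation gprod := (@gprod m n X).
Implicit Types (e : seq ('I_n * 'I_n)) (i j k : 'I_n) (s : seq 'I_n).

(* The Arnold relation G_ic G_ij = G_ic G_cj - G_ij G_jc pushes an edge attached *)
(* to the head of a path either right after the head or further down. *)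
Lemma gprod_path_insert i j s :
  lspan [set u | exists t1 t2, s = t1 ++ t2 /\ u = gprod (path_edges (i :: t1 ++ j :: t2))]
    (gprod (path_edges (i :: s)) * G i j).
Proof.
elim: s i => [|c s IHs] i.
  apply: mem_lspan; exists [::], [::]; split=> //.
  by rewrite gprod_nil mul1r gprod_cons gprod_nil mulr1.
set S := [set _ | _]; have sS : is_subspace (lspan S) := lspan_subspace S.
rewrite path_edges_cons gprod_cons /=; set Q := gprod _.
have QG : up_to_sign (Q * G i j) (G i j * Q).
  exact: gprod_comm.
apply: (up_to_sign_in sS (v := G i c * G i j * Q)).
  by rewrite -!mulrA; apply: up_to_sign_mul QG; left.
have -> : G i c * G i j = G i c * G c j - G i j * G j c.
  rewrite -[G i c]kriz_G_sym -[G i j]kriz_G_sym kriz_G_arnold.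
  rewrite [G c j * G j i]kriz_G_anti [G c j * G c i]kriz_G_anti opprK addrC.
  by rewrite [G j c]kriz_G_sym.
rewrite mulrBl; apply: subspaceB => //; last first.
  apply: mem_lspan; exists [::], (c :: s); split=> //.
  by rewrite !path_edges_cons !gprod_cons mulrA.
have Qc : up_to_sign (G c j * Q) (Q * G c j).
  exact/up_to_sign_sym/gprod_comm.
apply: (up_to_sign_in sS (v := G i c * (Q * G c j))).
  by rewrite -mulrA; apply: up_to_sign_mul Qc; left.
apply: (lspan_mull sS _ (IHs c)).
move=> _ [t1 [t2 [sE ->]]]; apply: mem_lspan; exists (c :: t1), t2.
by split; [rewrite sE | rewrite [in RHS]/= path_edges_cons gprod_cons].
Qed.

Definition path_span e : set E :=
  [set u | exists b, path_system (root e) b /\ u = gprod (system_edges b)].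

(** Induction on the edges, in canonical order. A new edge joins an isolated vertex [j] to a vertex
    [i] inside some path; [gprod_path_insert] applied to the portion of that path from [i] on
    inserts [j] after [i] and keeps the head of the path. *)
Lemma gprod_path_span e : canonical_edges e -> lspan (path_span e) (gprod e).
Proof.
elim/last_ind: e => [|e [i j] IHe] ce.
  apply: mem_lspan; exists (fun a => [:: a]); split=> [a|].
    by split=> // v; rewrite inE /root.
  rewrite gprod_nil /system_edges (_ : flatten _ = [::]) ?gprod_nil //.
  by elim: (enum _).
have ce' := ce; case/canonical_edges_rcons: ce' => ce0 ij ltj.
set S := path_span _; have sS : is_subspace (lspan S) := lspan_subspace S.
rewrite -cats1 gprod_cat [gprod [:: _]]gprod_cons gprod_nil mulr1 /=.
apply: (lspan_mulr sS _ (IHe ce0)).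
move=> _ [b [bP ->]].
have jt : j \notin targets e by apply/negP=> /ltj; rewrite ltnn.
have rj : root e j = j.
  by have [_ + _] := canonical_root ce0 j; rewrite jt => /eqP.
(* All earlier targets are below [j], so the component of [j] is still a single vertex. *)
have r_j v : (root e v == j) = (v == j).
  apply/eqP/eqP=> [rv|->//]; apply/eqP/negPn/negP=> vj.
  have [le_v tE _] := canonical_root ce0 v; rewrite rv in le_v tE.
  have : v \in targets e by rewrite -[_ \in _]negbK -tE eq_sym.
  by move/ltj; rewrite ltnNge le_v.
set r := root e i.
have rj' : r != j by rewrite /r r_j -val_eqE ltn_eqF //.
have [ub mb hb] := bP r.
have ib : i \in b r by rewrite mb.
have [s1 [s2 br]] : exists s1 s2, b r = s1 ++ i :: s2.
  by case/splitPr: ib => s1 s2; exists s1, s2.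
pose rest := rem r (enum 'I_n).
have enumE : perm_eq (enum 'I_n) (r :: rest) by apply: perm_to_rem; rewrite mem_enum.
have r_rest : r \notin rest by rewrite mem_rem_uniqF ?enum_uniq.
pose R := flatten [seq path_edges (b a) | a <- rest].
(* The path of [r] is brought to the end, up to sign, since it is the only nontrivial path that
   changes. *)
have systemE b' : (forall a, a \in rest -> path_edges (b' a) = path_edges (b a)) ->
    up_to_sign (gprod (system_edges b')) (gprod R * gprod (path_edges (b' r))).
  move=> b'E; rewrite -gprod_cat; apply: gprod_perm.
  rewrite /R; have <- : [seq path_edges (b' a) | a <- rest] = [seq path_edges (b a) | a <- rest].
    exact/eq_in_map.
  have := perm_flatten (perm_map (fun a => path_edges (b' a)) enumE).
  by move/perm_trans; apply; rewrite /= perm_catC.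
apply: (up_to_sign_in sS (v := gprod R * gprod (path_edges (rcons s1 i)) *
    (gprod (path_edges (i :: s2)) * G i j))).
  rewrite mulrA; apply: up_to_sign_mul; last by left.
  by apply: up_to_sign_trans (systemE b _) _ => //; rewrite br path_edges_cat gprod_cat mulrA; left.
apply: (lspan_mull sS _ (gprod_path_insert i j s2)).
move=> _ [t1 [t2 [s2E ->]]].
(* The vertex [j] joins the path of [r] and, no longer a root, gets an empty path; its former path
   had one vertex, so no edge is lost. *)
pose b' a := if a == r then s1 ++ i :: t1 ++ j :: t2 else if a == j then [::] else b a.
have bjE : perm_eq (b j) [:: j].
  have [uj mj _] := bP j; apply: uniq_perm => // v.
  by rewrite mj r_j inE.
have b'R a : a \in rest -> path_edges (b' a) = path_edges (b a).
  rewrite /b'; have [->|_ _] := eqVneq a r; first by rewrite (negPf r_rest).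
  by have [->|//] := eqVneq a j; rewrite (perm_small_eq _ bjE).
apply: (up_to_sign_in sS (v := gprod (system_edges b'))).
  apply/up_to_sign_sym/(up_to_sign_trans (systemE b' b'R)).
  by rewrite /b' eqxx path_edges_cat gprod_cat mulrA; left.
apply: mem_lspan; exists b'; split=> // a.
have rootE c v : (root (rcons e (i, j)) v == c) =
    if v == j then r == c else root e v == c.
  by rewrite root_rcons /merge_root /= rj r_j; case: ifP.
have perm_br : perm_eq (s1 ++ i :: t1 ++ j :: t2) (j :: b r).
  rewrite br s2E -!cat_cons !catA perm_catC /= perm_cons.
  by rewrite perm_catC.
rewrite /b'; have [->|ar] := eqVneq a r.
  split=> [|v|].
  - by rewrite (perm_uniq perm_br) /= mb rj eq_sym (negPf rj').
  - rewrite (perm_mem perm_br) inE mb rootE.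
    by case: eqP => //=; rewrite eqxx.
  - by move: hb; rewrite br; case: (s1).
have [->|aj] := eqVneq a j.
  split=> // v; rewrite in_nil rootE r_j (negPf rj').
  by case: eqP.
have [ua ma ha] := bP a; split=> // v.
rewrite ma rootE; have [->|//] := eqVneq v j.
by rewrite rj eq_sym (negPf aj) eq_sym (negPf ar).
Qed.

End Paths.

(** * Coordinates in a homogeneous basis of the cohomology *)

Section Cohomology.
Local Open Scope ring_scope.
Variables (m : nat) (X : cohomology m) (B : homogeneous_basis X).
Implicit Types (x y z : X) (h : hb_index B) (d : nat).

Lemma coh_direct : directv (\sum_(k < (2 * m).+1) coh X k).
Proof. by case: X. Qed.

Lemma coh_large d : (2 * m < d)%N -> coh X d = 0%VS.
Proof. by case: X => /= *; auto. Qed.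

Lemma coh_one : 1 \in coh X 0.
Proof. by case: X => ? coh0 ? ? ? ? /= -> *; apply: memv_line. Qed.

Lemma coh_mul d d' x y : x \in coh X d -> y \in coh X d' -> x * y \in coh X (d + d').
Proof. by case: X x y => /= *; auto. Qed.

Lemma coh_comm d d' x y : x \in coh X d -> y \in coh X d' ->
  x * y = (-1) ^+ (d * d') * (y * x).
Proof. by case: X x y => /= *; auto. Qed.

Lemma coh_independent (u : nat -> X) : (forall d, u d \in coh X d) ->
  \sum_(d < (2 * m).+1) u d = 0 -> forall d, u d = 0.
Proof.
move=> uE u0 d; have [ltd|gtd] := ltnP d (2 * m).+1; last first.
  by apply/eqP; rewrite -memv0 -(coh_large gtd).
have /directv_sum_independent H := coh_direct.
by apply: (H (fun d : 'I_(2 * m).+1 => u d) _ u0 (Ordinal ltd)) => // k _; apply: uE.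
Qed.

Lemma coh_disjoint d d' x : x \in coh X d -> x \in coh X d' -> d != d' -> x = 0.
Proof.
move=> xd xd' dd'.
have [ltd|gtd] := ltnP d (2 * m).+1; last first.
  by apply/eqP; rewrite -memv0 -(coh_large gtd).
have [ltd'|gtd'] := ltnP d' (2 * m).+1; last first.
  by apply/eqP; rewrite -memv0 -(coh_large gtd').
pose u k := if k == d then x else if k == d' then - x else 0.
suff : u d = 0 by rewrite /u eqxx.
apply: coh_independent => [k|].
  rewrite /u; have [->//|_] := eqVneq k d.
  by have [->|_] := eqVneq k d'; rewrite ?memvN ?mem0v.
rewrite (bigD1 (Ordinal ltd)) //= (bigD1 (Ordinal ltd')) /=; last first.
  by rewrite -val_eqE /= eq_sym.
rewrite /u eqxx eq_sym (negPf dd') eqxx big1 ?addr0 ?subrr // => k.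
by rewrite -!val_eqE /= => /andP[/negPf-> /negPf->].
Qed.

Lemma coh_one_deg d : 1 \in coh X d -> d = 0.
Proof.
move=> one_d; apply/eqP/negPn/negP=> d0; have := oner_neq0 X.
by rewrite (coh_disjoint one_d coh_one) // eqxx.
Qed.

Definition hb_tuple := [tuple B h | h < (hb_last B).+1].

Lemma hb_basis : basis_of fullv hb_tuple.
Proof.
suff -> : basis_of fullv hb_tuple = basis_of fullv (codom B) by case: B.
by congr (basis_of _ _).
Qed.

Lemma hb_coh h : B h \in coh X (hb_deg h).
Proof. by case: B h. Qed.

Lemma hb_one : B ord0 = 1.
Proof. by case: B. Qed.

Lemma hb_deg0 : hb_deg (ord0 : hb_index B) = 0.
Proof. by apply: coh_one_deg; rewrite -hb_one hb_coh. Qed.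

Definition hb_coord h x : rat := coord hb_tuple h x.

Fact hb_coord_linear h : linear_for *%R (hb_coord h).
Proof. by move=> k x y; rewrite /hb_coord linearP. Qed.
HB.instance Definition _ h :=
  GRing.isLinear.Build rat X rat *%R (hb_coord h) (hb_coord_linear h).

Lemma hb_coordP x : x = \sum_h hb_coord h x *: B h.
Proof.
rewrite {1}(coord_basis hb_basis (memvf x)); apply: eq_bigr => h _.
by rewrite -tnth_nth tnth_mktuple.
Qed.

Lemma hb_coordE h h' : hb_coord h (B h') = (h == h')%:R.
Proof.
have -> : B h' = hb_tuple`_h' by rewrite -tnth_nth tnth_mktuple.
by rewrite /hb_coord coord_free ?(basis_free hb_basis) // eq_sym.
Qed.

(** Grouping the expansion of [x] by degree writes [x] as a sum of homogeneous parts; as the grading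
    is direct, only the part of degree [d] survives. *)
Lemma hb_coord_deg h d x : x \in coh X d -> hb_deg h != d -> hb_coord h x = 0.
Proof.
move=> xd hd; pose u k := \sum_(h | hb_deg h == k) hb_coord h x *: B h.
have u_coh k : u k \in coh X k.
  by apply: memv_suml => h' /eqP <-; apply/memvZ/hb_coh.
have B0 h' : B h' != 0.
  by apply/eqP=> h0; have := hb_coordE h' h'; rewrite h0 linear0 eqxx.
have Bdeg h' : (hb_deg h' < (2 * m).+1)%N.
  rewrite ltnNge; apply: contra (B0 h') => lt.
  by have := hb_coh h'; rewrite (coh_large lt) memv0.
have uE : u (hb_deg h) = 0.
  (* These are the differences between two homogeneous decompositions of [x]. *)
  pose v k := u k - (if k == d then x else 0).
  have [ltd|gtd] := ltnP d (2 * m).+1; last first.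
    have x0 : x = 0 by apply/eqP; rewrite -memv0 -(coh_large gtd).
    by rewrite /u big1 // => h' _; rewrite x0 linear0 scale0r.
  have -> : u (hb_deg h) = v (hb_deg h) by rewrite /v (negPf hd) subr0.
  apply: coh_independent => [k|].
    by rewrite /v; have [->|_] := eqVneq k d; rewrite memvB ?mem0v.
  rewrite sumrB [X in _ - X](bigD1 (Ordinal ltd)) //= eqxx.
  rewrite [X in _ - (_ + X)]big1 => [|k]; last by rewrite -val_eqE /= => /negPf->.
  rewrite addr0 [X in _ - X]hb_coordP.
  rewrite [X in _ - X](partition_big (fun h => Ordinal (Bdeg h)) predT) //=.
  exact: subrr.
have := congr1 (hb_coord h) uE; rewrite linear0 linear_sum (bigD1 h) //=.
rewrite linearZ /= hb_coordE eqxx mulr1 big1 ?addr0 // => h' /andP[_ hh'].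
by rewrite linearZ /= hb_coordE eq_sym (negPf hh') mulr0.
Qed.

End Cohomology.

(** * Moving coefficients to the roots and expanding them *)

Section PProducts.
Local Open Scope ring_scope.
Local Open Scope classical_set_scope.
Variables (m n : nat) (X : cohomology m) (B : homogeneous_basis X).
Local Notation E := (kriz n X).
Local Notation p := (@kriz_p m n X).
Local Notation gprod := (@gprod m n X).
Implicit Types (e : seq ('I_n * 'I_n)) (i j a : 'I_n) (x y : 'I_n -> X) (d : 'I_n -> nat).

HB.instance Definition _ i :=
  GRing.isLinear.Build rat X E *:%R (kriz_p i) (@kriz_p_linear m n X i).

Definition homogeneous x d := forall a, x a \in coh X (d a).

Lemma p_comm_sign i j k l z w : z \in coh X k -> w \in coh X l ->
  up_to_sign (p i z * p j w) (p j w * p i z).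
Proof. by move=> zk wl; rewrite (kriz_p_comm _ _ zk wl); apply: up_to_sign_sign. Qed.

Lemma p_prod_perm x d r1 r2 : homogeneous x d -> perm_eq r1 r2 ->
  up_to_sign (\prod_(a <- r1) p a (x a)) (\prod_(a <- r2) p a (x a)).
Proof.
by move=> xd; apply: prod_perm_sign => a b; apply: p_comm_sign (xd a) (xd b).
Qed.

Lemma p_prod_absorb x d i k z : homogeneous x d -> z \in coh X k ->
  up_to_sign ((\prod_a p a (x a)) * p i z)
             (\prod_a p a (if a == i then x a * z else x a)).
Proof.
move=> xd zk; pose y a := if a == i then x a * z else x a.
have yd : homogeneous y (fun a => if a == i then (d a + k)%N else d a).
  by move=> a; rewrite /y; case: ifP => // _; apply: coh_mul.
have [r rE] : exists r, perm_eq (index_enum 'I_n) (i :: r).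
  by exists (rem i (index_enum 'I_n)); apply: perm_to_rem; rewrite mem_index_enum.
have ir : i \notin r by have := index_enum_uniq 'I_n; rewrite (perm_uniq rE) /= => /andP[].
apply: up_to_sign_trans (up_to_sign_sym (p_prod_perm yd rE)).
apply: up_to_sign_trans (up_to_sign_mul (p_prod_perm xd rE) (up_to_sign_refl _)) _.
rewrite !big_cons {1}/y eqxx kriz_pM -!mulrA; apply: up_to_sign_mul; first by left.
have -> : \prod_(a <- r) p a (y a) = \prod_(a <- r) p a (x a).
  apply: eq_big_seq => a ar; rewrite /y; case: eqP => // ai.
  by rewrite ai (negPf ir) in ar.
by apply: prod_commute_sign => a; apply: p_comm_sign (xd a) zk.
Qed.

(** The coefficients at the vertices of [s] are moved one at a time: that of [j] is replaced by 1,
    slid along the component of [j], and multiplied into the coefficient of the root, which is not a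
    target and so is never emptied. *)
Lemma p_gprod_roots x d e (s : seq 'I_n) : canonical_edges e -> homogeneous x d ->
    {subset s <= targets e} ->
  exists y d', [/\ homogeneous y d', forall j, j \in s -> y j = 1,
    (\sum_a d' a = \sum_a d a)%N
    & up_to_sign ((\prod_a p a (x a)) * gprod e) ((\prod_a p a (y a)) * gprod e)].
Proof.
move=> ce xd; elim: s => [|j s IHs] sub.
  by exists x, d; split=> //; left.
have [|y [d' [yd ys dE xy]]] := IHs.
  by move=> k ks; apply: sub; rewrite inE ks orbT.
have jt : j \in targets e by apply: sub; rewrite mem_head.
pose r := root e j; have [_ rt0 rr] := canonical_root ce j.
have rt : r \notin targets e.
  by have [_ <- _] := canonical_root ce r; rewrite /r rr.
have rj : r != j by apply: contraNneq rt => ->.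
pose y1 a := if a == j then 1 else y a.
pose d1 a := if a == j then 0%N else d' a.
have yd1 : homogeneous y1 d1.
  by move=> a; rewrite /y1 /d1; case: ifP => // _; apply: coh_one.
pose y2 a := if a == r then y1 a * y j else y1 a.
pose d2 a := if a == r then (d1 a + d' j)%N else d1 a.
exists y2, d2; split.
- move=> a; rewrite /y2 /d2; case: ifP => // _; exact: coh_mul.
- move=> k; rewrite /y2 /y1 inE => /orP[/eqP->|ks]; first by rewrite eq_sym (negPf rj) eqxx.
  have -> : (k == r) = false.
    by apply: contraNF rt => /eqP <-; apply: sub; rewrite inE ks orbT.
  by case: ifP => // _; apply: ys.
- rewrite -dE (bigD1 r) //= (bigD1 j) /=; last by rewrite eq_sym.
  rewrite [in RHS](bigD1 r) //= [in RHS](bigD1 j) /=; last by rewrite eq_sym.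
  rewrite /d2 /d1 eqxx (negPf rj) [j == r]eq_sym (negPf rj) eqxx add0n -addnA.
  congr (_ + (_ + _))%N; apply: eq_bigr => a /andP[/negPf-> /negPf->].
  by [].
- apply: up_to_sign_trans xy _.
  have A1 := p_prod_absorb j yd1 (yd j).
  have -> : \prod_a p a (y a) = \prod_a p a (if a == j then y1 a * y j else y1 a).
    apply: eq_bigr => a _; rewrite /y1; case: eqP => [->|//].
    by rewrite mul1r.
  apply: up_to_sign_trans (up_to_sign_mul (up_to_sign_sym A1) (up_to_sign_refl _)) _.
  have jr : connect (graph_adj e) j r by rewrite connect_rootE /r rr.
  rewrite -mulrA (p_gprod_move _ jr) mulrA; apply: up_to_sign_mul; last by left.
  exact: p_prod_absorb yd1 (yd j).
Qed.

Lemma p_prod_expand x (S : 'I_n -> set X) (r : seq 'I_n) : uniq r ->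
    (forall a, lspan (S a) (x a)) ->
  lspan [set u | exists2 z : 'I_n -> X, (forall a, a \in r -> S a (z a))
                 & u = \prod_(a <- r) p a (z a)] (\prod_(a <- r) p a (x a)).
Proof.
move=> + xS; elim: r => [|a r IHr] /=.
  by move=> _; apply: mem_lspan; exists x => //; rewrite big_nil.
case/andP=> ar /IHr {}IHr; rewrite big_cons.
set W := lspan _; have sW : is_subspace W := lspan_subspace _.
apply: (lspan_mull sW _ IHr) => _ [z zS ->].
have sW' : is_subspace [set u : E | W (u * \prod_(a <- r) p a (z a))].
  exact: (subspace_preimage (kriz_mulr _)).
apply: (lspan_linear (f := kriz_p a) sW' _ (xS a)) => v Sv.
apply: mem_lspan; exists (fun b => if b == a then v else z b).
  move=> b; rewrite inE; case: eqP => [->//|_] /= br; exact: zS.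
rewrite big_cons eqxx; congr (_ * _); apply: eq_big_seq => b br.
by case: eqP => // ba; rewrite -ba br in ar.
Qed.

(** Once the targets carry 1, expanding the remaining coefficients in the basis gives canonical
    monomials; homogeneity of the basis keeps the degree of each vertex. *)
Lemma canonical_span x d e : canonical_edges e -> homogeneous x d ->
  lspan [set u | exists h : 'I_n -> hb_index B, [/\ is_canonical h e,
     (\sum_a hb_deg (h a) = \sum_a d a)%N & u = canonical_monomial h e]]
    ((\prod_a p a (x a)) * gprod e).
Proof.
move=> ce xd; set W := lspan _; have sW : is_subspace W := lspan_subspace _.
have [y [d' [yd yt dE xy]]] := p_gprod_roots ce xd (fun _ => id).
apply: (up_to_sign_in sW xy).
pose S a : set X := [set z | exists h : hb_index B,
  [/\ hb_deg h = d' a, a \in targets e -> h = ord0 & z = B h]].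
have yS a : lspan (S a) (y a).
  have [at_|nat_] := boolP (a \in targets e).
    apply: mem_lspan; exists ord0; split=> //; last by rewrite hb_one yt.
    (* A target carries 1, which is homogeneous of degree 0 only. *)
    by rewrite hb_deg0; apply/esym; apply: (@coh_one_deg _ X); rewrite -(yt _ at_); apply: yd.
  rewrite [y a](hb_coordP B); apply: subspace_sum => [|h _]; first exact: lspan_subspace.
  have [hd|hd] := eqVneq (hb_deg h) (d' a); last first.
    by rewrite (hb_coord_deg (yd a) hd) scale0r; apply: subspace0; apply: lspan_subspace.
  apply: subspaceZ; first exact: lspan_subspace.
  by apply: mem_lspan; exists h; split=> // at_; rewrite at_ in nat_.
apply: (lspan_mulr sW _ (p_prod_expand (index_enum_uniq _) yS)) => _ [z zS ->].
have [h hP] : exists h : 'I_n -> hb_index B, forall a,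
    [/\ hb_deg (h a) = d' a, a \in targets e -> h a = ord0 & z a = B (h a)].
  have H a : exists h : hb_index B, [/\ hb_deg h = d' a, a \in targets e -> h = ord0 & z a = B h].
    by apply: zS; rewrite mem_index_enum.
  by have [h hP] := choice H; exists h.
apply: mem_lspan; exists h; split.
- rewrite /is_canonical; case/andP: ce => -> -> /=; apply/allP=> ij ije.
  by have [_ -> //] := hP ij.2; apply: map_f.
- by rewrite -dE; apply: eq_bigr => a _; have [-> _ _] := hP a.
- by congr (_ * _); apply: eq_bigr => a _; have [_ _ ->] := hP a.
Qed.

End PProducts.

(** * Types and monogenicity *)

Section KrizTypes.
Local Open Scope nat_scope.
Variables (m n : nat) (X : cohomology m) (B : homogeneous_basis X).
Implicit Types (e : seq ('I_n * 'I_n)) (i j a v : 'I_n) (h : 'I_n -> hb_index B).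
Implicit Types (T : kriz_type n B).

Definition roots e : seq 'I_n := [seq a <- enum 'I_n | a \notin targets e].

Lemma mem_roots e a : (a \in roots e) = (a \notin targets e).
Proof. by rewrite mem_filter mem_enum andbT. Qed.

Lemma roots_uniq e : uniq (roots e).
Proof. by apply: filter_uniq; apply: enum_uniq. Qed.

Lemma is_canonicalP h e : reflect
  (canonical_edges e /\ forall j, j \in targets e -> h j = ord0) (is_canonical h e).
Proof.
rewrite /is_canonical /canonical_edges andbA.
apply: (iffP andP) => -[-> H]; split=> //.
  by move=> j /mapP[ij ije ->]; apply/eqP/(allP H).
by apply/allP=> ij ije; rewrite H //; apply: map_f.
Qed.

Lemma marked_componentsE h e : canonical_edges e ->
  marked_components h e = [seq (#|connect (graph_adj e) a|, h a) | a <- roots e].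
Proof.
move=> ce; congr map; apply: eq_filter => a; exact: root_min.
Qed.

Lemma sum_roots_card e : canonical_edges e ->
  \sum_(a <- roots e) #|connect (graph_adj e) a| = n.
Proof.
move=> ce; rewrite -[RHS]card_ord -sum1_card big_filter big_enum_cond /=.
rewrite [RHS](partition_big (root e) (fun a => a \notin targets e)) /=.
  apply: eq_bigr => a at_; rewrite -sum1_card; apply: eq_bigl => v.
  have [_ E _] := canonical_root ce a; rewrite at_ in E.
  by rewrite !inE [LHS]connect_rootE (eqP E) eq_sym.
by move=> v _; have [_ _ rr] := canonical_root ce v;
  have [_ <- _] := canonical_root ce (root e v); rewrite rr.
Qed.

Lemma size_roots e : canonical_edges e -> size (roots e) + size e = n.
Proof.
move=> ce; rewrite -(size_map snd e) -size_cat -[RHS](size_enum_ord n).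
apply/perm_size/uniq_perm; rewrite ?enum_uniq //.
  rewrite cat_uniq roots_uniq (canonical_targets_uniq ce) andbT.
  by apply/hasPn=> a at_; rewrite /= mem_roots negbK.
by move=> a; rewrite mem_cat mem_roots mem_enum orNb.
Qed.

Definition has_type T h e :=
  perm_eq (marked_components h e) (zip (type_parts T) (type_marks T)).

Lemma type_sizes T : size (type_marks T) = size (type_parts T).
Proof. by have /andP[/eqP] := valP T. Qed.

Lemma type_unzip1 T : unzip1 (zip (type_parts T) (type_marks T)) = type_parts T.
Proof. by apply: unzip1_zip; rewrite type_sizes. Qed.

Lemma type_unzip2 T : unzip2 (zip (type_parts T) (type_marks T)) = type_marks T.
Proof. by apply: unzip2_zip; rewrite type_sizes. Qed.

Lemma type_rankE T h e : is_canonical h e -> has_type T h e -> type_rank T = size e.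
Proof.
case/is_canonicalP=> ce _ hT; rewrite /type_rank -type_unzip1.
rewrite -(perm_big _ (perm_map fst hT)) marked_componentsE // -map_comp big_map /=.
apply: (@addnI (size (roots e))); rewrite size_roots // -[RHS](sum_roots_card ce).
rewrite -sum1_size -big_split /=; apply: eq_bigr => a _.
by rewrite subnKC //; apply/card_gt0P; exists a; rewrite inE connect0.
Qed.

Lemma type_degE T h e : is_canonical h e -> has_type T h e ->
  type_deg T = \sum_a hb_deg (h a).
Proof.
case/is_canonicalP=> ce ht hT; rewrite /type_deg -type_unzip2.
rewrite -(perm_big _ (perm_map snd hT)) marked_componentsE // -map_comp big_map /=.
rewrite big_filter big_enum_cond [RHS](bigID (fun a => a \notin targets e)) /=.
rewrite [X in _ = _ + X]big1 ?addn0 // => a; rewrite negbK => /ht ->.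
exact: hb_deg0.
Qed.

(** Types list their pairs in decreasing order for this lexicographic order, so a type amounts to a
    multiset of pairs and is recovered from any monomial. *)
Definition type_ge : rel (nat * hb_index B) := fun x y =>
  (y.1 < x.1) || (x.1 == y.1) && (y.2 <= x.2).

Lemma type_ge_trans : transitive type_ge.
Proof. by move=> [l i] [l' i'] [l2 i2]; rewrite /type_ge /=; lia. Qed.

Lemma type_ge_total : total type_ge.
Proof. by move=> [l i] [l' i']; rewrite /type_ge /=; lia. Qed.

Lemma type_ge_anti : antisymmetric type_ge.
Proof.
move=> [l i] [l' i']; rewrite /type_ge /= => H.
by congr pair; [|apply: val_inj => /=]; lia.
Qed.

Lemma sorted_type T : sorted type_ge (zip (type_parts T) (type_marks T)).
Proof.
have szE := type_sizes T.
apply/(sortedP (0, ord0)) => i; rewrite size1_zip ?szE // => lt_i.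
rewrite !nth_zip ?szE // /type_ge /=.
have [srt _ _] := partsP (val T).1.
have := sorted_leq_nth _ _ 0 srt i i.+1; rewrite !inE => le_i.
have {}le_i : nth 0 (type_parts T) i.+1 <= nth 0 (type_parts T) i.
  apply: le_i => //; last exact: ltnW.
  - by move=> x y z /= xy /leq_trans; apply.
  - exact: leqnn.
rewrite leq_eqVlt in le_i; case/orP: le_i => [/eqP E|->//].
have /andP[_ /allP/(_ i)] := valP T.
rewrite mem_iota add0n => H; rewrite E eqxx ltnn /=.
have /H : 0 <= i < (size (parts (val T).1)).-1.
  by move: lt_i; rewrite -/(type_parts T) /=; case: (size _).
by rewrite -/(type_parts T) -/(type_marks T) E eqxx.
Qed.

Lemma type_unique T T' h e : has_type T h e -> has_type T' h e -> T = T'.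
Proof.
rewrite /has_type => hT hT'.
have E : zip (type_parts T) (type_marks T) = zip (type_parts T') (type_marks T').
  apply: (sorted_eq type_ge_trans type_ge_anti); rewrite ?sorted_type //.
  by rewrite -(permPl hT).
have E1 := congr1 unzip1 E; have E2 := congr1 unzip2 E.
rewrite !type_unzip1 in E1; rewrite !type_unzip2 in E2.
apply: val_inj; move: E1 E2; rewrite /type_parts /type_marks.
case: (val T) (val T') => [L H] [L' H'] /= E1 /val_inj ->; congr pair.
exact/val_inj/val_inj/(inj_map val_inj).
Qed.

Lemma exists_type h e : is_canonical h e -> exists T, has_type T h e.
Proof.
case/is_canonicalP=> ce _; pose s := sort type_ge (marked_components h e).
have ps : perm_eq s (marked_components h e) by rewrite perm_sort.
have srt : sorted type_ge s by apply: sort_sorted type_ge_total _.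
have p1 : perm_eq (unzip1 s) [seq #|connect (graph_adj e) a| | a <- roots e].
  have <- : unzip1 (marked_components h e) = [seq #|connect (graph_adj e) a| | a <- roots e].
    by rewrite marked_componentsE // /unzip1 -map_comp.
  exact: perm_map.
have [lam lamE] : exists lam : intpart n, parts lam = unzip1 s.
  apply: exists_intpart; apply/and3P; split.
  - rewrite sorted_map; apply: sub_sorted srt => x y; rewrite /type_ge /=; lia.
  - rewrite (perm_all _ p1) all_map; apply/allP=> a _ /=.
    by apply/card_gt0P; exists a; rewrite inE connect0.
  - by rewrite (perm_sumn p1) sumnE big_map; apply/eqP/sum_roots_card.
have szH : size (unzip2 s) <= n.
  rewrite size_map (perm_size ps) marked_componentsE // size_map.
  by rewrite -{2}(size_roots ce) leq_addr.
have TP : is_kriz_type (parts lam) (Bseq szH).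
  rewrite /is_kriz_type lamE /= !size_map eqxx; apply/allP=> i.
  rewrite mem_iota add0n => /= lt_i.
  have lt_i1 : i.+1 < size s by move: lt_i; case: (size s).
  have lt_i0 := ltnW lt_i1.
  have := (sortedP (0, ord0) srt) i lt_i1; rewrite /type_ge.
  rewrite -!(nth_map _ 0 fst) // -!(nth_map _ ord0 snd) //.
  by case: eqP => [->|]; rewrite ?ltnn.
exists (Sub (lam, Bseq szH) TP); rewrite /has_type /type_parts /type_marks /=.
by rewrite lamE zip_unzip perm_sym.
Qed.

End KrizTypes.

Section SeqFlatten.
Lemma flatten_map_filter (T U : eqType) (P : pred T) (F : T -> seq U) (s : seq T) :
  (forall x, ~~ P x -> F x = [::]) ->
  flatten [seq F x | x <- s & P x] = flatten [seq F x | x <- s].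
Proof.
move=> F0; elim: s => //= x s IHs; case: ifP => Px /=; rewrite IHs //.
by rewrite F0 ?Px.
Qed.
End SeqFlatten.

(** * The subspace of a type is a submodule generated by one path monomial *)

Section Monogenic.
Local Open Scope ring_scope.
Local Open Scope classical_set_scope.
Variables (m n : nat) (X : cohomology m) (B : homogeneous_basis X).
Local Notation E := (kriz n X).
Local Notation p := (@kriz_p m n X).
Local Notation gprod := (@gprod m n X).
Implicit Types (e : seq ('I_n * 'I_n)) (i j a c u v : 'I_n) (h : 'I_n -> hb_index B).
Implicit Types (T : kriz_type n B) (s : 'S_n) (b : 'I_n -> seq 'I_n).

Lemma type_space_subspace T : is_subspace (kriz_type_space T).
Proof. exact: lspan_subspace. Qed.

Lemma p_prod_move (f g : 'I_n -> 'I_n) h e (r : seq 'I_n) :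
    (forall a, connect (graph_adj e) (f a) (g a)) ->
  up_to_sign ((\prod_(a <- r) p (f a) (B (h a))) * gprod e)
             ((\prod_(a <- r) p (g a) (B (h a))) * gprod e).
Proof.
move=> fg; elim: r => [|a r IHr]; first by rewrite !big_nil; left.
rewrite !big_cons -[X in up_to_sign _ X]mulrA.
apply: up_to_sign_trans (up_to_sign_mul (up_to_sign_refl _) IHr).
have comm x : up_to_sign (\prod_(b <- r) p (f b) (B (h b)) * p x (B (h a)))
                         (p x (B (h a)) * \prod_(b <- r) p (f b) (B (h b))).
  by apply: prod_commute_sign => b; apply: p_comm_sign; apply: hb_coh.
apply: up_to_sign_trans (up_to_sign_mul (up_to_sign_sym (comm _)) (up_to_sign_refl _)) _.
rewrite -mulrA (p_gprod_move _ (fg a)) !mulrA.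
exact: up_to_sign_mul (comm _) (up_to_sign_refl _).
Qed.

Lemma p_prod_roots (f : 'I_n -> 'I_n) h e : (forall j, j \in targets e -> h j = ord0) ->
  \prod_a p (f a) (B (h a)) = \prod_(a <- roots e) p (f a) (B (h a)).
Proof.
move=> ht; rewrite /roots [RHS]big_filter [RHS]big_mkcond enumT /=.
rewrite [index_enum _]unlock.
apply: eq_bigr => a _; case: ifP => // /negbFE/ht->.
by rewrite hb_one kriz_p1.
Qed.

(** Only the components of [e1] matter: straightening keeps them, and labels then slide to the
    smallest vertices. As these components are the images under [s] of those of [e], sizes and marks
    are those of [T]. The cases needed are images of monomials under [s] and, with [s] trivial, path
    monomials. *)
Lemma relabelled_type_space T h e s e1 : is_canonical h e -> has_type T h e ->
    (forall u v, connect (graph_adj e1) (s u) (s v) = connect (graph_adj e) u v) ->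
  kriz_type_space T ((\prod_a p (s a) (B (h a))) * gprod e1).
Proof.
move=> /is_canonicalP[ce ht] hT cE; have sW := type_space_subspace T.
apply: (lspan_mull sW _ (gprod_straight X e1)) => _ [e2 [ce2 _ cE2 ->]].
(* The maps [f] and [g] match the roots of [e] with those of [e2]; [h'] is the transported
   labelling, with 1 at the targets. *)
pose f a := root e2 (s a); pose g c := root e (s^-1%g c).
have rr2 c : root e2 (root e2 c) = root e2 c by have [] := canonical_root ce2 c.
have rr c : root e (root e c) = root e c by have [] := canonical_root ce c.
have rootsE a : (a \in roots e) = (root e a == a).
  by rewrite mem_roots; have [_ <- _] := canonical_root ce a.
have roots2E a : (a \in roots e2) = (root e2 a == a).
  by rewrite mem_roots; have [_ <- _] := canonical_root ce2 a.
have fK a : g (f a) = root e a.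
  apply/eqP; rewrite -connect_rootE -cE permKV -cE2 connect_rootE /f rr2.
  exact: eqxx.
have gK c : f (g c) = root e2 c.
  apply/eqP; rewrite /f -connect_rootE cE2 -[X in connect _ _ X](permKV s) cE.
  by rewrite connect_rootE /g rr.
pose h' c := if c \in targets e2 then ord0 else h (g c).
have perm_f : perm_eq (map f (roots e)) (roots e2).
  apply: uniq_perm; rewrite ?roots_uniq //.
    rewrite map_inj_in_uniq ?roots_uniq // => a a'; rewrite !rootsE => /eqP ra /eqP ra'.
    by move/(congr1 g); rewrite !fK ra ra'.
  move=> c; rewrite roots2E; apply/mapP/eqP=> [[a _ ->]|rc]; first exact: rr2.
  by exists (g c); rewrite ?gK // rootsE /g rr.
have h'f a : a \in roots e -> h' (f a) = h a.
  rewrite rootsE /h' => /eqP ra; rewrite fK ra ifN //.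
  by rewrite -mem_roots roots2E rr2.
have h't c : c \in targets e2 -> h' c = ord0 by rewrite /h' => ->.
apply: (up_to_sign_in sW (v := canonical_monomial h' e2)); last first.
  apply: mem_lspan; exists h', e2; split=> //; first exact/is_canonicalP.
  apply: perm_trans hT; rewrite !marked_componentsE //.
  rewrite -(permPl (perm_map _ perm_f)) -map_comp (_ : map _ _ = map (fun a => (#|connect (graph_adj e) a|, h a)) (roots e)) //.
  apply/eq_in_map => a ar /=; rewrite h'f //; congr pair.
  rewrite -[RHS](card_image (@perm_inj _ s)); apply: eq_card => v; rewrite !inE.
  apply/idP/fintype.imageP=> [fv|[u au ->]].
    exists (s^-1%g v); rewrite ?permKV // inE -cE permKV -cE2.
    by move: fv; rewrite !connect_rootE rr2.
  by move: au; rewrite inE -cE -cE2 !connect_rootE rr2.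
rewrite /canonical_monomial (p_prod_roots _ ht) (p_prod_roots id h't).
apply: up_to_sign_trans (p_prod_move (g := f) h _ _) _.
  by move=> a; rewrite connect_rootE /f rr2.
apply: up_to_sign_mul; last by left.
rewrite (eq_big_seq (fun a => p (f a) (B (h' (f a))))) => [|a ar]; last by rewrite h'f.
rewrite -(big_map f predT (fun c => p c (B (h' c)))).
exact: (p_prod_perm (d := fun c => hb_deg (h' c)) (fun c => hb_coh (h' c))).
Qed.

Lemma connect_adj_perm s e u v :
  connect (graph_adj [seq (s ij.1, s ij.2) | ij <- e]) (s u) (s v) =
  connect (graph_adj e) u v.
Proof.
have fwd (t : 'S_n) e' x y : connect (graph_adj e') x y ->
    connect (graph_adj [seq (t ij.1, t ij.2) | ij <- e']) (t x) (t y).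
  have edge w z : (w, z) \in e' -> (t w, t z) \in [seq (t ij.1, t ij.2) | ij <- e'].
    by move=> wz; apply/mapP; exists (w, z).
  case/connectP=> r + ->; elim: r x => [|z r IHr] x /=; first by rewrite connect0.
  case/andP=> xz /IHr; apply: connect_trans; apply: connect1.
  by case/orP: xz => /edge; rewrite /graph_adj => ->; rewrite ?orbT.
apply/idP/idP; last exact: fwd.
move/(fwd s^-1%g); rewrite !permK -map_comp map_id_in // => -[i j] _ /=.
by rewrite !permK.
Qed.

Lemma kriz_act_monomial s h e :
  kriz_act s ((\prod_a p a (B (h a))) * gprod e) =
  (\prod_a p (s a) (B (h a))) * gprod [seq (s ij.1, s ij.2) | ij <- e].
Proof.
rewrite rmorphM !rmorph_prod /gprod big_map; congr (_ * _).
  by apply: eq_bigr => a _; apply: kriz_act_p.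
by apply: eq_bigr => ij _; apply: kriz_act_G.
Qed.

Lemma type_space_submodule T : is_submodule (@kriz_act m n X) (kriz_type_space T).
Proof.
have sW := type_space_subspace T; split=> // s.
apply: (lspan_linear (f := kriz_act s) sW) => _ [h [e [ch hT ->]]].
have -> : canonical_monomial h e = (\prod_a p a (B (h a))) * gprod e by [].
rewrite [X in kriz_type_space T X]kriz_act_monomial.
apply: relabelled_type_space ch hT _ => u v; exact: connect_adj_perm.
Qed.

Definition path_monomial h b : E := (\prod_a p a (B (h a))) * gprod (system_edges b).

Lemma path_monomial_type T h e b : is_canonical h e -> has_type T h e ->
  path_system (root e) b -> kriz_type_space T (path_monomial h b).
Proof.
move=> ch hT bP; have := @relabelled_type_space T h e 1%g (system_edges b) ch hT.
rewrite (eq_bigr (fun a => p a (B (h a)))) => [|a _]; last by rewrite perm1.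
by apply=> u v; rewrite !perm1 (system_connect bP) connect_rootE.
Qed.

Section System.
Variables (e : seq ('I_n * 'I_n)) (b : 'I_n -> seq 'I_n).
Hypotheses (ce : canonical_edges e) (bP : path_system (root e) b).

Lemma system_root a : a \in roots e -> ohead (b a) = Some a.
Proof.
rewrite mem_roots; have [_ mb hb] := bP a; have [_ <- _] := canonical_root ce a.
by rewrite -mb; move: hb; case: (b a) => //= x t ->.
Qed.

Lemma system_size a : a \in roots e -> size (b a) = #|connect (graph_adj e) a|.
Proof.
rewrite mem_roots; have [ub mb _] := bP a; have [_ <- _] := canonical_root ce a.
move=> /eqP ra; rewrite -(card_uniqP ub); apply: eq_card => v.
by rewrite mb [RHS]connect_rootE ra eq_sym.
Qed.

Lemma system_full (r : seq 'I_n) : perm_eq r (roots e) ->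
  uniq (flatten (map b r)) /\ size (flatten (map b r)) = #|'I_n|.
Proof.
move=> rE; have sz : size (flatten (map b r)) = #|'I_n|.
  rewrite size_flatten /shape -map_comp sumnE big_map (perm_big _ rE) /= card_ord.
  rewrite -[RHS](sum_roots_card ce); apply: eq_big_seq => a; exact: system_size.
split=> //; apply: (@leq_size_uniq _ (enum 'I_n)); rewrite ?enum_uniq //; last first.
  by rewrite sz -cardE.
move=> v _; apply/flattenP; exists (b (root e v)); last first.
  by have [_ -> _] := bP (root e v).
apply: map_f; rewrite (perm_mem rE) mem_roots.
by have [_ <- _] := canonical_root ce (root e v); have [_ _ ->] := canonical_root ce v.
Qed.

Lemma system_edges_roots (r : seq 'I_n) : perm_eq r (roots e) ->
  perm_eq (system_edges b) (flatten (map (@path_edges n) (map b r))).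
Proof.
move=> rE; rewrite /system_edges -map_comp.
rewrite -(@flatten_map_filter _ _ (fun a => a \notin targets e)).
  by apply: perm_flatten; apply: perm_map; rewrite perm_sym.
move=> a; rewrite negbK => at_; suff -> : b a = [::] by [].
have [_ mb hb] := bP a; have [_ E _] := canonical_root ce a.
case ba : (b a) mb hb => [//|x t] mb /= xa; have := mb x.
by rewrite mem_head xa E at_.
Qed.

End System.

(** Match the components of the two forests by size and mark, and concatenate their paths in this
    order. Both results enumerate all vertices, so a permutation takes one to the other; as the
    lengths agree, it maps path to path, edges to edges and heads to heads. *)
Lemma path_monomial_transport T h e b h0 e0 b0 :
    is_canonical h e -> has_type T h e -> path_system (root e) b ->
    is_canonical h0 e0 -> has_type T h0 e0 -> path_system (root e0) b0 ->
  exists s, up_to_sign (kriz_act s (path_monomial h0 b0)) (path_monomial h b).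
Proof.
move=> /is_canonicalP[ce ht] hT bP /is_canonicalP[ce0 ht0] hT0 b0P.
have : perm_eq (marked_components h e) (marked_components h0 e0).
  by rewrite (permPl hT) perm_sym.
(* The list [r] orders the roots of [e] so that their sizes and marks agree with those of
   [roots e0], place by place. *)
rewrite !marked_componentsE // => /perm_map_lift[r rE FE].
set r0 := roots e0 in FE.
have r0E : perm_eq r0 (roots e0) by [].
have [uA sA] := system_full ce bP rE; have [uA0 sA0] := system_full ce0 b0P r0E.
have [s sE] := perm_of_seqs uA0 uA sA0 sA; exists s.
have szE : map (size \o b) r = map (size \o b0) r0.
  have := congr1 unzip1 FE; rewrite /unzip1 -!map_comp => F1.
  rewrite (eq_in_map _ (fun a => #|connect (graph_adj e) a|) r).1 => [|a]; last first.
    by rewrite (perm_mem rE) /=; apply: system_size.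
  rewrite [RHS](eq_in_map _ (fun a => #|connect (graph_adj e0) a|) r0).1 => [|a]; last first.
    exact: system_size.
  exact: F1.
have mapE : map (map s) (map b0 r0) = map b r.
  apply: eq_from_flatten_shape; first by rewrite -map_flatten.
  rewrite /shape -!map_comp szE; apply: eq_map => a /=; exact: size_map.
have srE : map s r0 = r.
  apply: (inj_map Some_inj); have := congr1 (map ohead) mapE; rewrite -!map_comp.
  rewrite [RHS](eq_in_map _ Some r).1 => [<-|a]; last first.
    by rewrite (perm_mem rE) /=; apply: system_root.
  apply/eq_in_map => a /(system_root ce0 b0P) /=.
  by case: (b0 a) => //= x t [->].
have hE : map h0 r0 = map h r.
  by have := congr1 unzip2 FE; rewrite /unzip2 -!map_comp => <-.
rewrite /path_monomial kriz_act_monomial; apply: up_to_sign_mul.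
  rewrite (p_prod_roots s ht0) (p_prod_roots id ht).
  have -> : \prod_(a <- roots e0) p (s a) (B (h0 a)) = \prod_(a <- r) p a (B (h a)).
    rewrite -(big_map (fun a => (s a, h0 a)) predT (fun x => p x.1 (B x.2))).
    rewrite -(big_map (fun a => (a, h a)) predT (fun x => p x.1 (B x.2))).
    by congr bigop; rewrite -!zip_map -/r0 srE hE map_id.
  exact: (p_prod_perm (d := fun c => hb_deg (h c)) (fun c => hb_coh (h c))).
apply: gprod_perm; rewrite (permPr (system_edges_roots ce bP rE)).
rewrite -mapE; have := perm_map (fun ij => (s ij.1, s ij.2)) (system_edges_roots ce0 b0P r0E).
move/perm_trans; apply; rewrite map_flatten -!map_comp.
suff -> : map (map (fun ij : 'I_n * 'I_n => (s ij.1, s ij.2)) \o (@path_edges n \o b0)) r0 =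
          map (@path_edges n \o (map s \o b0)) r0 by [].
by apply: eq_map => a /=; rewrite path_edges_map.
Qed.

(** Expanding the forest of a canonical monomial into path systems leaves path monomials of type
    [T], each a translate, up to sign, of a fixed one. *)
Lemma type_space_monogenic T : is_monogenic (@kriz_act m n X) (kriz_type_space T).
Proof.
have subm := type_space_submodule T; have sW := type_space_subspace T.
split=> //; have [|no] := pselect (exists h e, is_canonical h e /\ has_type T h e).
  case=> h0 [e0 [ch0 hT0]].
  have ce0 : canonical_edges e0 by case/is_canonicalP: ch0.
  have [|b0 b0P] := @exists_path_system n (root e0).
    by move=> v; have [] := canonical_root ce0 v.
  exists (path_monomial h0 b0); first exact: path_monomial_type ch0 hT0 b0P.
  apply/seteqP; split; apply: lspan_min => //; try exact: lspan_subspace; last first.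
    by move=> _ [s _ <-]; apply: subm.2; apply: path_monomial_type ch0 hT0 b0P.
  move=> _ [h [e [ch hT ->]]]; have ce : canonical_edges e by case/is_canonicalP: ch.
  set W := lspan _; have sW' : is_subspace W := lspan_subspace _.
  apply: (lspan_mull sW' _ (gprod_path_span X ce)) => _ [b [bP ->]].
  have [s sE] := path_monomial_transport ch hT bP ch0 hT0 b0P.
  by apply: (up_to_sign_in sW' (up_to_sign_sym sE)); apply: mem_lspan; exists s.
exists 0; first exact: subspace0.
apply/seteqP; split; apply: lspan_min => //; try exact: lspan_subspace.
  by move=> _ [h [e [ch hT ->]]]; case: no; exists h, e.
by move=> _ [s _ <-]; rewrite linear0; apply: subspace0.
Qed.

End Monogenic.

(** * Independence of the canonical monomials *)

Section StructureConstants.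
Local Open Scope ring_scope.
Variables (m : nat) (X : cohomology m) (B : homogeneous_basis X).
Implicit Types (z w u b s : hb_index B).

Definition cst z w b : rat := hb_coord b (B z * B w).
(** Koszul signs: [sg] for passing a basis element across a generator of odd degree, [sg2] for
    exchanging two basis elements. *)
Definition sg z : rat := (-1) ^+ hb_deg z.
Definition sg2 z w : rat := (-1) ^+ (hb_deg z * hb_deg w)%N.

Lemma sg_sq z : sg z * sg z = 1.
Proof. by rewrite /sg -exprMn mulrNN mulr1 expr1n. Qed.

Lemma sg2_sq z w : sg2 z w * sg2 z w = 1.
Proof. by rewrite /sg2 -exprMn mulrNN mulr1 expr1n. Qed.

Lemma sg2C z w : sg2 z w = sg2 w z.
Proof. by rewrite /sg2 mulnC. Qed.

Lemma sg20 z : sg2 ord0 z = 1.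
Proof. by rewrite /sg2 hb_deg0. Qed.

Lemma cst_deg z w b : cst z w b = 0 \/ hb_deg b = (hb_deg z + hb_deg w)%N.
Proof.
have [->|ne] := eqVneq (hb_deg b) (hb_deg z + hb_deg w)%N; first by right.
by left; apply: hb_coord_deg ne; apply: coh_mul; apply: hb_coh.
Qed.

Lemma cst_sg z w b : cst z w b * sg b = cst z w b * (sg z * sg w).
Proof. by case: (cst_deg z w b) => [->|E]; rewrite ?mul0r // /sg E exprD. Qed.

Lemma cst_sg2 z w b u : cst z w b * sg2 b u = cst z w b * (sg2 z u * sg2 w u).
Proof.
by case: (cst_deg z w b) => [->|E]; rewrite ?mul0r // /sg2 E mulnDl exprD.
Qed.

Lemma cstE z w : B z * B w = \sum_b cst z w b *: B b.
Proof. exact: hb_coordP. Qed.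

Lemma cst_assoc z u w b :
  \sum_s cst z u s * cst s w b = \sum_s cst u w s * cst z s b.
Proof.
have := congr1 (hb_coord b) (mulrA (B z) (B u) (B w)).
rewrite {1}(cstE u w) (cstE z u) mulr_sumr mulr_suml !linear_sum /= => E.
rewrite [LHS](eq_bigr (fun s => hb_coord b (cst z u s *: B s * B w))) => [|s _].
  rewrite -E; apply: eq_bigr => s _.
  by rewrite -scalerAr linearZ.
by rewrite -scalerAl linearZ.
Qed.

Lemma cstC z w b : cst z w b = sg2 z w * cst w z b.
Proof.
rewrite /cst (coh_comm (hb_coh z) (hb_coh w)) -signr_odd mulr_sign -/(sg2 z w).
by rewrite /sg2 -signr_odd; case: odd; rewrite ?linearN ?expr1 ?expr0 ?mulN1r ?mul1r.
Qed.

Lemma cst0l w b : cst ord0 w b = (b == w)%:R.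
Proof. by rewrite /cst hb_one mul1r hb_coordE. Qed.

Lemma cst0r w b : cst w ord0 b = (b == w)%:R.
Proof. by rewrite /cst hb_one mulr1 hb_coordE. Qed.

End StructureConstants.

(** * Adding one point to a representation of the model *)

Section KrizOps.
Local Open Scope ring_scope.
Variables (m : nat) (X : cohomology m) (B : homogeneous_basis X).
Local Notation hb := (hb_index B).

(* [Q i z] and [G i j] stand for the right multiplications by p_i^*(B z) and *)
(* by G_ij on the Kriz model with t points. *)
Record kriz_ops (t : nat) (V : lmodType rat) (Q : nat -> hb -> V -> V)
    (G : nat -> nat -> V -> V) : Prop := KrizOps {
  opQ_linear : forall i z, linear (Q i z);
  opG_linear : forall i j, linear (G i j);
  opQ_one : forall i v, (i < t)%N -> Q i ord0 v = v;
  opQ_mul : forall i z w v, (i < t)%N ->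
    Q i w (Q i z v) = \sum_b cst z w b *: Q i b v;
  opQ_comm : forall i j z w v, (i < t)%N -> (j < t)%N ->
    Q j w (Q i z v) = sg2 z w *: Q i z (Q j w v);
  opGQ : forall i j k z v, (i < t)%N -> (j < t)%N -> (k < t)%N ->
    G i j (Q k z v) = sg z *: Q k z (G i j v);
  opG_anti : forall i j k l v, (i < t)%N -> (j < t)%N -> (k < t)%N -> (l < t)%N ->
    G k l (G i j v) = - G i j (G k l v);
  opG_diag : forall i v, (i < t)%N -> G i i v = 0;
  opG_sym : forall i j v, (i < t)%N -> (j < t)%N -> G j i v = G i j v;
  opQG : forall i j z v, (i < t)%N -> (j < t)%N -> G i j (Q j z v) = G i j (Q i z v);
  opG_cyc : forall i j k v, (i < t)%N -> (j < t)%N -> (k < t)%N ->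
    G j k (G i j v) + G k i (G j k v) + G i j (G k i v) = 0
}.

Section Extension.
Variables (t : nat) (V : lmodType rat) (Q : nat -> hb -> V -> V).
Variables (G : nat -> nat -> V -> V).
Hypothesis ops : kriz_ops t Q G.
Implicit Types (z w b s : hb).

HB.instance Definition _ i z :=
  GRing.isLinear.Build rat V V *:%R (Q i z) (opQ_linear ops i z).
HB.instance Definition _ i j :=
  GRing.isLinear.Build rat V V *:%R (G i j) (opG_linear ops i j).

(* [v] stands for the sum of the v(b) p_t^*(b) and of the v(k) G_kt. *)
Local Notation V' := ({ffun hb + 'I_t -> V}).
Implicit Types v : V'.

(** On the terms [v(b) p_t^*(b)], multiplication at the point [t] multiplies labels, while at an
    earlier point it acts on [v(b)] after passing the label. On the terms [v(k) G_kt], an element at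
    the point [t] is first moved to [k]. *)
Definition extQ (i : nat) z v : V' := [ffun y : hb + 'I_t => match y return V with
  | inl b => if i == t then \sum_a cst a z b *: v (inl a)
             else sg2 b z *: Q i z (v (inl b))
  | inr k => sg z *: Q (if i == t then k : nat else i) z (v (inr k))
  end].

(** This is the coefficient contributed to [G_it] by right multiplication by [G_it]: the label at
    [t] moves to [i], and [G_lt G_it = G_li G_it - G_li G_lt] contributes its first term. The second
    term is subtracted in [attach]. *)
Definition attach_sum (i : nat) v : V :=
  \sum_b Q i b (v (inl b)) + \sum_(l < t) G l i (v (inr l)).

Definition attach (i : nat) v : V' := [ffun y : hb + 'I_t => match y return V with
  | inl b => 0
  | inr k => (if k == i :> nat then attach_sum i v else 0) - G k i (v (inr k))
  end].

Definition diagG (i j : nat) v : V' := [ffun y : hb + 'I_t => match y return V with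
  | inl b => sg b *: G i j (v (inl b))
  | inr k => - G i j (v (inr k))
  end].

Definition extG (i j : nat) v : V' :=
  if i == t then (if j == t then 0 else attach j v)
  else if j == t then attach i v else diagG i j v.

Fact extQ_linear i z : linear (extQ i z).
Proof.
move=> c v v'; apply/ffunP=> -[b|k]; rewrite !ffunE; last first.
  by rewrite linearP scalerDr !scalerA mulrC.
case: eqP => _; last by rewrite linearP scalerDr !scalerA mulrC.
rewrite scaler_sumr -big_split; apply: eq_bigr => a _ /=.
by rewrite !ffunE scalerDr !scalerA mulrC.
Qed.

Fact attach_sum_linear i : linear (attach_sum i).
Proof.
move=> c v v'; rewrite /attach_sum scalerDr addrACA !scaler_sumr -!big_split /=.
by congr (_ + _); apply: eq_bigr => b _; rewrite !ffunE linearP.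
Qed.
HB.instance Definition _ i :=
  GRing.isLinear.Build rat V' V *:%R (attach_sum i) (attach_sum_linear i).

Fact attach_linear i : linear (attach i).
Proof.
move=> c v v'; apply/ffunP=> -[b|k]; rewrite !ffunE ?scaler0 ?addr0 //.
rewrite linearP [G _ _ _]linearP scalerBr opprD.
case: eqP => _; first by rewrite addrACA.
by rewrite scaler0 !sub0r add0r.
Qed.

Fact diagG_linear i j : linear (diagG i j).
Proof.
move=> c v v'; apply/ffunP=> -[b|k]; rewrite !ffunE.
  by rewrite linearP scalerDr !scalerA mulrC.
by rewrite linearP opprD scalerN.
Qed.

Fact extG_linear i j : linear (extG i j).
Proof.
rewrite /extG; case: eqP => _; case: eqP => _; try exact: attach_linear.
  by move=> c v v'; rewrite scaler0 addr0.
exact: diagG_linear.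
Qed.

Let GQ i j k z (x : V) : (i < t)%N -> (j < t)%N -> (k < t)%N ->
  Q k z (G i j x) = sg z *: G i j (Q k z x).
Proof. by move=> i_t j_t k_t; rewrite (opGQ ops) // scalerA sg_sq scale1r. Qed.

Lemma attach_sumQ i k z v : (i < t)%N -> (k < t)%N ->
  attach_sum i (extQ k z v) = Q k z (attach_sum i v).
Proof.
move=> i_t k_t; have kt : (k == t) = false by rewrite ltn_eqF.
rewrite /attach_sum linearD !linear_sum; congr (_ + _); apply: eq_bigr => b _.
  by rewrite ffunE kt linearZ [RHS](opQ_comm ops).
by rewrite ffunE kt linearZ [RHS]GQ.
Qed.

Lemma attach_sumQt i z v : (i < t)%N ->
  attach_sum i (extQ t z v) = Q i z (attach_sum i v).
Proof.
move=> i_t; rewrite /attach_sum linearD !linear_sum; congr (_ + _).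
  under [LHS]eq_bigr => b _ do rewrite ffunE eqxx linear_sum.
  rewrite exchange_big; apply: eq_bigr => a _ /=; rewrite (opQ_mul ops) //.
  by apply: eq_bigr => b _; rewrite linearZ.
apply: eq_bigr => l _; rewrite ffunE eqxx linearZ /=; set x := v _.
have -> : G l i (Q l z x) = G l i (Q i z x).
  by rewrite (opG_sym ops) // (opQG ops) // (opG_sym ops).
by rewrite [RHS]GQ.
Qed.

Lemma attach_sumG i j k v : (i < t)%N -> (j < t)%N -> (k < t)%N ->
  attach_sum k (diagG i j v) = G i j (attach_sum k v).
Proof.
move=> i_t j_t k_t; rewrite /attach_sum linearD !linear_sum; congr (_ + _).
  by apply: eq_bigr => b _; rewrite ffunE linearZ /= (opGQ ops).
apply: eq_bigr => l _; rewrite ffunE linearN /= -[LHS]opprK.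
by rewrite (opG_anti ops) // !opprK.
Qed.

(** In the label terms, [opQG] exchanges the points [i] and [j] under [G i j]; in the edge terms,
    the identity is the cyclic Arnold relation for [i], [j] and [l]. *)
Lemma attach_sum_attach i j v : (i < t)%N -> (j < t)%N ->
  attach_sum i (attach j v) = G i j (attach_sum i v).
Proof.
move=> i_t j_t; rewrite {1}/attach_sum big1 ?add0r => [|b _]; last first.
  by rewrite ffunE linear0.
have -> : \sum_(l < t) G l i (attach j v (inr l)) =
    G j i (attach_sum j v) - \sum_(l < t) G l i (G l j (v (inr l))).
  under [LHS]eq_bigr => l _ do rewrite ffunE linearB.
  rewrite sumrB; congr (_ - _); rewrite (bigD1 (Ordinal j_t)) //= eqxx big1 ?addr0 //.
  by move=> l; rewrite -val_eqE /= => /negPf->; rewrite linear0.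
rewrite (opG_sym ops) // /attach_sum !linearD -[LHS]addrA !linear_sum; congr (_ + _).
  by apply: eq_bigr => b _ /=; rewrite (opQG ops).
rewrite -big_split; apply: eq_bigr => l _ /=; set x := v (inr l).
have := opG_cyc ops x i_t j_t (ltn_ord l).
rewrite [G j l (G i j x)](opG_sym ops) // [G l j (G i j x)](opG_anti ops) //.
rewrite [G j l x](opG_sym ops) // => /eqP; rewrite addr_eq0 => /eqP E.
by rewrite -[RHS]opprK -E opprD opprK.
Qed.

Let att_l b i v : attach i v (inl b) = 0.
Proof. by rewrite ffunE. Qed.

Let att_r k i v : attach i v (inr k) =
  (if k == i :> nat then attach_sum i v else 0) - G k i (v (inr k)).
Proof. by rewrite ffunE. Qed.

Let cmp i : (i < t.+1)%N -> i = t \/ (i < t)%N.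
Proof. by rewrite ltnS leq_eqVlt => /orP[/eqP->|i_t]; [left | right]. Qed.

Let extQ_l i z v b : (i < t)%N -> extQ i z v (inl b) = sg2 b z *: Q i z (v (inl b)).
Proof. by move=> i_t; rewrite ffunE ltn_eqF. Qed.

Let extQ_r i z v k : (i < t)%N -> extQ i z v (inr k) = sg z *: Q i z (v (inr k)).
Proof. by move=> i_t; rewrite ffunE ltn_eqF. Qed.

Let extQt_l z v b : extQ t z v (inl b) = \sum_a cst a z b *: v (inl a).
Proof. by rewrite ffunE eqxx. Qed.

Let extQt_r z v k : extQ t z v (inr k) = sg z *: Q k z (v (inr k)).
Proof. by rewrite ffunE eqxx. Qed.

Let diagG_l i j v b : diagG i j v (inl b) = sg b *: G i j (v (inl b)).
Proof. by rewrite ffunE. Qed.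

Let diagG_r i j v k : diagG i j v (inr k) = - G i j (v (inr k)).
Proof. by rewrite ffunE. Qed.

Let extG_tt v : extG t t v = 0.
Proof. by rewrite /extG eqxx. Qed.

Let extG_tl i v : (i < t)%N -> extG t i v = attach i v.
Proof. by move=> i_t; rewrite /extG eqxx ltn_eqF. Qed.

Let extG_tr i v : (i < t)%N -> extG i t v = attach i v.
Proof. by move=> i_t; rewrite /extG eqxx ltn_eqF. Qed.

Let extG_lt i j v : (i < t)%N -> (j < t)%N -> extG i j v = diagG i j v.
Proof. by move=> i_t j_t; rewrite /extG !ltn_eqF. Qed.

Let scaleV (c : rat) v y : (c *: v) y = c *: v y.
Proof. by rewrite ffunE. Qed.

Let oppV v y : (- v) y = - v y.
Proof. by rewrite ffunE. Qed.

Let addV v v' y : (v + v') y = v y + v' y.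
Proof. by rewrite ffunE. Qed.

Let attG_comm i j k v : (i < t)%N -> (j < t)%N -> (k < t)%N ->
  attach k (diagG i j v) = - diagG i j (attach k v).
Proof.
move=> i_t j_t k_t; apply/ffunP=> -[b|r]; rewrite oppV.
  by rewrite att_l diagG_l att_l linear0 scaler0 oppr0.
rewrite att_r diagG_r linearN opprK attach_sumG // diagG_r att_r linearB opprK /=.
by rewrite (opG_anti ops (v (inr r)) i_t) //; case: eqP => _; rewrite ?linear0.
Qed.

Let att_att i j v : (i < t)%N -> (j < t)%N -> forall r : 'I_t,
  attach i (attach j v) (inr r) =
  (if r == i :> nat then G i j (attach_sum i v) else 0)
  - (if r == j :> nat then G r i (attach_sum j v) else 0) + G r i (G r j (v (inr r))).
Proof.
move=> i_t j_t r; rewrite att_r attach_sum_attach // att_r linearB opprB addrA addrAC.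
by case: (r == j :> nat); rewrite ?linear0.
Qed.

Let QZ i z (c : rat) (x : V) : Q i z (c *: x) = c *: Q i z x.
Proof. exact: linearZ_LR. Qed.

Let GZ i j (c : rat) (x : V) : G i j (c *: x) = c *: G i j x.
Proof. exact: linearZ_LR. Qed.

Let QB i z (x y : V) : Q i z (x - y) = Q i z x - Q i z y.
Proof. exact: linearB. Qed.

Let QN i z (x : V) : Q i z (- x) = - Q i z x.
Proof. exact: linearN. Qed.

Let GN i j (x : V) : G i j (- x) = - G i j x.
Proof. exact: linearN. Qed.

Let GB i j (x y : V) : G i j (x - y) = G i j x - G i j y.
Proof. exact: linearB. Qed.

Let ext_one i v : (i < t.+1)%N -> extQ i ord0 v = v.
Proof.
move=> /cmp[->|i_t]; apply/ffunP=> -[b|k].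
- rewrite extQt_l (bigD1 b) //= cst0r eqxx scale1r big1 ?addr0 // => a ab.
  by rewrite cst0r eq_sym (negPf ab) scale0r.
- by rewrite extQt_r /sg hb_deg0 scale1r (opQ_one ops).
- by rewrite extQ_l // sg2C sg20 scale1r (opQ_one ops).
- by rewrite extQ_r // /sg hb_deg0 scale1r (opQ_one ops).
Qed.

Let ext_mul i z w v : (i < t.+1)%N ->
  extQ i w (extQ i z v) = \sum_b cst z w b *: extQ i b v.
Proof.
have signs (F : hb -> V) : (sg w * sg z) *: (\sum_b cst z w b *: F b) =
    \sum_b cst z w b *: (sg b *: F b).
  rewrite scaler_sumr; apply: eq_bigr => b _.
  by rewrite !scalerA cst_sg; congr (_ *: _); ring.
move=> /cmp[->|i_t]; apply/ffunP=> -[b|k]; rewrite sum_ffunE.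
- under [RHS]eq_bigr => s _ do rewrite scaleV extQt_l scaler_sumr.
  rewrite extQt_l; under [LHS]eq_bigr => s _ do rewrite extQt_l scaler_sumr.
  rewrite exchange_big [RHS]exchange_big; apply: eq_bigr => a _ /=.
  under [LHS]eq_bigr => s _ do rewrite scalerA mulrC.
  under [RHS]eq_bigr => s _ do rewrite scalerA.
  by rewrite -!scaler_suml cst_assoc.
- under [RHS]eq_bigr => s _ do rewrite scaleV extQt_r.
  by rewrite !extQt_r QZ scalerA (opQ_mul ops) // signs.
- under [RHS]eq_bigr => s _ do rewrite scaleV extQ_l //.
  rewrite !extQ_l // QZ scalerA (opQ_mul ops) // scaler_sumr.
  apply: eq_bigr => s _; rewrite !scalerA; congr (_ *: _).
  by rewrite [sg2 b s]sg2C cst_sg2 ![sg2 _ b]sg2C; ring.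
- under [RHS]eq_bigr => s _ do rewrite scaleV extQ_r //.
  by rewrite !extQ_r // QZ scalerA (opQ_mul ops) // signs.
Qed.

Let ext_comm i j z w v : (i < t.+1)%N -> (j < t.+1)%N ->
  extQ j w (extQ i z v) = sg2 z w *: extQ i z (extQ j w v).
Proof.
move=> /cmp[->|i_t] /cmp[->|j_t]; apply/ffunP=> -[b|k]; rewrite scaleV.
- rewrite !extQt_l scaler_sumr.
  under [LHS]eq_bigr => s _ do rewrite extQt_l scaler_sumr.
  under [RHS]eq_bigr => s _ do rewrite extQt_l !scaler_sumr.
  rewrite exchange_big [RHS]exchange_big; apply: eq_bigr => a _ /=.
  under [LHS]eq_bigr => s _ do rewrite scalerA mulrC.
  under [RHS]eq_bigr => s _ do rewrite !scalerA -mulrA [cst s z b * _]mulrC.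
  rewrite -!scaler_suml -mulr_sumr !cst_assoc mulr_sumr.
  congr (_ *: _); apply: eq_bigr => s _.
  by rewrite (cstC z w) mulrA.
- rewrite !extQt_r !QZ !scalerA (opQ_comm ops) // scalerA; congr (_ *: _); ring.
- rewrite (extQ_l _ _ _ j_t) !extQt_l linear_sum !scaler_sumr; apply: eq_bigr => a _.
  rewrite /= QZ (extQ_l _ _ _ j_t) !scalerA; congr (_ *: _).
  by rewrite mulrC cst_sg2; ring.
- rewrite !(extQ_r _ _ _ j_t) !extQt_r (extQ_r _ _ _ j_t) !QZ !scalerA (opQ_comm ops) //.
  rewrite scalerA; congr (_ *: _); ring.
- rewrite extQt_l (extQ_l _ _ _ i_t) extQt_l linear_sum !scaler_sumr; apply: eq_bigr => a _ /=.
  rewrite (extQ_l _ _ _ i_t) QZ !scalerA; congr (_ *: _).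
  rewrite -mulrA [sg2 b z * _]mulrC cst_sg2 [sg2 w z]sg2C.
  by rewrite -[LHS]mulr1 -(sg2_sq z w); ring.
- rewrite extQt_r !(extQ_r _ _ _ i_t) extQt_r !QZ !scalerA (opQ_comm ops) //.
  rewrite scalerA; congr (_ *: _); ring.
- rewrite !extQ_l // !QZ !scalerA (opQ_comm ops) // scalerA; congr (_ *: _); ring.
- rewrite !extQ_r // !QZ !scalerA (opQ_comm ops) // scalerA; congr (_ *: _); ring.
Qed.

Let ext_GQ i j k z v : (i < t.+1)%N -> (j < t.+1)%N -> (k < t.+1)%N ->
  extG i j (extQ k z v) = sg z *: extQ k z (extG i j v).
Proof.
have att l : (l < t)%N -> (k < t.+1)%N ->
    attach l (extQ k z v) = sg z *: extQ k z (attach l v).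
  move=> l_t /cmp[->|k_t]; apply/ffunP=> -[b|r]; rewrite scaleV.
  - rewrite att_l extQt_l big1 ?scaler0 // => a _; by rewrite att_l scaler0.
  - rewrite att_r attach_sumQt // !extQt_r scalerA sg_sq scale1r att_r QB GZ.
    rewrite (opGQ ops) // scalerA sg_sq scale1r.
    by case: eqP => [->|_]; rewrite ?linear0.
  - by rewrite att_l extQ_l // att_l linear0 !scaler0.
  - rewrite att_r attach_sumQ // !extQ_r // scalerA sg_sq scale1r att_r QB GZ.
    rewrite (opGQ ops) // scalerA sg_sq scale1r.
    by case: eqP => [->|_]; rewrite ?linear0.
move=> /cmp[->|i_t] /cmp[->|j_t] k_t.
- have [-> ->] : extG t t v = 0 /\ extG t t (extQ k z v) = 0 by rewrite !extG_tt.
  have := extQ_linear k z (-1) 0 0.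
  by rewrite scaler0 addr0 scaleN1r addNr => ->; rewrite scaler0.
- by rewrite !extG_tl // att.
- by rewrite !extG_tr // att.
rewrite !extG_lt //; case/cmp: k_t => [->|k_t]; apply/ffunP=> -[b|r]; rewrite scaleV.
- rewrite diagG_l !extQt_l linear_sum !scaler_sumr; apply: eq_bigr => a _ /=.
  rewrite GZ diagG_l !scalerA; congr (_ *: _).
  by rewrite mulrC cst_sg; ring.
- by rewrite diagG_r !extQt_r diagG_r GZ (opGQ ops) // QN !scalerN.
- rewrite diagG_l !extQ_l // diagG_l GZ QZ (opGQ ops) // !scalerA; congr (_ *: _); ring.
- by rewrite diagG_r !extQ_r // diagG_r GZ (opGQ ops) // QN !scalerN.
Qed.

Let diag_diag i j k l v : (i < t)%N -> (j < t)%N -> (k < t)%N -> (l < t)%N ->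
  diagG k l (diagG i j v) = - diagG i j (diagG k l v).
Proof.
move=> i_t j_t k_t l_t; apply/ffunP=> -[b|r]; rewrite oppV.
  by rewrite !diagG_l !GZ !scalerA (opG_anti ops) // scalerN.
by rewrite !diagG_r !GN !opprK (opG_anti ops).
Qed.

Let attach_anti i k v : (i < t)%N -> (k < t)%N ->
  attach k (attach i v) = - attach i (attach k v).
Proof.
move=> i_t k_t; apply/ffunP=> -[b|r]; rewrite oppV; first by rewrite !att_l oppr0.
have EA : (if r == k :> nat then G k i (attach_sum k v) else 0) =
          (if r == k :> nat then G r i (attach_sum k v) else 0) by case: eqP => [->|].
have EB : (if r == i :> nat then G i k (attach_sum i v) else 0) =
          (if r == i :> nat then G r k (attach_sum i v) else 0) by case: eqP => [->|].
by rewrite !att_att // (opG_anti ops) // EA -EB opprD opprB.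
Qed.

Let ext_anti i j k l v : (i < t.+1)%N -> (j < t.+1)%N -> (k < t.+1)%N -> (l < t.+1)%N ->
  extG k l (extG i j v) = - extG i j (extG k l v).
Proof.
have ext0 (a b : nat) : extG a b 0 = 0.
  have := extG_linear a b (-1) 0 0.
  by rewrite scaler0 addr0 scaleN1r addNr => ->.
(* Each extended operator is zero, attaches the new point, or acts on the coefficients;
   anticommutation is then checked for pairs of these. *)
have class (a b : nat) : (a < t.+1)%N -> (b < t.+1)%N ->
    [\/ forall w : V', extG a b w = 0,
        exists2 c, (c < t)%N & forall w : V', extG a b w = attach c w
      | [/\ (a < t)%N, (b < t)%N & forall w : V', extG a b w = diagG a b w]].
  move=> /cmp[->|a_t] /cmp[->|b_t].
  - by constructor 1 => w; apply: extG_tt.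
  - by constructor 2; exists b => // w; apply: extG_tl.
  - by constructor 2; exists a => // w; apply: extG_tr.
  - by constructor 3; split=> // w; apply: extG_lt.
move=> i_t j_t k_t l_t.
case: (class i j i_t j_t) => [E|[c c_t E]|[{}i_t {}j_t E]];
  case: (class k l k_t l_t) => [F|[d d_t F]|[{}k_t {}l_t F]].
- by rewrite !E ext0 oppr0.
- by rewrite !E ext0 oppr0.
- by rewrite !E ext0 oppr0.
- by rewrite !F ext0 oppr0.
- by rewrite !E !F attach_anti.
- by rewrite !E !F attG_comm // opprK.
- by rewrite !F ext0 oppr0.
- by rewrite !E !F attG_comm.
- by rewrite !E !F diag_diag.
Qed.

Let ext_sym i j v : (i < t.+1)%N -> (j < t.+1)%N -> extG j i v = extG i j v.
Proof.
move=> /cmp[->|i_t] /cmp[->|j_t] //; rewrite ?extG_tl ?extG_tr // !extG_lt //.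
by apply/ffunP=> -[b|r]; rewrite ?diagG_l ?diagG_r (opG_sym ops).
Qed.

Let ext_QG i j z v : (i < t.+1)%N -> (j < t.+1)%N ->
  extG i j (extQ j z v) = extG i j (extQ i z v).
Proof.
have att l : (l < t)%N -> attach l (extQ l z v) = attach l (extQ t z v).
  move=> l_t; apply/ffunP=> -[b|r]; rewrite ?att_l // !att_r attach_sumQ //.
  rewrite attach_sumQt // extQ_r // extQt_r !GZ.
  by rewrite (opQG ops).
move=> /cmp[->|i_t] /cmp[->|j_t] //.
- by rewrite !extG_tl // att.
- by rewrite !extG_tr // att.
rewrite !extG_lt //; apply/ffunP=> -[b|r]; rewrite ?diagG_l ?diagG_r.
  by rewrite !extQ_l // !GZ (opQG ops).
by rewrite !extQ_r // !GZ (opQG ops).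
Qed.

Let ext_diag i v : (i < t.+1)%N -> extG i i v = 0.
Proof.
move=> /cmp[->|i_t]; first by rewrite extG_tt.
rewrite extG_lt //; apply/ffunP=> -[b|r]; rewrite [RHS]ffunE.
  by rewrite diagG_l (opG_diag ops) // scaler0.
by rewrite diagG_r (opG_diag ops) // oppr0.
Qed.

(** This is the Arnold relation for two old points and the new one; in the edge components it
    reduces to the cyclic relation for [i], [j] and [r], the remaining terms cancelling in pairs. *)
Let cyc_t i j v : (i < t)%N -> (j < t)%N ->
  attach j (diagG i j v) + attach i (attach j v) + diagG i j (attach i v) = 0.
Proof.
move=> i_t j_t; apply/ffunP=> -[b|r]; rewrite !addV [RHS]ffunE.
  by rewrite !att_l diagG_l att_l linear0 scaler0 !addr0.
rewrite att_r attach_sumG // diagG_r GN opprK att_att // diagG_r att_r GB opprB.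
have := opG_cyc ops (v (inr r)) i_t j_t (ltn_ord r).
rewrite [G j r _](opG_sym ops) // [G j r (v _)](opG_sym ops) // => cyc.
have EA : (if r == j :> nat then G r i (attach_sum j v) else 0) =
          (if r == j :> nat then G i j (attach_sum j v) else 0).
  by case: eqP => [->|//]; rewrite (opG_sym ops).
have EB : G i j (if r == i :> nat then attach_sum i v else 0) =
          (if r == i :> nat then G i j (attach_sum i v) else 0).
  by case: eqP; rewrite ?linear0.
rewrite EA EB; set A := (if r == j :> nat then _ else _).
set C := (if r == i :> nat then _ else _).
rewrite [X in X + (_ - C)]addrACA [A + _]addrC subrK addrACA [LHS]addrC addrA subrK.
exact: cyc.
Qed.

Let ext_cyc i j k v : (i < t.+1)%N -> (j < t.+1)%N -> (k < t.+1)%N ->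
  extG j k (extG i j v) + extG k i (extG j k v) + extG i j (extG k i v) = 0.
Proof.
have ext0 (a b : nat) : extG a b 0 = 0.
  have := extG_linear a b (-1) 0 0.
  by rewrite scaler0 addr0 scaleN1r addNr => ->.
have sq (a b : nat) (w : V') : (a < t.+1)%N -> (b < t.+1)%N -> extG a b (extG a b w) = 0.
  move=> a_t b_t; have /eqP := ext_anti w a_t b_t a_t b_t.
  rewrite -addr_eq0 -mulr2n -scaler_nat scaler_eq0 => /orP[//|/eqP].
  by [].
(* The relation is invariant under cyclic rotation of the indices, so new points can be put last. *)
have rot (a b c : nat) (w : V') :
    extG b c (extG a b w) + extG c a (extG b c w) + extG a b (extG c a w) = 0 ->
    extG c a (extG b c w) + extG a b (extG c a w) + extG b c (extG a b w) = 0.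
  by move=> <-; rewrite -[RHS]addrA [RHS]addrC.
have two (a : nat) (w : V') : (a < t.+1)%N ->
    extG t t (extG a t w) + extG t a (extG t t w) + extG a t (extG t a w) = 0.
  move=> a_t; rewrite !extG_tt ext0 !add0r ext_sym // sq //.
have main (a b : nat) (w : V') : (a < t)%N -> (b < t)%N ->
    extG b t (extG a b w) + extG t a (extG b t w) + extG a b (extG t a w) = 0.
  move=> a_t b_t; rewrite !(extG_lt _ a_t b_t) !(extG_tr _ b_t) !(extG_tl _ a_t).
  exact: cyc_t.
move=> i_t j_t k_t; case/cmp: (k_t) => [->|k_t'].
  case/cmp: (i_t) => [->|i_t'].
    by apply: (rot t t j); apply: (rot j t t); apply: two.
  case/cmp: (j_t) => [->|j_t']; first exact: two.
  exact: main.
case/cmp: (j_t) => [->|j_t'].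
  case/cmp: (i_t) => [->|i_t']; first by apply: (rot k t t); apply: two.
  by apply: (rot k i t); apply: main.
case/cmp: (i_t) => [->|i_t']; first by apply: (rot k t j); apply: (rot j k t); apply: main.
rewrite !extG_lt //; apply/ffunP=> -[b|r]; rewrite !addV [RHS]ffunE.
  by rewrite !diagG_l !GZ !scalerA sg_sq !scale1r (opG_cyc ops).
by rewrite !diagG_r !GN !opprK (opG_cyc ops).
Qed.

Lemma ext_ops : kriz_ops t.+1 extQ extG.
Proof.
split.
- exact: extQ_linear.
- exact: extG_linear.
- exact: ext_one.
- exact: ext_mul.
- exact: ext_comm.
- exact: ext_GQ.
- exact: ext_anti.
- exact: ext_diag.
- exact: ext_sym.
- exact: ext_QG.
- exact: ext_cyc.
Qed.

End Extension.
End KrizOps.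

(** * Basis vectors of the representation, indexed by codes *)

Section CodeBasis.
Local Open Scope ring_scope.
Variables (m : nat) (X : cohomology m) (B : homogeneous_basis X).
Local Notation hb := (hb_index B).
Implicit Types (c : nat -> hb + nat) (y : hb + nat).

Definition update c a y : nat -> hb + nat := fun j => if j == a then y else c j.

(* [c j] is [inl b] if the vertex j carries the label b, and [inr i] if the *)
(* edge from i < j ends at j. *)
Record code_basis (t : nat) (V : lmodType rat) (Q : nat -> hb -> V -> V)
    (G : nat -> nat -> V -> V) (delta : (nat -> hb + nat) -> V)
    (ev : (nat -> hb + nat) -> V -> rat) : Prop := CodeBasis {
  ev_linear : forall c, linear_for *%R (ev c);
  delta_ext : forall c c', (forall j, (j < t)%N -> c j = c' j) -> delta c = delta c';
  deltaQ : forall c a z, (a < t)%N ->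
    (forall j, (a <= j < t)%N -> c j = inl ord0) ->
    Q a z (delta c) = delta (update c a (inl z));
  deltaG : forall c i j, (i < j < t)%N -> c j = inl ord0 ->
    (forall l, (j < l < t)%N -> exists b, c l = inl b) ->
    exists2 eps : rat, eps * eps = 1 & G i j (delta c) = eps *: delta (update c j (inr i));
  ev_diag : forall c, (forall j k, (j < t)%N -> c j = inr k -> (k < j)%N) ->
    ev c (delta c) = 1;
  ev_off : forall c c', ev c (delta c') != 0 -> forall j, (j < t)%N -> c j = c' j
}.

Definition emb t (y : hb + 'I_t) : hb + nat :=
  match y with inl b => inl b | inr k => inr (val k) end.

(** The basis vector of a code is the previous one placed in the component named by the code of the
    last point, and the dual coordinate reads that component. *)
Lemma ext_code_basis t (V : lmodType rat) (Q : nat -> hb -> V -> V) G delta ev :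
    kriz_ops t Q G -> code_basis t Q G delta ev ->
  exists delta' ev', code_basis t.+1 (extQ (t := t) Q) (extG (t := t) Q G) delta' ev'.
Proof.
move=> ops cb.
have Q0 i z : Q i z 0 = 0.
  have := opQ_linear ops i z (-1) 0 0.
  by rewrite scaler0 addr0 scaleN1r addNr.
have G0 i j : G i j 0 = 0.
  have := opG_linear ops i j (-1) 0 0.
  by rewrite scaler0 addr0 scaleN1r addNr.
pose delta' c : {ffun hb + 'I_t -> V} :=
  [ffun y => if c t == emb y then delta c else 0].
pose ev' c (v : {ffun hb + 'I_t -> V}) : rat := match c t with
  | inl b => ev c (v (inl b))
  | inr k => if insub k is Some k' then ev c (v (inr k')) else 0
  end.
have ev0 c : ev c 0 = 0.
  by have := ev_linear cb c (-1) 0 0; rewrite scaler0 addr0 mulN1r addNr.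
have ell (a b : hb) : ((inl a : hb + nat) == emb (inl b : hb + 'I_t)) = (b == a).
  by apply/eqP/eqP=> [[->]|->].
have elr (a : hb) (k : 'I_t) : ((inl a : hb + nat) == emb (inr k)) = false by [].
have erl (i : nat) (b : hb) : ((inr i : hb + nat) == emb (inl b : hb + 'I_t)) = false by [].
have err (i : nat) (k : 'I_t) : ((inr i : hb + nat) == emb (inr k)) = (val k == i).
  by apply/eqP/eqP=> [[->]|/= <-].
exists delta', ev'; split.
- move=> c k v w; rewrite /ev'; case: (c t) => [b|i].
    by rewrite !ffunE (ev_linear cb).
  by case: insub => [i'|]; rewrite ?ffunE ?(ev_linear cb) // mulr0 addr0.
- move=> c c' E; apply/ffunP=> y; rewrite !ffunE E //.
  by rewrite (delta_ext cb (c' := c')) // => j jt; apply: E; apply: ltnW.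
- move=> c a z; rewrite ltnS leq_eqVlt => /orP[/eqP->|a_t] c0.
    (* Labelling the last point: its label is still 1, and multiplying by [z] moves the vector from
       the component of 1 to that of [z]. *)
    have ct : c t = inl ord0 by apply: c0; rewrite leqnn ltnSn.
    have dE : delta (update c t (inl z)) = delta c.
      by apply: (delta_ext cb) => j jt; rewrite /update ltn_eqF.
    have ut : update c t (inl z) t = inl z by rewrite /update eqxx.
    apply/ffunP=> -[b|k]; rewrite [in RHS]ffunE [in LHS]ffunE eqxx dE ut ?ell ?elr.
      rewrite (bigD1 (ord0 : hb)) //= ffunE ct ell eqxx cst0l big1 ?addr0.
        by case: (b == z); rewrite ?scale1r ?scale0r.
      by move=> a' /negPf a'0; rewrite ffunE ct ell a'0 scaler0.
    by rewrite ffunE ct elr Q0 scaler0.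
  have ct : c t = inl ord0 by apply: c0; rewrite ltnSn ltnW.
  have ut : update c a (inl z) t = inl ord0 by rewrite /update gtn_eqF.
  have dE : Q a z (delta c) = delta (update c a (inl z)).
    apply: (deltaQ cb) => // j /andP[aj jt]; apply: c0; by rewrite aj ltnW.
  apply/ffunP=> -[b|k]; rewrite [in RHS]ffunE [in LHS]ffunE ut (ltn_eqF a_t) ffunE ct ?ell ?elr.
    have [->|_] := eqVneq b ord0; last by rewrite Q0 scaler0.
    by rewrite sg20 scale1r dE.
  by rewrite Q0 scaler0.
- move=> c i j /andP[ij]; rewrite ltnS leq_eqVlt => /orP[/eqP jt|j_t] cj cl.
    (* The edge ends at the last point, whose label is 1: only the term of label 1 enters
       [attach_sum], and its value lands in the component of [i]. *)
    subst j; exists 1; rewrite ?mulr1 // scale1r /extG eqxx (ltn_eqF ij).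
    have dE : delta (update c t (inr i)) = delta c.
      by apply: (delta_ext cb) => l lt; rewrite /update ltn_eqF.
    have ut : update c t (inr i) t = inr i by rewrite /update eqxx.
    apply/ffunP=> -[b|k]; rewrite [in RHS]ffunE [in LHS]ffunE dE ut ?erl ?err //.
    rewrite ffunE cj elr G0 subr0; case: (val k == i) => //.
    rewrite /attach_sum (bigD1 (ord0 : hb)) //= ffunE cj ell eqxx.
    rewrite (opQ_one ops) // !big1 ?addr0 // => [l _|b /negPf b0].
      by rewrite ffunE cj elr G0.
    by rewrite ffunE cj ell b0 Q0.
  have [b ctb] : exists b, c t = inl b by apply: cl; rewrite j_t ltnSn.
  have [eps eps2 dE] : exists2 eps : rat, eps * eps = 1 &
      G i j (delta c) = eps *: delta (update c j (inr i)).
    apply: (deltaG cb) => //; first by rewrite ij.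
    by move=> l /andP[jl lt]; apply: cl; rewrite jl ltnW.
  (* The factor [sg b] comes from passing the edge across the label [b] of the last point. *)
  exists (sg b * eps); first by rewrite mulrACA sg_sq eps2 mulr1.
  have i_t := ltn_trans ij j_t; rewrite /extG (ltn_eqF i_t) (ltn_eqF j_t).
  have ut : update c j (inr i) t = inl b by rewrite /update gtn_eqF.
  apply/ffunP=> y; rewrite [RHS]ffunE [delta' _ _]ffunE ut.
  case: y => [b'|k]; rewrite ffunE ffunE ctb ?ell ?elr.
    have [->|_] := eqVneq b' b; last by rewrite G0 !scaler0.
    by rewrite dE scalerA.
  by rewrite G0 oppr0 scaler0.
- move=> c cP; have cP' : forall j k, (j < t)%N -> c j = inr k -> (k < j)%N.
    by move=> j k jt; apply: cP; apply: ltnW.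
  rewrite /ev'; case ct: (c t) => [b|k]; first by rewrite ffunE ct eqxx (ev_diag cb).
  have kt : (k < t)%N by apply: cP ct.
  by rewrite insubT ffunE ct /= eqxx (ev_diag cb).
- move=> c c' evn j; have key : c t = c' t /\ ev c (delta c') != 0.
    move: evn; rewrite /ev'; case: (c t) => [b|k].
      rewrite ffunE; have [-> //|_] := eqVneq (c' t) (emb (inl b : hb + 'I_t)).
      by rewrite ev0 eqxx.
    case: insubP => [k' _ <-|_]; last by rewrite eqxx.
    rewrite ffunE; have [-> //|_] := eqVneq (c' t) (emb (inr k' : hb + 'I_t)).
    by rewrite ev0 eqxx.
  rewrite ltnS leq_eqVlt => /orP[/eqP->|]; first by case: key.
  by apply: (ev_off cb); case: key.
Qed.

Lemma exists_code_basis t : exists (V : lmodType rat) (Q : nat -> hb -> V -> V) G delta ev,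
  kriz_ops t Q G /\ code_basis t Q G delta ev.
Proof.
elim: t => [|t [V [Q [G [delta [ev [ops cb]]]]]]]; last first.
  have [delta' [ev' cb']] := ext_code_basis ops cb.
  exists ({ffun hb + 'I_t -> V} : lmodType rat), (extQ (t := t) Q), (extG (t := t) Q G), delta', ev'.
  by split=> //; apply: ext_ops.
exists (rat^o : lmodType rat), (fun _ _ v => v), (fun _ _ _ => 0), (fun _ => 1), (fun _ v => v).
split; split=> //; try by [].
  by move=> i j k u v; rewrite scaler0 addr0.
by move=> c i j; rewrite ltn0 andbF.
Qed.

End CodeBasis.

(** * Matrix coefficients on a free algebra and on its quotients *)

Section FreeAction.
Local Open Scope ring_scope.
Variables (I : choiceType) (V : lmodType rat) (op : I -> V -> V).
Implicit Types (u : free_alg I) (psi : V -> rat).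

Definition act_word (w : seq I) (v : V) : V := foldl (fun v i => op i v) v w.

Lemma act_word_cat w1 w2 v : act_word (w1 ++ w2) v = act_word w2 (act_word w1 v).
Proof. exact: foldl_cat. Qed.

(* The matrix coefficient of the right action of the free algebra on V. *)
Definition coefficient psi (v : V) (u : free_alg I) : rat :=
  mmap idfun (fun w : {fmonom I} => psi (act_word w v)) u.

Fact coefficient_linear psi v : linear_for *%R (coefficient psi v).
Proof.
move=> c u u'; rewrite /coefficient; set h := fun w => _.
rewrite (raddfD (mmap idfun h)); congr (_ + _); change (free_alg I) with {malg rat[{fmonom I}]} in u.
rewrite [LHS](mmapEw (msuppZ_le c u)) mmapE big_distrr /=.
by apply: eq_bigr => w _; rewrite mcoeffZ mulrA.
Qed.
HB.instance Definition _ psi v :=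
  GRing.isLinear.Build rat (free_alg I) rat *%R (coefficient psi v)
    (coefficient_linear psi v).

Definition word (w : seq I) : free_alg I := \prod_(i <- w) free_gen i.

Lemma wordE w : word w = << FMonom w >>.
Proof.
rewrite /word; elim: w => [|i w IHw]; first by rewrite big_nil -fmoneE.
rewrite big_cons IHw unlock malgM_def fgmulUU mulr1; congr mkmalgU.
by apply/eqP; rewrite fmP fmM fmU.
Qed.

Lemma word_cat w1 w2 : word (w1 ++ w2) = word w1 * word w2.
Proof. exact: big_cat. Qed.

Lemma coefficient_word psi v w : coefficient psi v (word w) = psi (act_word w v).
Proof. by rewrite wordE /coefficient mmapU /= mul1r. Qed.

Lemma free_alg_words u : exists (s : seq (rat * seq I)), u = \sum_(x <- s) x.1 *: word x.2.
Proof.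
rewrite [u]monalgE; exists [seq (u@_w, w : seq I) | w <- finmap.enum_fset (msupp u)].
rewrite big_map; apply: eq_bigr => w _ /=.
by apply/malgP=> k; rewrite wordE fmK mcoeffZ !mcoeffU mulrnAr mulr1.
Qed.

Lemma coefficient_context psi v w1 w2 u :
  coefficient psi v (word w1 * u * word w2) =
  coefficient (fun v' => psi (act_word w2 v')) (act_word w1 v) u.
Proof.
have [s ->] := free_alg_words u; rewrite mulr_sumr mulr_suml !linear_sum /=.
apply: eq_bigr => x _; rewrite -scalerAr -scalerAl !linearZ /= -!word_cat.
by rewrite !coefficient_word !act_word_cat.
Qed.

Variable R : free_alg I -> free_alg I -> Prop.
Hypothesis op_linear : forall i, linear (op i).
Hypothesis R_op : forall r s, R r s -> forall psi v, linear_for *%R psi ->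
  coefficient psi v r = coefficient psi v s.

Lemma act_word_linear w : linear (act_word w).
Proof.
elim: w => [|i w IHw] c u v //=.
by rewrite op_linear; apply: IHw.
Qed.

(** The action is on the right, so words of [a] act on [v] first and words of [b] are absorbed into
    the functional. Quantifying over all vectors and functionals makes the vanishing stable under
    two-sided multiplication. *)
Lemma coefficient_mul_eq0 (a b u : free_alg I) :
    (forall psi v, linear_for *%R psi -> coefficient psi v u = 0) ->
  forall psi v, linear_for *%R psi -> coefficient psi v (a * u * b) = 0.
Proof.
move=> u0 psi v psiL; have [s aE] := free_alg_words a; have [s' bE] := free_alg_words b.
have aM w : a * w = \sum_(x <- s) x.1 *: (word x.2 * w).
  by rewrite aE mulr_suml; apply: eq_bigr => x _; rewrite scalerAl.
have bM w : w * b = \sum_(x <- s') x.1 *: (w * word x.2).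
  by rewrite bE mulr_sumr; apply: eq_bigr => x _; rewrite scalerAr.
rewrite bM linear_sum big1 // => y _; rewrite linearZ /= -mulrA aM linear_sum big1 ?mulr0 //.
move=> x _; rewrite linearZ /= mulrA coefficient_context u0 ?mulr0 //.
by move=> c w w'; rewrite act_word_linear psiL.
Qed.

Lemma coefficient_ideal u : rel_ideal R u -> forall psi v, linear_for *%R psi ->
  coefficient psi v u = 0.
Proof.
elim=> {u} [r s rs psi v psiL|psi v _|u u' _ IHu _ IHu' psi v psiL|a b u _ IHu psi v psiL].
- by rewrite linearB /= (R_op rs) // subrr.
- exact: linear0.
- by rewrite linearD /= IHu // IHu' // addr0.
exact: coefficient_mul_eq0.
Qed.

End FreeAction.

(** * The operators satisfy the relations of the Kriz model *)

Section KrizAction.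
Local Open Scope ring_scope.
Variables (m n : nat) (X : cohomology m) (B : homogeneous_basis X).
Local Notation hb := (hb_index B).
Variables (V : lmodType rat) (Q : nat -> hb -> V -> V) (G : nat -> nat -> V -> V).
Hypothesis ops : kriz_ops n Q G.
Implicit Types (i j k : 'I_n) (x y : X) (v : V) (psi : V -> rat).

HB.instance Definition _ i z :=
  GRing.isLinear.Build rat V V *:%R (Q i z) (opQ_linear ops i z).
HB.instance Definition _ i j :=
  GRing.isLinear.Build rat V V *:%R (G i j) (opG_linear ops i j).

Definition opP (i : nat) x v : V := \sum_u hb_coord u x *: Q i u v.

Definition kriz_op (g : kriz_gen n X) v : V :=
  match g with inl (i, x) => opP i x v | inr (i, j) => G i j v end.

Lemma opP_basis i z v : opP i (B z) v = Q i z v.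
Proof.
rewrite /opP (bigD1 z) //= hb_coordE eqxx scale1r big1 ?addr0 // => u uz.
by rewrite hb_coordE (negPf uz) scale0r.
Qed.

Lemma kriz_op_linear g : linear (kriz_op g).
Proof.
case: g => [[i x]|[i j]] c u v /=; last exact: opG_linear ops _ _ _ _ _.
rewrite /opP scaler_sumr -big_split; apply: eq_bigr => z _ /=.
by rewrite linearP scalerDr !scalerA mulrC.
Qed.

Let opP_lin i c x y v : opP i (c *: x + y) v = c *: opP i x v + opP i y v.
Proof.
rewrite /opP scaler_sumr -big_split; apply: eq_bigr => z _ /=.
by rewrite hb_coord_linear scalerDl scalerA.
Qed.

Let opP_one i v : opP i 1 v = v.
Proof. by rewrite -(hb_one B) opP_basis (opQ_one ops). Qed.

Let opP_mul i x y v : opP i (x * y) v = opP i y (opP i x v).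
Proof.
rewrite /opP; under [RHS]eq_bigr => w _ do rewrite linear_sum scaler_sumr.
have xyE (b : hb) : hb_coord b (x * y) =
    \sum_w \sum_z hb_coord w y * hb_coord z x * cst z w b.
  rewrite {1}[x](hb_coordP B) {1}[y](hb_coordP B) mulr_sumr linear_sum /=.
  apply: eq_bigr => w _; rewrite mulr_suml linear_sum /=; apply: eq_bigr => z _.
  by rewrite -scalerAr -scalerAl !linearZ /= mulrA.
under [LHS]eq_bigr => b _ do rewrite xyE scaler_suml.
rewrite exchange_big; apply: eq_bigr => w _ /=.
under [LHS]eq_bigr => b _ do rewrite scaler_suml.
rewrite exchange_big; apply: eq_bigr => z _ /=.
rewrite [Q i w (_ *: _)]linearZ_LR /= scalerA (opQ_mul ops) // scaler_sumr.
by apply: eq_bigr => b _; rewrite scalerA.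
Qed.

Let opP_comm i j a b x y v : x \in coh X a -> y \in coh X b ->
  opP j y (opP i x v) = (-1) ^+ (a * b) *: opP i x (opP j y v).
Proof.
move=> xa yb; rewrite /opP; under [LHS]eq_bigr => w _ do rewrite linear_sum scaler_sumr.
under [in RHS]eq_bigr => w _ do rewrite linear_sum scaler_sumr.
rewrite exchange_big scaler_sumr; apply: eq_bigr => z _ /=.
rewrite scaler_sumr; apply: eq_bigr => w _ /=.
rewrite !linearZ /= (opQ_comm ops) // !scalerA; congr (_ *: _).
have [za|za] := eqVneq (hb_deg z) a; last first.
  by rewrite (hb_coord_deg xa za) !(mul0r, mulr0).
have [wb|wb] := eqVneq (hb_deg w) b; last first.
  by rewrite (hb_coord_deg yb wb) !(mul0r, mulr0).
rewrite /sg2 za wb; ring.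
Qed.

Let opP_G i j k a x v : x \in coh X a ->
  opP k x (G i j v) = (-1) ^+ a *: G i j (opP k x v).
Proof.
move=> xa; rewrite /opP linear_sum scaler_sumr; apply: eq_bigr => z _ /=.
rewrite linearZ /= (opGQ ops) // !scalerA; congr (_ *: _).
have [<-|za] := eqVneq (hb_deg z) a; last first.
  by rewrite (hb_coord_deg xa za) !(mul0r, mulr0).
by rewrite mulrAC -/(sg z) sg_sq mul1r.
Qed.

Let G_P i j x v : G i j (opP j x v) = G i j (opP i x v).
Proof.
rewrite /opP !linear_sum; apply: eq_bigr => z _ /=.
by rewrite !linearZ /= (opQG ops).
Qed.

Local Notation cf := (coefficient kriz_op).

Let cf1 psi v g : cf psi v (free_gen g) = psi (kriz_op g v).
Proof.
rewrite -[free_gen g]mulr1 -(coefficient_word kriz_op psi v [:: g]).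
by rewrite /word big_cons big_nil.
Qed.

Let cf2 psi v g g' : cf psi v (free_gen g * free_gen g') = psi (kriz_op g' (kriz_op g v)).
Proof.
rewrite -(coefficient_word kriz_op psi v [:: g; g']).
by rewrite /word !big_cons big_nil mulr1.
Qed.

Let cf_one psi v : cf psi v 1 = psi v.
Proof. by rewrite -(coefficient_word kriz_op psi v [::]) /word big_nil. Qed.

Let cfS psi v (d : nat) (u : free_alg (kriz_gen n X)) :
  cf psi v ((-1) ^+ d * u) = (-1) ^+ d * cf psi v u.
Proof.
rewrite -signr_odd -[in RHS]signr_odd !mulr_sign; case: (odd d) => //.
by rewrite linearN.

Qed.

Lemma kriz_rel_op r s : kriz_rel (@free_p m n X) (@free_G m n X) r s ->
  forall psi v, linear_for *%R psi -> cf psi v r = cf psi v s.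
Proof.
move=> rs psi v psiL.
have psi0 : psi 0 = 0.
  by have := psiL (-1) 0 0; rewrite scaler0 addr0 mulN1r addNr.
have psiZ c w : psi (c *: w) = c * psi w.
  by rewrite -[c *: w]addr0 psiL psi0 addr0.
have psiN w : psi (- w) = - psi w by rewrite -scaleN1r psiZ mulN1r.
case: rs => [i c x y|i|i x y|i j a b x y xa yb|i j k a x xa|i j k l|i j|i|i j
            |i j x ij|i j k ijk].
- by rewrite linearP /= !cf1 /= opP_lin psiL.
- by rewrite cf1 cf_one /= opP_one.
- by rewrite cf1 cf2 /= opP_mul.
- apply: etrans (cf2 psi v (inl (i, x)) (inl (j, y))) _.
  by rewrite cfS cf2 /= (opP_comm _ _ _ xa yb) psiZ.
- apply: etrans (cf2 psi v (inr (i, j)) (inl (k, x))) _.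
  by rewrite cfS cf2 /= (opP_G _ _ _ _ xa) psiZ.
- apply: etrans (cf2 psi v (inr (i, j)) (inr (k, l))) _.
  by rewrite linearN /= cf2 /= (opG_anti ops) // psiN.
- apply: etrans (cf2 psi v (inr (i, j)) (inr (i, j))) _.
  rewrite linear0 /=; suff -> : G i j (G i j v) = 0 by [].
  (* Anticommuting with itself, the operator has a square equal to its opposite, hence 0 over the
     rationals. *)
  have /eqP := opG_anti ops v (ltn_ord i) (ltn_ord j) (ltn_ord i) (ltn_ord j).
  by rewrite -addr_eq0 -mulr2n -scaler_nat scaler_eq0 => /orP[//|/eqP].
- by rewrite cf1 linear0 /= (opG_diag ops).
- apply: etrans (cf1 psi v (inr (j, i))) _; rewrite cf1 /=.
  by rewrite (opG_sym ops).
- apply: etrans (cf2 psi v (inl (j, x)) (inr (i, j))) _; rewrite cf2 /=.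
  by rewrite G_P.
- apply: etrans (cf2 psi v (inr (i, k)) (inr (j, k))) _; rewrite linearB /=.
  rewrite (cf2 psi v (inr (i, j)) (inr (j, k))) (cf2 psi v (inr (i, j)) (inr (i, k))) /=.
  have psiB w w' : psi (w - w') = psi w - psi w'.
    by rewrite addrC -scaleN1r psiL mulN1r addrC.
  rewrite -psiB; congr psi; have := opG_cyc ops v (ltn_ord i) (ltn_ord j) (ltn_ord k).
  rewrite [G k i (G j k v)](opG_sym ops) // [G k i v](opG_sym ops) //.
  rewrite [G i j (G i k v)](opG_anti ops) // [G i k (G j k v)](opG_anti ops) //.
  by rewrite addrAC => /eqP; rewrite subr_eq0 => /eqP.
Qed.

End KrizAction.

(** * Coordinates dual to the canonical monomials *)

Section KrizCoordinates.
Local Open Scope ring_scope.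
Variables (m n : nat) (X : cohomology m) (B : homogeneous_basis X).
Local Notation hb := (hb_index B).
Local Notation E := (kriz n X).
Implicit Types (h : 'I_n -> hb) (e : seq ('I_n * 'I_n)) (i j : 'I_n).

Definition label h (j : nat) : hb := if insub j is Some i then h i else ord0.

Lemma labelE h i : label h i = h i.
Proof. by rewrite /label valK. Qed.

(** All vertices first carry their labels; each edge then overwrites the entry of its target, in the
    order in which the monomial acts. *)
Definition code h e : nat -> hb + nat :=
  foldl (fun c (ij : 'I_n * 'I_n) => update c ij.2 (inr (val ij.1)))
    (fun j : nat => inl (label h j)) e.

Lemma code_rcons h e ij : code h (rcons e ij) = update (code h e) ij.2 (inr (val ij.1)).
Proof. by rewrite /code foldl_rcons. Qed.

Lemma code_root h e i : i \notin targets e -> code h e i = inl (h i).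
Proof.
elim/last_ind: e => [|e ij IHe]; first by rewrite /code /= labelE.
rewrite /targets map_rcons mem_rcons inE negb_or => /andP[ne /IHe {}IHe].
by rewrite code_rcons /update val_eqE (negPf ne).
Qed.

Lemma code_edge h e : uniq (targets e) -> forall ij, ij \in e ->
  code h e ij.2 = inr (val ij.1).
Proof.
elim/last_ind: e => [|e kl IHe] //; rewrite /targets map_rcons rcons_uniq.
case/andP=> kle /IHe {}IHe ij; rewrite mem_rcons inE code_rcons /update => /orP[/eqP->|ije].
  by rewrite eqxx.
rewrite val_eqE ifN ?IHe //; apply: contraNneq kle => <-; exact: map_f.
Qed.

Definition monomial_word h e : seq (kriz_gen n X) :=
  [seq (inl (a, B (h a)) : kriz_gen n X) | a <- enum 'I_n]
  ++ [seq (inr ij : kriz_gen n X) | ij <- e].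

Lemma canonical_monomialE h e :
  canonical_monomial h e = kriz_proj (word (monomial_word h e)).
Proof.
rewrite /word big_cat !big_map [RHS]rmorphM; congr (_ * _); last first.
  by rewrite rmorph_prod; apply: eq_bigr => -[i j] _.
by rewrite rmorph_prod [index_enum _]unlock.
Qed.

Variables (V : lmodType rat) (Q : nat -> hb -> V -> V) (G : nat -> nat -> V -> V).
Variables (delta : (nat -> hb + nat) -> V) (ev : (nat -> hb + nat) -> V -> rat).
Hypothesis ops : kriz_ops n Q G.
Hypothesis cb : code_basis n Q G delta ev.
Local Notation op := (kriz_op Q G).

Let c0 : nat -> hb + nat := fun _ => inl ord0.

Lemma act_labels h :
  act_word op [seq (inl (a, B (h a)) : kriz_gen n X) | a <- enum 'I_n] (delta c0)
  = delta (fun j : nat => inl (label h j)).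
Proof.
pose c (k : nat) (j : nat) : hb + nat := inl (if (j < k)%N then label h j else ord0).
suff H k : (k <= n)%N ->
    act_word op [seq (inl (a, B (h a)) : kriz_gen n X) | a <- take k (enum 'I_n)]
      (delta c0) = delta (c k).
  have := H n (leqnn n); rewrite take_oversize ?size_enum_ord // => ->.
  by apply: (delta_ext cb) => j; rewrite /c => ->.
elim: k => [|k IHk] kn; first by rewrite take0; apply: (delta_ext cb).
rewrite (take_nth (Ordinal kn)) ?size_enum_ord // map_rcons /act_word foldl_rcons.
rewrite -/(act_word op _ _) IHk 1?ltnW // /kriz_op opP_basis.
have -> : nth (Ordinal kn) (enum 'I_n) k = Ordinal kn.
  by apply: val_inj; rewrite /= nth_enum_ord.
rewrite (deltaQ cb) //; last by move=> j /andP[kj _]; rewrite /c ltnNge kj.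
apply: (delta_ext cb) => j _; rewrite /update /c ltnS [(j <= k)%N]leq_eqVlt /=.
have [->|_] := eqVneq j k; last by [].
by rewrite -(labelE h (Ordinal kn)).
Qed.

(** The targets increase along a canonical list, so when an edge ending at [j] acts, [j] carries 1
    and all later vertices still carry labels, as [deltaG] requires. *)
Lemma act_edges h e : canonical_edges e -> (forall j, j \in targets e -> h j = ord0) ->
  exists2 eps : rat, eps * eps = 1 &
    act_word op [seq (inr ij : kriz_gen n X) | ij <- e] (delta (fun j : nat => inl (label h j)))
    = eps *: delta (code h e).
Proof.
elim/last_ind: e => [|e [i j] IHe]; first by exists 1; rewrite ?mulr1 // scale1r.
move=> ce ht; have := canonical_targets_uniq ce.
rewrite /targets map_rcons rcons_uniq => /andP[je _].
have [ce' ij lt_j] := canonical_edges_rcons ce.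
have [|eps eps2 IH] := IHe ce'.
  by move=> k ke; apply: ht; rewrite /targets map_rcons mem_rcons inE ke orbT.
have [|||eps' eps'2 H] := deltaG cb (c := code h e) (i := i) (j := j).
- by rewrite ij ltn_ord.
- by rewrite code_root // ht // /targets map_rcons mem_rcons mem_head.
- move=> l /andP[jl ln]; exists (h (Ordinal ln)); apply: (@code_root h e (Ordinal ln)).
  by apply/negP=> /lt_j /=; rewrite ltnNge ltnW.
exists (eps * eps'); first by rewrite mulrACA eps2 eps'2 mulr1.
rewrite map_rcons /act_word foldl_rcons -/(act_word op _ _) IH code_rcons /=.
have G0 : G i j 0 = 0.
  by have := opG_linear ops i j (-1) 0 0; rewrite scaler0 addr0 scaleN1r addNr.
by have := opG_linear ops i j eps (delta (code h e)) 0; rewrite G0 !addr0 H scalerA => ->.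
Qed.

(** This takes the [code h e] coordinate of the image under [x] of the vector of the empty monomial;
    as matrix coefficients vanish on the ideal, it is independent of the representative
    ([kriz_coord_proj]). *)
Definition kriz_coord h e (x : E) : rat :=
  coefficient op (ev (code h e)) (delta c0) (repr x).

Lemma kriz_coord_proj h e u :
  kriz_coord h e (kriz_proj u) = coefficient op (ev (code h e)) (delta c0) u.
Proof.
apply/eqP; rewrite -subr_eq0 /kriz_coord -linearB; apply/eqP.
have Iu : rel_ideal (kriz_rel (@free_p m n X) (@free_G m n X)) (repr (kriz_proj u) - u).
  exact/rel_predP/repr_rel.
apply: (coefficient_ideal (kriz_op_linear ops) _ Iu _ (ev_linear cb _)).
by move=> r s rs psi v psiL; apply: (kriz_rel_op ops).
Qed.

Lemma kriz_coord_linear h e : linear_for *%R (kriz_coord h e).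
Proof.
move=> c; elim/kriz_ind=> u; elim/kriz_ind=> v.
have -> : c *: kriz_proj u + kriz_proj v = kriz_proj (c *: u + v).
  by rewrite linearP.
by rewrite !kriz_coord_proj linearP.
Qed.

Lemma kriz_coord_monomial h e h' e' : is_canonical h' e' ->
  exists2 eps : rat, eps * eps = 1 &
    kriz_coord h e (canonical_monomial h' e') = eps * ev (code h e) (delta (code h' e')).
Proof.
case/is_canonicalP=> ce ht; have [eps eps2 H] := act_edges ce ht.
exists eps => //; rewrite canonical_monomialE kriz_coord_proj coefficient_word.
rewrite act_word_cat act_labels H -[eps *: _]addr0 (ev_linear cb).
by have := ev_linear cb (code h e) (-1) 0 0; rewrite scaler0 addr0 mulN1r addNr => ->; rewrite addr0.
Qed.

Lemma kriz_coord_diag h e : is_canonical h e ->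
  kriz_coord h e (canonical_monomial h e) != 0.
Proof.
move=> ceh; have [eps eps2 ->] := kriz_coord_monomial h e ceh.
have [ce _] := is_canonicalP _ _ ceh.
rewrite (ev_diag cb) ?mulr1; first by apply/eqP=> e0; move: eps2; rewrite e0 mul0r => /eqP.
move=> j k jn ek; have jE : j = val (Ordinal jn) by [].
have jt : Ordinal jn \in targets e.
  by apply/negPn/negP=> /(code_root h); rewrite -jE ek.
have /mapP[ij ije jij] := jt; move: ek; rewrite jE jij (code_edge _ (canonical_targets_uniq ce)) //.
by case=> <-; have /andP[/allP/(_ _ ije)] := ce.
Qed.

(** The code shows the targets, the source of each edge and the labels of the roots. Targets carry
    1, and a canonical list is sorted, so its set of edges determines it. *)
Lemma code_inj h e h' e' : is_canonical h e -> is_canonical h' e' ->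
  (forall j, code h e j = code h' e' j) -> h =1 h' /\ e = e'.
Proof.
case/is_canonicalP=> ce ht /is_canonicalP[ce' ht'] codeE.
have sub f g f' g' : canonical_edges g -> canonical_edges g' ->
    (forall j : 'I_n, code f g j = code f' g' j) -> {subset g <= g'}.
  move=> cg cg' gE [i j] ijg; have := code_edge f (canonical_targets_uniq cg) ijg.
  rewrite gE /=; have [/mapP[[i' j'] ije' /= ->]|jg'] := boolP (j \in targets g').
    by rewrite (code_edge _ (canonical_targets_uniq cg') ije') => -[/val_inj <-].
  by rewrite code_root.
have ee' : e =i e'.
  by move=> ij; apply/idP/idP; [apply: (sub h e h' e') | apply: (sub h' e' h e)].
have tt' : targets e =i targets e' by apply: eq_mem_map.
split.
  move=> a; have [at_|at_] := boolP (a \in targets e).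
    by rewrite ht // ht' // -tt'.
  by have := codeE a; rewrite !code_root -?tt' // => -[].
have srt g : canonical_edges g -> sorted (fun ij kl : 'I_n * 'I_n => (ij.2 < kl.2)%N) g.
  by case/andP=> _; rewrite sorted_map.
apply: (irr_sorted_eq _ _ (srt _ ce) (srt _ ce')) => //.
- by move=> ij kl uv; apply: ltn_trans.
by move=> ij; apply: ltnn.
Qed.

Lemma kriz_coord_off h e h' e' : is_canonical h e -> is_canonical h' e' ->
  kriz_coord h e (canonical_monomial h' e') != 0 -> h =1 h' /\ e = e'.
Proof.
move=> ceh ceh'; have [eps eps2 ->] := kriz_coord_monomial h e ceh'.
rewrite mulf_eq0 negb_or => /andP[_ /(ev_off cb) codeE].
by apply: code_inj => // j; apply: codeE.
Qed.

End KrizCoordinates.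

(** * Independence of the subspaces of types *)

Section KrizDirect.
Local Open Scope ring_scope.
Local Open Scope classical_set_scope.
Variables (m n : nat) (X : cohomology m) (B : homogeneous_basis X).
Local Notation hb := (hb_index B).
Local Notation E := (kriz n X).
Implicit Types (h : 'I_n -> hb) (e : seq ('I_n * 'I_n)) (T : kriz_type n B).

Lemma exists_kriz_coord : exists coord : ('I_n -> hb) -> seq ('I_n * 'I_n) -> E -> rat,
  [/\ forall h e, linear_for *%R (coord h e),
      forall h e, is_canonical h e -> coord h e (canonical_monomial h e) != 0
    & forall h e h' e', is_canonical h e -> is_canonical h' e' ->
        coord h e (canonical_monomial h' e') != 0 -> h = h' /\ e = e'].
Proof.
have [V [Q [G [delta [ev [ops cb]]]]]] := exists_code_basis B n.
exists (kriz_coord Q G delta ev); split=> [h e|h e|h e h' e' ch ch' ne].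
- exact: (kriz_coord_linear ops cb).
- exact: (kriz_coord_diag ops cb).
by have [/funext] := kriz_coord_off ops cb ch ch' ne.
Qed.

Variable coord : ('I_n -> hb) -> seq ('I_n * 'I_n) -> E -> rat.
Hypothesis coord_linear : forall h e, linear_for *%R (coord h e).
Hypothesis coord_diag : forall h e, is_canonical h e ->
  coord h e (canonical_monomial h e) != 0.
Hypothesis coord_off : forall h e h' e', is_canonical h e -> is_canonical h' e' ->
  coord h e (canonical_monomial h' e') != 0 -> h = h' /\ e = e'.

HB.instance Definition _ h e :=
  GRing.isLinear.Build rat E rat *%R (coord h e) (coord_linear h e).

Local Notation key := (('I_n -> hb) * seq ('I_n * 'I_n))%type.
Local Notation monomials := [set u : E | exists h e, is_canonical h e /\ u = canonical_monomial h e].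

Let term (k : key) (v : E) : E :=
  (coord k.1 k.2 v / coord k.1 k.2 (canonical_monomial k.1 k.2)) *: canonical_monomial k.1 k.2.

(** The expansion holds over every sufficiently large list of distinct keys, so that expansions of
    two vectors can be added over a common list. *)
Lemma kriz_expansion v : lspan monomials v -> exists K : seq key,
  {in K, forall k, is_canonical k.1 k.2} /\
  forall K', uniq K' -> {in K', forall k, is_canonical k.1 k.2} -> {subset K <= K'} ->
    v = \sum_(k <- K') term k v.
Proof.
move: v; apply: lspan_min; first split.
- by exists [::]; split=> // K' _ _ _; rewrite big1 // => k _; rewrite /term linear0 mul0r scale0r.
- move=> a u v [K [Kc Ku]] [L [Lc Lv]]; exists (K ++ L); split.
    by move=> k; rewrite mem_cat => /orP[/Kc|/Lc].
  move=> K' K'u K'c sK.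
  rewrite {1}(Ku K') // => [|k kK]; last by apply: sK; rewrite mem_cat kK.
  rewrite {1}(Lv K') // => [|k kK]; last by apply: sK; rewrite mem_cat kK orbT.
  rewrite scaler_sumr -big_split; apply: eq_bigr => k _ /=.
  by rewrite /term coord_linear scalerA -scalerDl mulrDl mulrA.
move=> _ [h [e [ce ->]]]; exists [:: (h, e)]; split=> [k|K' K'u K'c sK].
  by rewrite inE => /eqP->.
have he : (h, e) \in K' by apply: sK; rewrite mem_head.
rewrite (bigD1_seq (h, e)) //= {1}/term /= mulfV ?coord_diag // scale1r.
rewrite big_seq_cond big1 ?addr0 // => -[h' e'] /andP[kK ne]; rewrite /term /=.
have [-> | nz] := eqVneq (coord h' e' (canonical_monomial h e)) 0.
  by rewrite mul0r scale0r.
by have [/= hh ee] := coord_off (K'c _ kK) ce nz; rewrite hh ee eqxx in ne.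
Qed.

Lemma kriz_coord_eq0 v : lspan monomials v ->
  (forall h e, is_canonical h e -> coord h e v = 0) -> v = 0.
Proof.
move=> /kriz_expansion[K [Kc Kv]] v0; rewrite (Kv (undup K)) ?undup_uniq //.
- rewrite big_seq big1 // => k; rewrite mem_undup => /Kc kc.
  by rewrite /term v0 // mul0r scale0r.
- by move=> k; rewrite mem_undup => /Kc.
by move=> k; rewrite mem_undup.
Qed.

Lemma type_space_coord T u h e : kriz_type_space T u -> is_canonical h e ->
  ~~ has_type T h e -> coord h e u = 0.
Proof.
move=> Tu ce nT; move: u Tu; apply: (@lspan_min _ _ [set u | coord h e u = 0]).
  split=> /= [|a u v u0 v0]; first exact: linear0.
  by rewrite coord_linear u0 v0 mulr0 addr0.
move=> _ /= [h' [e' [ce' hT ->]]]; apply/eqP/negPn/negP => ne.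
have [hh ee] := coord_off ce ce' ne; subst h' e'.
by move: nT; rewrite /has_type hT.
Qed.

(** A canonical monomial has only one type, so each coordinate sees at most one summand of the
    relation; all coordinates of each [u T] therefore vanish. *)
Lemma type_space_independent (P : pred (kriz_type n B)) (u : kriz_type n B -> E) :
  (forall T, P T -> kriz_type_space T (u T)) -> \sum_(T | P T) u T = 0 ->
  forall T, P T -> u T = 0.
Proof.
move=> uT u0 T PT; apply: kriz_coord_eq0 => [|h e ce].
  by apply: lspan_sub (uT T PT) => _ [h [e [ce _ ->]]]; apply: mem_lspan; exists h, e.
have [hT|nT] := boolP (has_type T h e); last exact: type_space_coord (uT T PT) ce nT.
have := congr1 (coord h e) u0; rewrite linear0 linear_sum (bigD1 T) //=.
rewrite big1 ?addr0 // => T' /andP[PT' T'T].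
apply: type_space_coord (uT T' PT') ce _.
by apply: contra T'T => hT'; apply/eqP/(type_unique hT' hT).
Qed.

End KrizDirect.

(** * The decomposition *)

Section KrizDecomposition.
Local Open Scope ring_scope.
Local Open Scope classical_set_scope.
Variables (m n : nat) (X : cohomology m) (B : homogeneous_basis X).
Local Notation E := (kriz n X).
Implicit Types (x : E) (T : kriz_type n B).

Lemma kriz_act_word s w : kriz_act s (kriz_proj (word w)) =
  kriz_proj (word [seq kriz_gen_act s g | g <- w] : free_alg (kriz_gen n X)).
Proof.
rewrite kriz_actE /word big_map rmorph_prod; congr kriz_proj.
by apply: eq_bigr => g _; apply: free_lift_gen.
Qed.

Lemma kriz_words x : exists c : seq (rat * seq (kriz_gen n X)),
  x = \sum_(a <- c) a.1 *: kriz_proj (word a.2).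
Proof.
elim/kriz_ind: x => u; have [c ->] := free_alg_words u; exists c.
by rewrite linear_sum; apply: eq_bigr => a _; rewrite linearZ_LR.
Qed.

Lemma kriz_act1 x : kriz_act 1 x = x.
Proof.
have [c ->] := kriz_words x; rewrite linear_sum; apply: eq_bigr => a _ /=.
rewrite linearZ_LR /= kriz_act_word; congr (_ *: kriz_proj (word _)).
rewrite -[RHS]map_id; apply: eq_map => -[[i y]|[i j]] /=; by rewrite !perm1.
Qed.

Lemma kriz_actM s t x : kriz_act s (kriz_act t x) = kriz_act (t * s)%g x.
Proof.
have [c ->] := kriz_words x; rewrite !linear_sum; apply: eq_bigr => a _ /=.
rewrite !linearZ_LR /= !kriz_act_word; congr (_ *: kriz_proj (word _)).
by rewrite -map_comp; apply: eq_map => -[[i y]|[i j]] /=; rewrite !permM.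
Qed.

(** Straightening keeps the number of edges and the expansion of coefficients keeps the total
    degree, so canonical monomials of the given bidegree span. *)
Lemma kriz_component_canonical (q k : nat) : @kriz_component m n X q k =
  lspan [set u | exists (h : 'I_n -> hb_index B) e, [/\ is_canonical h e, size e = q,
    (\sum_a hb_deg (h a) + q * (2 * m - 1))%N = k & u = canonical_monomial h e]].
Proof.
apply/seteqP; split; last first.
  apply: lspan_sub => _ [h [e [ce se <- ->]]]; apply: mem_lspan.
  exists (fun a => hb_deg (h a)), (fun a => B (h a)).
  have/eqP se' := se; exists (Tuple se'); split=> // a; exact: hb_coh.
apply: lspan_sub => _ [d [x [e [xd <- ->]]]].
set W := lspan _; have sW : is_subspace W := lspan_subspace _.
apply: (lspan_mull sW _ (gprod_straight X e)) => _ [e' [ce' se' _ ->]].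
apply: (lspan_min sW) (canonical_span B ce' xd) => _ [h [ch hd ->]].
apply: mem_lspan; exists h, e'; split=> //; first by rewrite se' size_tuple.
by rewrite hd.
Qed.

(** Rank and degree of a type are those of each monomial of that type ([type_rankE], [type_degE]),
    so sorting the canonical monomials of the component by type gives the sum. *)
Lemma kriz_component_direct_sum (q k : nat) :
  is_direct_sum [pred T : kriz_type n B |
      (type_rank T == q) && (type_deg T + q * (2 * m - 1) == k)%N]
    (@kriz_type_space m n X B) (@kriz_component m n X q k).
Proof.
have [coord [cL cD cO]] := exists_kriz_coord n B.
split; [by move=> T _; apply: type_space_subspace | | exact: type_space_independent cL cD cO _].
rewrite kriz_component_canonical; apply/seteqP; split; last first.
  move=> _ [u uT ->]; apply: subspace_sum => [|T /= PT]; first exact: lspan_subspace.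
  apply: lspan_sub (uT T PT) => _ [h [e [ce hT ->]]]; apply: mem_lspan.
  have /andP[/eqP rT /eqP dT] := PT.
  exists h, e; split=> //; first by rewrite -(type_rankE ce hT).
  by rewrite -(type_degE ce hT).
apply: lspan_min.
  split=> [|a _ _ [u uT ->] [v vT ->]].
    exists (fun _ => 0) => [T _|]; last by rewrite big1.
    by apply: subspace0; apply: type_space_subspace.
  exists (fun T => a *: u T + v T) => [T PT|].
    by have [_ H] := type_space_subspace T; apply: H; [apply: uT | apply: vT].
  by rewrite scaler_sumr -big_split.
move=> _ [h [e [ce se hd ->]]]; have [T0 hT] := exists_type ce.
have PT0 : (type_rank T0 == q) && (type_deg T0 + q * (2 * m - 1) == k)%N.
  by rewrite (type_rankE ce hT) (type_degE ce hT) se hd !eqxx.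
exists (fun T => if T == T0 then canonical_monomial h e else 0) => [T _|].
  have [->|_] := eqVneq T T0; last by apply: subspace0; apply: type_space_subspace.
  by apply: mem_lspan; exists h, e.
by rewrite (bigD1 T0) //= eqxx big1 ?addr0 // => T /andP[_ /negPf ->].
Qed.

End KrizDecomposition.

Theorem theorem2p13 (m n : nat) (hm : 1 <= m) (hn : 1 <= n)
    (X : cohomology m) (B : homogeneous_basis X) (q k : nat) :
  let types := [pred T : kriz_type n B |
                  (type_rank T == q) &&
                  (type_deg T + q * (2 * m - 1) == k)] in
  is_direct_sum types (@kriz_type_space m n X B) (@kriz_component m n X q k) /\
  forall T : kriz_type n B, types T ->
    [/\ is_monogenic (@kriz_act m n X) (kriz_type_space T),
        exists mu : intpart n -> nat,
          has_multiplicities (@kriz_act m n X) (kriz_type_space T) mu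
      & forall mu : intpart n -> nat,
          has_multiplicities (@kriz_act m n X) (kriz_type_space T) mu ->
          forall lam : intpart n, mu lam <= \dim (specht lam)].
Proof.
split=> [|T _]; first exact: kriz_component_direct_sum.
have mono := type_space_monogenic T; have [_ [g _ gE]] := mono.
have lin s : linear (@kriz_act m n X s) by move=> c u v; apply: linearP.
split=> [//||mu].
  exact: monogenic_multiplicities lin (@kriz_act1 _ _ _) (@kriz_actM _ _ _) _ _ gE.
exact: (monogenic_multiplicity_le lin (@kriz_actM _ _ _) gE).
Qed.
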